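(* Let $\mathbb{K}$ be a field of characteristic $0$ and let $G$ be a finite abelian group acting diagonally on the finite dimensional $\mathbb{K}$-vector space $V$ with respect to a basis $v_1,\dots,v_n$. Let $\mathcal{H}_{\mathbf{q},\kappa}$, with $\kappa:V\times V\to V\otimes\mathbb{K}G$, be a corresponding quantum Drinfeld orbifold algebra for which the strong vanishing condition holds. Then $\mathcal{H}_{\mathbf{q},\kappa}$ is a braided Hopf algebra, that is, a Hopf algebra in the category $\mathcal{C}$ of $A/N$-graded $\mathbb{K}G$-bimodules with monoidal product $\otimes_{\mathbb{K}G}$, graded morphisms, and braiding $\tau$, as described in the context.
   Context: Conventions: $\otimes=\otimes_{\mathbb{K}}$; $\mathbb{N}$ contains $0$; ${}^gv_i=\chi_i(g)v_i$ with linear characters $\chi_i:G\to\mathbb{K}^*$. A quantum system of parameters is $\mathbf{q}=\{q_{ij}\}_{1\le i,j\le n}\subset\mathbb{K}^*$ with $q_{ii}=1$, $q_{ji}=q_{ij}^{-1}$. A parameter function is a bilinear map $\kappa:V\times V\to V\otimes\mathbb{K}G$ with $\kappa(v_i,v_j)=-q_{ij}\kappa(v_j,v_i)$; write $\kappa(v_i,v_j)=\sum_{r,g}c_r^{ijg}\,v_r\otimes g$. The skew group algebra $T(V)\rtimes G$ is $T(V)\otimes\mathbb{K}G$ with product $(r\,g)(s\,h)=r({}^gs)\,gh$, and $\mathcal{H}_{\mathbf{q},\kappa}=(T(V)\rtimes G)/(v_iv_j-q_{ij}v_jv_i-\kappa(v_i,v_j):1\le i,j\le n)$. It is a quantum Drinfeld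 orbifold algebra if it satisfies the PBW property: the image of $\{v_1^{m_1}\cdots v_n^{m_n}g:m_i\in\mathbb{N},g\in G\}$ is a $\mathbb{K}$-basis. Strong vanishing condition: for all $g\in G$ and all $1\le i,j,k,r\le n$ (not necessarily distinct), ${}^gv_k=q_{ik}q_{jk}q_{kr}\,v_k$ whenever $c_r^{ijg}\ne0$. Grading: $A=\mathbb{Z}^n\times G$, with $|v_i|=(a_i,1_G)$ ($a_1,\dots,a_n$ the standard basis of $\mathbb{Z}^n$), $|g|=(0,g)$. $N$ is the subgroup of $A$ generated by all $|v_i||v_j||v_r|^{-1}|g|^{-1}$ with $c_r^{ijg}\neq0$. There is an antisymmetric bicharacter $\epsilon:A/N\times A/N\to\mathbb{K}^*$ satisfying $\epsilon(|v_i||g|,|v_j||h|)=q_{ij}\chi_j(g)\chi_i^{-1}(h)$ for $g,h\in G$, $1\le i,j\le n$ (antisymmetric means $\epsilon(b,a)=\epsilon(a,b)^{-1}$). $\mathbb{K}G$ is graded by $A/N$ through the classes of $|g|$, and $\mathcal{H}_{\mathbf{q},\kappa}$ is graded by $A/N$ with $v_i$ and $g$ in the degrees given by the classes of $|v_i|$ and $|g|$. The category $\mathcal{C}$: objects are $A/N$-graded $\mathbb{K}G$-bimodules; morphisms are graded bimodule maps; the monoidal product is $\otimes_{\mathbb{K}G}$; the braiding is $\tau(v\otimes_{\mathbb{K}G}w)=\epsilon(|v|,|w|)\,w\otimes_{\mathbb{K}G}v$ for homogeneous $v,w$. A Hopf algebra in a $\mathbb{K}$-linear symmetric monoidal category is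 an object of it with unit, multiplication, counit, comultiplication and antipode maps, all morphisms in the category, satisfying the standard Hopf algebra properties. *)

(* Defs.v *)
From HB Require Import structures.
From mathcomp Require Import all_boot all_order all_algebra.
From mathcomp Require Import boolp finmap monalg.

Set Implicit Arguments.
Unset Strict Implicit.
Unset Printing Implicit Defensive.

Import GRing.Theory.
Local Open Scope ring_scope.
Local Open Scope quotient_scope.


Inductive zspan (V : zmodType) (S : V -> Prop) : V -> Prop :=
| zspan_gen x of S x : zspan S x
| zspan0 : zspan S 0
| zspanB x y of zspan S x & zspan S y : zspan S (x - y).

Inductive lspan (K : fieldType) (V : lmodType K) (S : V -> Prop) : V -> Prop :=
| lspan_gen x of S x : lspan S x
| lspan0 : lspan S 0
| lspanP a x y of lspan S x & lspan S y : lspan S (a *: x + y).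

Inductive ideal_span (A : nzRingType) (S : A -> Prop) : A -> Prop :=
| ideal_gen x of S x : ideal_span S x
| ideal0 : ideal_span S 0
| idealD x y of ideal_span S x & ideal_span S y : ideal_span S (x + y)
| idealMl a x of ideal_span S x : ideal_span S (a * x)
| idealMr a x of ideal_span S x : ideal_span S (x * a).

(* Membership is not decidable in general, hence the classical [asbool]. *)
Definition zspan_pred (V : zmodType) (S : V -> Prop) : V -> bool :=
  fun x => `[< zspan S x >].

Definition lspan_pred (K : fieldType) (V : lmodType K) (S : V -> Prop)
  : V -> bool := fun x => `[< lspan S x >].

Definition ideal_pred (A : nzRingType) (S : A -> Prop) : A -> bool :=
  fun x => `[< ideal_span S x >].

Lemma zspan_pred_closed (V : zmodType) (S : V -> Prop) :
  zmod_closed (zspan_pred S).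
Proof.
split=> [|x y]; first by apply/asboolP; exact: zspan0.
by move=> /asboolP Sx /asboolP Sy; apply/asboolP; exact: zspanB.
Qed.

HB.instance Definition _ (V : zmodType) (S : V -> Prop) :=
  GRing.isZmodClosed.Build V (zspan_pred S) (zspan_pred_closed S).

Lemma lspan_pred_closed (K : fieldType) (V : lmodType K) (S : V -> Prop) :
  submod_closed (lspan_pred S).
Proof.
split=> [|a x y]; first by apply/asboolP; exact: lspan0.
by move=> /asboolP Sx /asboolP Sy; apply/asboolP; exact: lspanP.
Qed.

HB.instance Definition _ (K : fieldType) (V : lmodType K) (S : V -> Prop) :=
  GRing.isSubmodClosed.Build K V (lspan_pred S) (lspan_pred_closed S).

Lemma ideal_pred_closed (K : fieldType) (A : algType K) (S : A -> Prop) :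
  submod_closed (ideal_pred S).
Proof.
split=> [|a x y]; first by apply/asboolP; exact: ideal0.
move=> /asboolP Sx /asboolP Sy; apply/asboolP; apply: idealD => //.
by rewrite -[x]mul1r scalerAl; exact: idealMl.
Qed.

HB.instance Definition _ (K : fieldType) (A : algType K) (S : A -> Prop) :=
  GRing.isSubmodClosed.Build K A (ideal_pred S) (ideal_pred_closed S).

Definition zspan_zmod (V : zmodType) (S : V -> Prop) : zmodClosed V :=
  GRing.ZmodClosed.clone V (zspan_pred S) _.
Definition lspan_submod (K : fieldType) (V : lmodType K) (S : V -> Prop)
  : submodClosed V := GRing.SubmodClosed.clone K V (lspan_pred S) _.
Definition ideal_submod (K : fieldType) (A : algType K) (S : A -> Prop)
  : submodClosed A := GRing.SubmodClosed.clone K A (ideal_pred S) _.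

Section LinearQuotient.
Variables (K : fieldType) (V : lmodType K) (I : submodClosed V).

Definition submod_pred : V -> bool := fun x => x \in I.

Lemma submod_pred_closed : zmod_closed submod_pred.
Proof.
have inE' x : (x \in submod_pred) = (x \in I) by [].
split=> [|x y]; rewrite !inE' ?rpred0 // => Ix Iy.
by rewrite -scaleN1r rpredD // rpredZ.
Qed.

HB.instance Definition _ :=
  GRing.isZmodClosed.Build V submod_pred submod_pred_closed.

Definition lquot := Quotient.quot (GRing.ZmodClosed.clone V submod_pred _).
HB.instance Definition _ := GRing.Zmodule.on lquot.


Definition lpi (x : V) : lquot := \pi_lquot x.

Lemma lpi_eq x y : lpi x = lpi y <-> x - y \in I.
Proof.
have -> : (x - y \in I) = (x == y %[mod lquot]).
  exact: (Quotient.idealrBE (GRing.ZmodClosed.clone V submod_pred _) x y).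
by split=> [e|/eqP //]; apply/eqP.
Qed.

Lemma lpi_repr (x : lquot) : lpi (repr x) = x.
Proof. exact: reprK x. Qed.

Lemma lpiB : zmod_morphism lpi.
Proof. by move=> x y; exact: (raddfB \pi_(Quotient.quot (GRing.ZmodClosed.clone V submod_pred _))). Qed.

HB.instance Definition _ := GRing.isZmodMorphism.Build V lquot lpi lpiB.

Definition lquot_scale (a : K) (x : lquot) : lquot := lpi (a *: repr x).

Lemma lquot_scaleE a x : lquot_scale a (lpi x) = lpi (a *: x).
Proof.
apply/lpi_eq; rewrite -scalerBr rpredZ //.
by apply/lpi_eq; rewrite lpi_repr.
Qed.

Lemma lquot_scaleA a b x :
  lquot_scale a (lquot_scale b x) = lquot_scale (a * b) x.
Proof. by rewrite -[x]lpi_repr !lquot_scaleE scalerA. Qed.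

Lemma lquot_scale1 : left_id 1 lquot_scale.
Proof. by move=> x; rewrite -[x]lpi_repr lquot_scaleE scale1r. Qed.

Lemma lquot_scaleDr : right_distributive lquot_scale +%R.
Proof.
move=> a x y; rewrite -[x]lpi_repr -[y]lpi_repr -raddfD !lquot_scaleE.
by rewrite scalerDr raddfD.
Qed.

Lemma lquot_scaleDl x : {morph lquot_scale^~ x : a b / a + b}.
Proof.
by move=> a b; rewrite -[x]lpi_repr /= !lquot_scaleE scalerDl raddfD.
Qed.

HB.instance Definition _ := GRing.Zmodule_isLmodule.Build K lquot
  lquot_scaleA lquot_scale1 lquot_scaleDr lquot_scaleDl.

Lemma lpiZ : scalable lpi.
Proof. by move=> a x; rewrite -[RHS]/(lquot_scale a (lpi x)) lquot_scaleE. Qed.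

HB.instance Definition _ := GRing.isScalable.Build K V lquot *:%R lpi lpiZ.

Variables (W : lmodType K) (f : {linear V -> W}).
Hypothesis fI : forall x, x \in I -> f x = 0.

Definition lquot_lift (x : lquot) : W := f (repr x).

Lemma lquot_liftE x : lquot_lift (lpi x) = f x.
Proof.
apply/eqP; rewrite -subr_eq0 -raddfB /= fI //.
by apply/lpi_eq; rewrite lpi_repr.
Qed.

Lemma lquot_lift_linear : linear lquot_lift.
Proof.
move=> a x y; rewrite -[x]lpi_repr -[y]lpi_repr -linearP !lquot_liftE.
by rewrite linearP.
Qed.

End LinearQuotient.

Arguments lquot_lift {K V I W} f x.

Section AlgebraQuotient.
Variables (K : fieldType) (A : algType K) (S : A -> Prop).

(* A / (S), for the two-sided ideal (S); it is only a [pzRingType] together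
   with a [lmodType K], because [algType] would require it to be nonzero. *)
Definition aquot := lquot (ideal_submod S).
HB.instance Definition _ := GRing.Lmodule.on aquot.

Definition api : A -> aquot := @lpi K A (ideal_submod S).
HB.instance Definition _ := GRing.Linear.on api.

Definition aquot_one : aquot := api 1.
Definition aquot_mul (x y : aquot) : aquot := api (repr x * repr y).

Lemma api_repr (x : aquot) : api (repr x) = x.
Proof. exact: lpi_repr. Qed.

Lemma aquot_mulE x y : aquot_mul (api x) (api y) = api (x * y).
Proof.
set x' := repr (api x); set y' := repr (api y).
have Ix : x' - x \in ideal_submod S by apply/lpi_eq; exact: api_repr.
have Iy : y' - y \in ideal_submod S by apply/lpi_eq; exact: api_repr.
apply/lpi_eq; rewrite -/x' -/y'.
have -> : x' * y' - x * y = (x' - x) * y' + x * (y' - y).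
  by rewrite mulrBl mulrBr addrA subrK.
by apply/asboolP; apply: idealD;
  [apply: idealMr; exact/asboolP|apply: idealMl; exact/asboolP].
Qed.

Lemma aquot_mulA : associative aquot_mul.
Proof.
move=> x y z; rewrite -[x]api_repr -[y]api_repr -[z]api_repr.
by rewrite !aquot_mulE mulrA.
Qed.

Lemma aquot_mul1 : left_id aquot_one aquot_mul.
Proof. by move=> x; rewrite -[x]api_repr aquot_mulE mul1r. Qed.

Lemma aquot_mulr1 : right_id aquot_one aquot_mul.
Proof. by move=> x; rewrite -[x]api_repr aquot_mulE mulr1. Qed.

Lemma aquot_mulDl : left_distributive aquot_mul +%R.
Proof.
move=> x y z; rewrite -[x]api_repr -[y]api_repr -[z]api_repr.
by rewrite -raddfD !aquot_mulE mulrDl raddfD.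
Qed.

Lemma aquot_mulDr : right_distributive aquot_mul +%R.
Proof.
move=> x y z; rewrite -[x]api_repr -[y]api_repr -[z]api_repr.
by rewrite -raddfD !aquot_mulE mulrDr raddfD.
Qed.

HB.instance Definition _ := GRing.Zmodule_isPzRing.Build aquot
  aquot_mulA aquot_mul1 aquot_mulr1 aquot_mulDl aquot_mulDr.

Lemma api_monoid_morphism : monoid_morphism api.
Proof. by split=> // x y; rewrite -aquot_mulE. Qed.

HB.instance Definition _ :=
  GRing.isMonoidMorphism.Build A aquot api api_monoid_morphism.

Lemma aquot_scalerAl (a : K) (x y : aquot) : a *: (x * y) = (a *: x) * y.
Proof.
rewrite -[x]api_repr -[y]api_repr -rmorphM -!linearZ /= -rmorphM.
by rewrite -scalerAl.
Qed.

Lemma aquot_scalerAr (a : K) (x y : aquot) : a *: (x * y) = x * (a *: y).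
Proof.
rewrite -[x]api_repr -[y]api_repr -rmorphM -!linearZ /= -rmorphM.
by rewrite -scalerAr.
Qed.

End AlgebraQuotient.


(* Groups, including the finite group G below, are written additively. *)
Record lin_char (G : zmodType) (K : fieldType) := LinChar {
  lchar :> G -> K;
  lchar0 : lchar 0 = 1;
  lcharD : forall g h, lchar (g + h) = lchar g * lchar h
}.

Record alg_action (K : fieldType) (A : algType K) (G : zmodType) := AlgAction {
  gact :> G -> A -> A;
  gact_linear : forall g, linear (gact g);
  gact_monoid : forall g, monoid_morphism (gact g);
  gact0 : forall x, gact 0 x = x;
  gactD : forall g h x, gact (g + h) x = gact g (gact h x)
}.

Section SkewGroupAlgebra.
Variables (K : fieldType) (A : algType K) (G : finZmodType).
Variable alpha : alg_action A G.

HB.instance Definition _ g := GRing.isLinear.Build K A A *:%R (alpha g)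
  (gact_linear alpha g).
HB.instance Definition _ g := GRing.isMonoidMorphism.Build A A (alpha g)
  (gact_monoid alpha g).

(* A \otimes KG, where f stands for \sum_g (f g) g. *)
Definition skew of alg_action A G := {ffun G -> A}.
Local Notation AG := (skew alpha).
HB.instance Definition _ := GRing.Lmodule.on AG.

Definition skew_el (a : A) (g : G) : AG := [ffun k => if k == g then a else 0].

Definition skew_one : AG := skew_el 1 0.

(* (a g) (b h) = a (g.b) (g h). *)
Definition skew_mul (f h : AG) : AG :=
  [ffun k => \sum_g f g * alpha g (h (k - g))].

Lemma skew_mulA : associative skew_mul.
Proof.
move=> f h l; apply/ffunP=> k; rewrite !ffunE.
under [RHS]eq_bigr => g _ do rewrite ffunE mulr_suml.
under [LHS]eq_bigr => g _ do rewrite ffunE raddf_sum mulr_sumr.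
rewrite [RHS]exchange_big /=; apply: eq_bigr => b _.
rewrite [RHS](reindex_inj (addrI b)) /=; apply: eq_bigr => c _.
rewrite rmorphM mulrA /= -gactD; congr (_ * alpha b (h _) * alpha _ (l _)).
  by rewrite addrAC subrr add0r.
by rewrite opprD addrA.
Qed.

Lemma skew_mul1 : left_id skew_one skew_mul.
Proof.
move=> f; apply/ffunP=> k; rewrite !ffunE (bigD1 0) //= big1 ?addr0.
  by rewrite ffunE eqxx mul1r gact0 subr0.
by move=> g /negbTE g0; rewrite ffunE g0 mul0r.
Qed.

Lemma skew_mulr1 : right_id skew_one skew_mul.
Proof.
move=> f; apply/ffunP=> k; rewrite !ffunE (bigD1 k) //= big1 ?addr0.
  by rewrite ffunE subrr eqxx rmorph1 mulr1.
move=> g /negbTE gk; rewrite ffunE subr_eq0 eq_sym gk.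
by rewrite raddf0 mulr0.
Qed.

Lemma skew_mulDl : left_distributive skew_mul +%R.
Proof.
move=> f h l; apply/ffunP=> k; rewrite !ffunE -big_split /=.
by apply: eq_bigr => g _; rewrite ffunE mulrDl.
Qed.

Lemma skew_mulDr : right_distributive skew_mul +%R.
Proof.
move=> f h l; apply/ffunP=> k; rewrite !ffunE -big_split /=.
by apply: eq_bigr => g _; rewrite ffunE raddfD mulrDr.
Qed.

Lemma skew_one_neq0 : skew_one != 0.
Proof.
by apply/eqP => /ffunP /(_ 0) /eqP; rewrite !ffunE eqxx oner_eq0.
Qed.

HB.instance Definition _ := GRing.Zmodule_isNzRing.Build AG
  skew_mulA skew_mul1 skew_mulr1 skew_mulDl skew_mulDr skew_one_neq0.

Lemma skew_scalerAl (a : K) (f h : AG) : a *: (f * h) = (a *: f) * h.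
Proof.
apply/ffunP=> k; rewrite !ffunE scaler_sumr.
by apply: eq_bigr => g _; rewrite ffunE scalerAl.
Qed.

HB.instance Definition _ :=
  GRing.Lmodule_isLalgebra.Build K AG skew_scalerAl.

Lemma skew_scalerAr (a : K) (f h : AG) : a *: (f * h) = f * (a *: h).
Proof.
apply/ffunP=> k; rewrite !ffunE scaler_sumr.
by apply: eq_bigr => g _; rewrite ffunE linearZ scalerAr.
Qed.

HB.instance Definition _ := GRing.Lalgebra_isAlgebra.Build K AG skew_scalerAr.

Lemma skew_el_linear g : linear (skew_el^~ g).
Proof.
move=> a x y; apply/ffunP=> k; rewrite !ffunE.
by case: ifP; rewrite ?scaler0 ?addr0.
Qed.

Lemma skew_elE (f : AG) : f = \sum_g skew_el (f g) g.
Proof.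
apply/ffunP=> k; rewrite sum_ffunE (bigD1 k) //= big1 ?addr0.
  by rewrite ffunE eqxx.
by move=> g /negbTE gk; rewrite ffunE eq_sym gk.
Qed.

Lemma skew_elM a b g h :
  skew_el a g * skew_el b h = skew_el (a * alpha g b) (g + h).
Proof.
apply/ffunP=> k; rewrite !ffunE (bigD1 g) //= big1 ?addr0; last first.
  by move=> l /negbTE lg; rewrite ffunE lg mul0r.
rewrite !ffunE eqxx subr_eq [h + g]addrC.
by case: ifP; rewrite ?raddf0 ?mulr0.
Qed.

End SkewGroupAlgebra.

Section GroupAlgebra.
Variables (K : fieldType) (G : finZmodType).

Lemma trivial_act_linear (g : G) : linear (@id K^o).
Proof. by []. Qed.

Lemma trivial_act_monoid (g : G) : monoid_morphism (@id K^o).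
Proof. by []. Qed.

Definition trivial_action : alg_action K^o G :=
  @AlgAction K K^o G (fun=> id) trivial_act_linear trivial_act_monoid
    (fun=> erefl) (fun _ _ _ => erefl).

(* KG, as the skew group algebra of the trivial action on K. *)
Definition group_alg := skew trivial_action.
HB.instance Definition _ := GRing.Algebra.on group_alg.

Definition group_el (g : G) : group_alg := skew_el trivial_action 1 g.

Variables (A : algType K) (alpha : alg_action A G).

Definition group_alg_in (f : group_alg) : skew alpha := [ffun g => (f g)%:A].

Lemma group_alg_in_linear : linear group_alg_in.
Proof.
by move=> a f h; apply/ffunP=> g; rewrite !ffunE scalerDl scalerA.
Qed.

Lemma group_alg_in_monoid : monoid_morphism group_alg_in.
Proof.
split; first by apply/ffunP=> g; rewrite !ffunE; case: ifP;
  rewrite ?scale1r ?scale0r.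
move=> f h; apply/ffunP=> k; rewrite !ffunE scaler_suml.
apply: eq_bigr => g _; rewrite !ffunE linearZ rmorph1 /=.
by rewrite -scalerAl mul1r scalerA.
Qed.

Lemma group_alg_in_el g : group_alg_in (group_el g) = skew_el alpha 1 g.
Proof.
by apply/ffunP=> k; rewrite !ffunE; case: ifP; rewrite ?scale1r ?scale0r.
Qed.

HB.instance Definition _ := GRing.isLinear.Build K group_alg (skew alpha) *:%R
  group_alg_in group_alg_in_linear.
HB.instance Definition _ := GRing.isMonoidMorphism.Build group_alg (skew alpha)
  group_alg_in group_alg_in_monoid.

End GroupAlgebra.


Section Twist.
Variables (M : monomType) (R : comNzRingType) (c : M -> R).

Lemma malg_scalerAr (a : R) (x y : {malg R[M]}) : a *: (x * y) = x * (a *: y).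
Proof.
apply/malgP=> k; rewrite mcoeffZ.
rewrite (mcoeffMlw k (fsubset_refl (msupp x)) (fsubset_refl (msupp y))).
rewrite (mcoeffMlw k (fsubset_refl (msupp x)) (msuppZ_le a y)).
rewrite mulr_sumr; apply: eq_bigr => u _; rewrite mulr_sumr.
by apply: eq_bigr => w _; rewrite mcoeffZ mulrnAr mulrCA.
Qed.

Definition malg_twist (x : {malg R[M]}) : {malg R[M]} :=
  \sum_(w <- msupp x) << c w * x@_w *g w >>.

Lemma malg_twistE x w : (malg_twist x)@_w = c w * x@_w.
Proof.
rewrite /malg_twist raddf_sum /=.
under eq_bigr => u _ do rewrite mcoeffU.
case: (msuppP x w) => xw; last first.
  rewrite mulr0 big_seq big1 // => u xu.
  by case: eqVneq => // uw; rewrite -uw xu in xw.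
rewrite (bigD1_seq w) ?fset_uniq //= eqxx big1 ?addr0 //.
by move=> u /negbTE ->.
Qed.

Lemma malg_twist_linear : linear malg_twist.
Proof.
move=> a x y; apply/malgP=> w.
rewrite mcoeffD mcoeffZ !malg_twistE mcoeffD mcoeffZ.
by rewrite mulrDr mulrCA.
Qed.

Lemma malg_twist_monoid : c mone = 1 ->
  (forall u w, c (mmul u w) = c u * c w) -> monoid_morphism malg_twist.
Proof.
move=> c1 cM; split; first by apply/malgP=> w; rewrite malg_twistE mcoeff1;
  case: eqVneq => [->|_]; rewrite ?c1 ?mulr1 ?mulr0.
move=> x y; apply/malgP=> k; rewrite malg_twistE.
have sub z : (msupp (malg_twist z) `<=` msupp z)%fset.
  apply/fsubsetP=> w; rewrite -!mcoeff_neq0 malg_twistE.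
  by apply: contraNneq => ->; rewrite mulr0.
rewrite (mcoeffMlw k (fsubset_refl (msupp x)) (fsubset_refl (msupp y))).
rewrite (mcoeffMlw k (sub x) (sub y)).
rewrite mulr_sumr; apply: eq_bigr => u _; rewrite mulr_sumr.
apply: eq_bigr => w _; rewrite !malg_twistE.
case: eqVneq => [<-|_]; last by rewrite !mulr0n mulr0.
by rewrite !mulr1n cM mulrACA.
Qed.

Lemma malg_twistU w : malg_twist << w >> = c w *: << w >>.
Proof.
apply/malgP=> k; rewrite malg_twistE mcoeffZ !mcoeffU.
by case: eqVneq => [->|]; rewrite ?mulr0.
Qed.

End Twist.

Lemma malg_twistM (M : monomType) (R : comNzRingType) (b c d : M -> R) :
  (forall w, d w = b w * c w) ->
  forall x, malg_twist d x = malg_twist b (malg_twist c x).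
Proof.
by move=> dE x; apply/malgP=> w; rewrite !malg_twistE dE mulrA.
Qed.

Section TensorAlgebra.
Variables (K : fieldType) (n : nat).

(* T(V), for V with basis v_0, ..., v_(n-1), as the free algebra on 'I_n. *)
Definition tensor_alg := {malg K[{fmonom 'I_n}]}.
HB.instance Definition _ := GRing.Lalgebra.on tensor_alg.
HB.instance Definition _ := GRing.Lalgebra_isAlgebra.Build K tensor_alg
  (@malg_scalerAr {fmonom 'I_n} K).

Definition tvar (i : 'I_n) : tensor_alg := << fmu i >>.

Variables (G : finZmodType) (chi : 'I_n -> lin_char G K).

Definition word_char (g : G) (w : {fmonom 'I_n}) : K :=
  \prod_(i <- fmonom_val w) chi i g.

Lemma word_char1 g : word_char g mone = 1.
Proof. by rewrite /word_char fm1 big_nil. Qed.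

Lemma word_charM g u w : word_char g (mmul u w) = word_char g u * word_char g w.
Proof. by rewrite /word_char fmM big_cat. Qed.

Definition tensor_act (g : G) (x : tensor_alg) : tensor_alg :=
  malg_twist (word_char g) x.

Lemma tensor_act0 x : tensor_act 0 x = x.
Proof.
apply/malgP=> w; rewrite malg_twistE /word_char big1 ?mul1r // => i _.
exact: lchar0.
Qed.

Lemma tensor_actD g h x : tensor_act (g + h) x = tensor_act g (tensor_act h x).
Proof.
apply: malg_twistM => w.
by rewrite /word_char -big_split; apply: eq_bigr => i _; rewrite lcharD.
Qed.

(* Multiplicative extension of the action g.v_i = chi_i(g) v_i. *)
Definition diag_action : alg_action tensor_alg G :=
  @AlgAction K tensor_alg G tensor_act
    (fun g => malg_twist_linear (word_char g))
    (fun g => malg_twist_monoid (word_char1 g) (word_charM g))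
    tensor_act0 tensor_actD.

Lemma diag_action_var g i : diag_action g (tvar i) = chi i g *: tvar i.
Proof.
rewrite /= /tensor_act malg_twistU; congr (_ *: _).
by rewrite /word_char fmU big_seq1.
Qed.

End TensorAlgebra.


Section LinearExtension.
Variables (K : fieldType) (I : choiceType) (W : lmodType K) (f : I -> W).

Definition malg_lift (x : {malg K[I]}) : W := \sum_(k <- msupp x) x@_k *: f k.

Lemma malg_liftEw (d : {fset I}) x : (msupp x `<=` d)%fset ->
  malg_lift x = \sum_(k <- d) x@_k *: f k.
Proof.
move=> le; rewrite /malg_lift (big_fset_incl _ le) //= => k _ /mcoeff_outdom ->.
by rewrite scale0r.
Qed.

Lemma malg_liftU k : malg_lift << k >> = f k.
Proof. by rewrite (malg_liftEw msuppU_le) big_seq_fset1 mcoeffUU scale1r. Qed.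

Lemma malg_lift_linear : linear malg_lift.
Proof.
move=> a x y; pose d := (msupp x `|` msupp y)%fset.
rewrite (malg_liftEw (d := d) (x := x)) ?fsubsetUl //.
rewrite (malg_liftEw (d := d) (x := y)) ?fsubsetUr //.
rewrite (malg_liftEw (d := d)); last first.
  exact: fsubset_trans (msuppD_le _ _) (fsetSU _ (msuppZ_le _ _)).
rewrite scaler_sumr -big_split; apply: eq_bigr => k _ /=.
by rewrite mcoeffD mcoeffZ scalerDl scalerA.
Qed.

HB.instance Definition _ := GRing.isLinear.Build K {malg K[I]} W *:%R
  malg_lift malg_lift_linear.

End LinearExtension.

Section LinearProp.
Variables (K : fieldType) (U W : lmodType K) (f : U -> W).
Hypothesis lf : linear f.

Lemma lin0 : f 0 = 0.
Proof. by have := lf (-1) 0 0; rewrite scaler0 addr0 scaleN1r addNr. Qed.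

Lemma linD x y : f (x + y) = f x + f y.
Proof. by have := lf 1 x y; rewrite !scale1r. Qed.

Lemma linZ a x : f (a *: x) = a *: f x.
Proof. by have := lf a x 0; rewrite lin0 !addr0. Qed.

End LinearProp.

Lemma lin_shuffle (K : fieldType) (W : lmodType K) (a b : K) (x y u w : W) :
  b *: (a *: x + y) + (a *: u + w) = a *: (b *: x + u) + (b *: y + w).
Proof. by rewrite !scalerDr !scalerA addrACA [a * b]mulrC. Qed.

Section Bimodules.
Variables (K : fieldType) (R : algType K).

(* R-bimodules on which K acts centrally. *)
Record bimod := Bimod {
  bcar :> lmodType K;
  lact : R -> bcar -> bcar;
  ract : bcar -> R -> bcar;
  lact_linear : forall r, linear (lact r);
  lact_linearl : forall m, linear (lact^~ m);
  ract_linear : forall m, linear (ract m);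
  ract_linearl : forall r, linear (ract^~ r);
  lact1 : forall m, lact 1 m = m;
  ract1 : forall m, ract m 1 = m;
  lactA : forall r s m, lact (r * s) m = lact r (lact s m);
  ractA : forall r s m, ract m (r * s) = ract (ract m r) s;
  lractA : forall r s m, ract (lact r m) s = lact r (ract m s)
}.

Lemma lact0 (M : bimod) r : lact r (0 : M) = 0.
Proof. exact: lin0 (lact_linear r). Qed.

Lemma ract0 (M : bimod) r : ract (0 : M) r = 0.
Proof. exact: lin0 (ract_linearl r). Qed.

Lemma lactP (M : bimod) r a (m m' : M) :
  lact r (a *: m + m') = a *: lact r m + lact r m'.
Proof. exact: lact_linear. Qed.

Lemma ractP (M : bimod) r a (m m' : M) :
  ract (a *: m + m') r = a *: ract m r + ract m' r.
Proof. exact: ract_linearl. Qed.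

Record bimap (M N : bimod) := Bimap {
  bfun :> M -> N;
  bfun_linear : linear bfun;
  bfunl : forall r m, bfun (lact r m) = lact r (bfun m);
  bfunr : forall r m, bfun (ract m r) = ract (bfun m) r
}.

Definition bimap_id (M : bimod) : bimap M M :=
  @Bimap M M id (fun _ _ _ => erefl) (fun _ _ => erefl) (fun _ _ => erefl).

Section Tensor.
Variables (M N : bimod).

Inductive tens_rel : {malg K[(M * N)%type]} -> Prop :=
| tens_relPl a m m' n :
    tens_rel (<< (a *: m + m', n) >> - (a *: << (m, n) >> + << (m', n) >>))
| tens_relPr a m n n' :
    tens_rel (<< (m, a *: n + n') >> - (a *: << (m, n) >> + << (m, n') >>))
| tens_relR r m n :
    tens_rel (<< (ract m r, n) >> - << (m, lact r n) >>).

Definition tcar : lmodType K := lquot (lspan_submod tens_rel).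

Fact tens_key : unit. Proof. exact: tt. Qed.

(* m \otimes n; locked because unification otherwise unfolds the quotient. *)
Definition tel : M -> N -> tcar := locked_with tens_key
  (fun m n => lpi (lspan_submod tens_rel) << (m, n) >>).

Lemma tel_def m n : tel m n = lpi (lspan_submod tens_rel) << (m, n) >>.
Proof. by rewrite /tel unlock_with. Qed.

Lemma tel_rel x y : tens_rel (x - y) ->
  lpi (lspan_submod tens_rel) x = lpi (lspan_submod tens_rel) y.
Proof. by move=> xy; apply/lpi_eq/asboolP; exact: lspan_gen. Qed.

Lemma tel_linearl n : linear (tel^~ n).
Proof.
by move=> a m m'; rewrite !tel_def (tel_rel (tens_relPl _ _ _ _)) linearP.
Qed.

Lemma tel_linearr m : linear (tel m).
Proof.
by move=> a n n'; rewrite !tel_def (tel_rel (tens_relPr _ _ _ _)) linearP.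
Qed.

Lemma telPl a m m' n : tel (a *: m + m') n = a *: tel m n + tel m' n.
Proof. exact: tel_linearl. Qed.

Lemma telPr a m n n' : tel m (a *: n + n') = a *: tel m n + tel m n'.
Proof. exact: tel_linearr. Qed.

Lemma tel0l n : tel 0 n = 0.
Proof. exact: lin0 (tel_linearl n). Qed.

Lemma tel0r m : tel m 0 = 0.
Proof. exact: lin0 (tel_linearr m). Qed.

Lemma telR r m n : tel (ract m r) n = tel m (lact r n).
Proof. by rewrite !tel_def; exact: tel_rel (tens_relR _ _ _). Qed.

Lemma tens_ind (P : tcar -> Prop) : P 0 ->
  (forall a m n t, P t -> P (a *: tel m n + t)) -> forall t, P t.
Proof.
move=> P0 PS t; rewrite -[t]lpi_repr; move: {t}(repr t) => x.
rewrite [x]monalgE raddf_sum; elim: (enum_fset (msupp x)) => [|[m n] s IHs].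
  by rewrite big_nil.
rewrite big_cons; set c := mcoeff _ _.
have -> : << c *g (m, n) >> = c *: (<< (m, n) >> : {malg K[(M * N)%type]}).
  by apply/malgP => k; rewrite mcoeffZ !mcoeffU mulrnAr mulr1.
by rewrite [X in X + _]linearZ /= -tel_def; exact: PS.
Qed.

Lemma tens_ext (W : lmodType K) (f h : tcar -> W) : linear f -> linear h ->
  (forall m n, f (tel m n) = h (tel m n)) -> f =1 h.
Proof.
move=> lf lh fh; elim/tens_ind => [|a m n t IHt]; first by rewrite !lin0.
by rewrite lf lh fh IHt.
Qed.

Record balanced (W : lmodType K) (f : M -> N -> W) : Prop := Balanced {
  bal_linearl : forall n, linear (f^~ n);
  bal_linearr : forall m, linear (f m);
  balR : forall r m n, f (ract m r) n = f m (lact r n)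
}.

Section Lift.
Variables (W : lmodType K) (f : M -> N -> W).
Hypothesis bf : balanced f.

Definition tlift_malg := malg_lift (fun p : M * N => f p.1 p.2).
HB.instance Definition _ := GRing.Linear.on tlift_malg.

Definition tlift : tcar -> W := locked_with tens_key (lquot_lift tlift_malg).

Lemma tlift_def : tlift = lquot_lift tlift_malg.
Proof. by rewrite /tlift unlock_with. Qed.

Lemma tlift_malg0 x : x \in lspan_submod tens_rel -> tlift_malg x = 0.
Proof.
move=> /asboolP; elim=> [{}x|| a {}x y _ x0 _ y0]; last 2 first.
- exact: raddf0.
- have -> : tlift_malg (a *: x + y) = a *: tlift_malg x + tlift_malg y.
    exact: malg_lift_linear.
  by rewrite x0 y0 scaler0 addr0.
have fE m n : tlift_malg << (m, n) >> = f m n by exact: malg_liftU.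
have fP a u v : tlift_malg (a *: u + v) = a *: tlift_malg u + tlift_malg v.
  exact: malg_lift_linear.
case=> [a m m' n|a m n n'|r m n]; rewrite raddfB /= ?fP !fE.
- by rewrite (bal_linearl bf n a m m') subrr.
- by rewrite (bal_linearr bf) subrr.
- by rewrite (balR bf) subrr.
Qed.

Lemma tliftE m n : tlift (tel m n) = f m n.
Proof.
rewrite tlift_def tel_def lquot_liftE; first exact: malg_liftU.
by move=> x; exact: tlift_malg0.
Qed.

Lemma tlift_linear : linear tlift.
Proof. by rewrite tlift_def; apply: lquot_lift_linear => x; exact: tlift_malg0. Qed.

End Lift.

Lemma lact_tel_bal r : balanced (fun m n => tel (lact r m) n).
Proof.
split=> [n a m m'|m a n n'|s m n].
- by rewrite lact_linear tel_linearl.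
- by rewrite tel_linearr.
- by rewrite -lractA telR.
Qed.

Lemma ract_tel_bal r : balanced (fun m n => tel m (ract n r)).
Proof.
split=> [n a m m'|m a n n'|s m n].
- by rewrite tel_linearl.
- by rewrite ract_linearl tel_linearr.
- by rewrite telR lractA.
Qed.

Definition tlact r : tcar -> tcar := tlift (fun m n => tel (lact r m) n).
Definition tract (t : tcar) r : tcar := tlift (fun m n => tel m (ract n r)) t.

Lemma tlactE r m n : tlact r (tel m n) = tel (lact r m) n.
Proof. exact: tliftE (lact_tel_bal r) m n. Qed.

Lemma tractE r m n : tract (tel m n) r = tel m (ract n r).
Proof. exact: tliftE (ract_tel_bal r) m n. Qed.

Lemma tlact_linear r : linear (tlact r).
Proof. exact: tlift_linear (lact_tel_bal r). Qed.

Lemma tract_linearl r : linear (tract^~ r).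
Proof. exact: tlift_linear (ract_tel_bal r). Qed.

Lemma tlactP r a m n t :
  tlact r (a *: tel m n + t) = a *: tel (lact r m) n + tlact r t.
Proof. by rewrite tlact_linear tlactE. Qed.

Lemma tractP r a m n t :
  tract (a *: tel m n + t) r = a *: tel m (ract n r) + tract t r.
Proof. by rewrite tract_linearl tractE. Qed.

Lemma tlact_linearl t : linear (tlact^~ t).
Proof.
move=> a r s; elim/tens_ind: t => [|b m n t IHt].
  by rewrite !(lin0 (tlact_linear _)) scaler0 addr0.
rewrite !tlact_linear !tlactE IHt lact_linearl tel_linearl.
exact: lin_shuffle.
Qed.

Lemma tract_linear t : linear (tract t).
Proof.
move=> a r s; elim/tens_ind: t => [|b m n t IHt].
  by rewrite !(lin0 (tract_linearl _)) scaler0 addr0.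
rewrite !(tract_linearl _ b) !tractE IHt ract_linear tel_linearr.
exact: lin_shuffle.
Qed.

Lemma tlact1 t : tlact 1 t = t.
Proof.
elim/tens_ind: t => [|b m n t IHt]; first by rewrite (lin0 (tlact_linear _)).
by rewrite tlact_linear tlactE lact1 IHt.
Qed.

Lemma tract1 t : tract t 1 = t.
Proof.
elim/tens_ind: t => [|b m n t IHt]; first by rewrite (lin0 (tract_linearl _)).
by rewrite tract_linearl tractE ract1 IHt.
Qed.

Lemma tlactA r s t : tlact (r * s) t = tlact r (tlact s t).
Proof.
elim/tens_ind: t => [|b m n t IHt]; first by rewrite !(lin0 (tlact_linear _)).
by rewrite !tlact_linear !tlactE lactA IHt.
Qed.

Lemma tractA r s t : tract t (r * s) = tract (tract t r) s.
Proof.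
elim/tens_ind: t => [|b m n t IHt]; first by rewrite !(lin0 (tract_linearl _)).
by rewrite !(tract_linearl _ b) !tractE ractA IHt.
Qed.

Lemma tlractA r s t : tract (tlact r t) s = tlact r (tract t s).
Proof.
elim/tens_ind: t => [|b m n t IHt].
  by rewrite !(lin0 (tlact_linear _), lin0 (tract_linearl _)).
by rewrite !(tlact_linear, tract_linearl _ b) !(tractE, tlactE) IHt.
Qed.

Definition tens : bimod :=
  Bimod tlact_linear tlact_linearl tract_linear tract_linearl
    tlact1 tract1 tlactA tractA tlractA.

Lemma tens_bimap (P : bimod) (f : tens -> P) : linear f ->
  (forall r m n, f (tel (lact r m) n) = lact r (f (tel m n))) ->
  (forall r m n, f (tel m (ract n r)) = ract (f (tel m n)) r) ->
  (forall r t, f (lact r t) = lact r (f t)) /\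
  (forall r t, f (ract t r) = ract (f t) r).
Proof.
move=> lf fl fr; split=> r; elim/tens_ind => [|a m n t IHt].
- by rewrite lact0 (lin0 lf) lact0.
- by rewrite /= tlactP [LHS]lf [in RHS]lf lactP -IHt fl.
- by rewrite ract0 (lin0 lf) ract0.
- by rewrite /= tractP [LHS]lf [in RHS]lf ractP -IHt fr.
Qed.

End Tensor.

Section TensorMap.
Variables (M M' N N' : bimod) (f : bimap M M') (h : bimap N N').

Lemma tmap_bal : balanced (fun m n => tel (f m) (h n)).
Proof.
split=> [n a m m'|m a n n'|s m n].
- by rewrite bfun_linear tel_linearl.
- by rewrite bfun_linear tel_linearr.
- by rewrite bfunr telR bfunl.
Qed.

Definition tmap_fun : tens M N -> tens M' N' :=
  tlift (fun m n => tel (f m) (h n)).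

Lemma tmap_funE m n : tmap_fun (tel m n) = tel (f m) (h n).
Proof. exact: tliftE tmap_bal m n. Qed.

Lemma tmap_linear : linear tmap_fun.
Proof. exact: tlift_linear tmap_bal. Qed.

Lemma tmap_bimap :
  (forall r t, tmap_fun (lact r t) = lact r (tmap_fun t)) /\
  (forall r t, tmap_fun (ract t r) = ract (tmap_fun t) r).
Proof.
apply: (tens_bimap tmap_linear) => r m n; rewrite !tmap_funE /=.
- by rewrite bfunl tlactE.
- by rewrite bfunr tractE.
Qed.

Definition tmap : bimap (tens M N) (tens M' N') :=
  Bimap tmap_linear tmap_bimap.1 tmap_bimap.2.

End TensorMap.

Section Associator.
Variables (M N P : bimod).

Lemma tassoc_bal1 (p : P) :
  balanced (fun (m : M) (n : N) => tel m (tel n p : tens N P)).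
Proof.
split=> [n a m m'|m a n n'|s m n].
- by rewrite tel_linearl.
- by rewrite (tel_linearl p) tel_linearr.
- by rewrite telR /= tlactE.
Qed.

Definition tassoc1 (t : tens M N) (p : P) : tens M (tens N P) :=
  tlift (fun (m : M) (n : N) => tel m (tel n p : tens N P)) t.

Lemma tassoc1E m n p : tassoc1 (tel m n) p = tel m (tel n p : tens N P).
Proof. exact: tliftE (tassoc_bal1 p) m n. Qed.

Lemma tassoc1_linear p : linear (tassoc1^~ p).
Proof. exact: tlift_linear (tassoc_bal1 p). Qed.

Lemma tassoc10 p : tassoc1 0 p = 0.
Proof. exact: lin0 (tassoc1_linear p). Qed.

Lemma tassoc1P a m n t p : tassoc1 (a *: tel m n + t) p =
  a *: tel m (tel n p : tens N P) + tassoc1 t p.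
Proof. by rewrite [LHS]tassoc1_linear tassoc1E. Qed.

Lemma tassoc_bal : balanced tassoc1.
Proof.
split=> [p|t|r t p]; first exact: tassoc1_linear.
- move=> a p p'; elim/tens_ind: t => [|b m n t IHt].
    by rewrite !tassoc10 scaler0 addr0.
  rewrite !tassoc1P IHt !tel_linearr.
  exact: lin_shuffle.
- elim/tens_ind: t => [|b m n t IHt].
    by rewrite ract0 !tassoc10.
  by rewrite /= tractP !tassoc1P /= IHt telR.
Qed.

Definition tassoc_fun : tens (tens M N) P -> tens M (tens N P) := tlift tassoc1.

Lemma tassoc_funE m n p :
  tassoc_fun (tel (tel m n : tens M N) p) = tel m (tel n p : tens N P).
Proof. by rewrite /tassoc_fun (tliftE tassoc_bal) tassoc1E. Qed.

Lemma tassoc_linear : linear tassoc_fun.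
Proof. exact: tlift_linear tassoc_bal. Qed.

Lemma tassoc_funP a m n (t : tens M N) p : tassoc_fun (tel (a *: tel m n + t : tens M N) p) =
  a *: tel m (tel n p : tens N P) + tassoc_fun (tel t p).
Proof. by rewrite telPl [LHS]tassoc_linear tassoc_funE. Qed.

Lemma tassoc_fun0 p : tassoc_fun (tel 0 p) = 0.
Proof. by rewrite tel0l (lin0 tassoc_linear). Qed.

Lemma tassoc_bimap :
  (forall r t, tassoc_fun (lact r t) = lact r (tassoc_fun t)) /\
  (forall r t, tassoc_fun (ract t r) = ract (tassoc_fun t) r).
Proof.
apply: (tens_bimap tassoc_linear) => r t p.
- elim/tens_ind: t => [|b m n t /= IHt].
    by rewrite lact0 !tassoc_fun0 lact0.
  by rewrite /= tlactP !tassoc_funP tlactP IHt.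
- elim/tens_ind: t => [|b m n t /= IHt].
    by rewrite !tassoc_fun0 ract0.
  by rewrite !tassoc_funP /= tractP /= tractE IHt.
Qed.

Definition tassoc : bimap (tens (tens M N) P) (tens M (tens N P)) :=
  Bimap tassoc_linear tassoc_bimap.1 tassoc_bimap.2.

Lemma tassocV_bal1 (m : M) :
  balanced (fun (n : N) (p : P) => tel (tel m n : tens M N) p).
Proof.
split=> [p a n n'|n a p p'|s n p].
- by rewrite (tel_linearr m) tel_linearl.
- by rewrite tel_linearr.
- by rewrite -telR /= tractE.
Qed.

Definition tassocV1 (m : M) (t : tens N P) : tens (tens M N) P :=
  tlift (fun (n : N) (p : P) => tel (tel m n : tens M N) p) t.

Lemma tassocV1E m n p : tassocV1 m (tel n p) = tel (tel m n : tens M N) p.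
Proof. exact: tliftE (tassocV_bal1 m) n p. Qed.

Lemma tassocV1_linear m : linear (tassocV1 m).
Proof. exact: tlift_linear (tassocV_bal1 m). Qed.

Lemma tassocV10 m : tassocV1 m 0 = 0.
Proof. exact: lin0 (tassocV1_linear m). Qed.

Lemma tassocV1P a m n p t : tassocV1 m (a *: tel n p + t) =
  a *: tel (tel m n : tens M N) p + tassocV1 m t.
Proof. by rewrite [LHS]tassocV1_linear tassocV1E. Qed.

Lemma tassocV_bal : balanced tassocV1.
Proof.
split=> [t|m|r m t]; last 2 first.
- exact: tassocV1_linear.
- elim/tens_ind: t => [|b n p t IHt].
    by rewrite lact0 !tassocV10.
  by rewrite /= tlactP !tassocV1P /= IHt telR.
move=> a m m'; elim/tens_ind: t => [|b n p t IHt].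
  by rewrite !tassocV10 scaler0 addr0.
rewrite !tassocV1P IHt (telPl a m m' n) telPl.
exact: lin_shuffle.
Qed.

Definition tassocV_fun : tens M (tens N P) -> tens (tens M N) P :=
  tlift tassocV1.

Lemma tassocV_funE m n p :
  tassocV_fun (tel m (tel n p : tens N P)) = tel (tel m n : tens M N) p.
Proof. by rewrite /tassocV_fun (tliftE tassocV_bal) tassocV1E. Qed.

Lemma tassocV_linear : linear tassocV_fun.
Proof. exact: tlift_linear tassocV_bal. Qed.

Lemma tassocV_funP a m n p (t : tens N P) : tassocV_fun (tel m (a *: tel n p + t : tens N P)) =
  a *: tel (tel m n : tens M N) p + tassocV_fun (tel m t).
Proof. by rewrite telPr [LHS]tassocV_linear tassocV_funE. Qed.

Lemma tassocV_fun0 m : tassocV_fun (tel m 0) = 0.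
Proof. by rewrite tel0r (lin0 tassocV_linear). Qed.

Lemma tassocV_bimap :
  (forall r t, tassocV_fun (lact r t) = lact r (tassocV_fun t)) /\
  (forall r t, tassocV_fun (ract t r) = ract (tassocV_fun t) r).
Proof.
apply: (tens_bimap tassocV_linear) => r m t.
- elim/tens_ind: t => [|b n p t /= IHt].
    by rewrite !tassocV_fun0 lact0.
  by rewrite !tassocV_funP /= tlactP /= tlactE IHt.
- elim/tens_ind: t => [|b n p t /= IHt].
    by rewrite ract0 !tassocV_fun0 ract0.
  by rewrite /= tractP !tassocV_funP tractP IHt.
Qed.

Definition tassocV : bimap (tens M (tens N P)) (tens (tens M N) P) :=
  Bimap tassocV_linear tassocV_bimap.1 tassocV_bimap.2.

Lemma tassocK : cancel tassoc tassocV.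
Proof.
apply: (tens_ext (f := fun t => tassocV (tassoc t)) (h := id)) => //.
  by move=> a x y /=; rewrite tassoc_linear tassocV_linear.
move=> t p /=; elim/tens_ind: t => [|a m n t IHt].
  by rewrite tassoc_fun0 (lin0 tassocV_linear) tel0l.
by rewrite tassoc_funP [LHS]tassocV_linear tassocV_funE IHt -telPl.
Qed.

Lemma tassocVK : cancel tassocV tassoc.
Proof.
apply: (tens_ext (f := fun t => tassoc (tassocV t)) (h := id)) => //.
  by move=> a x y /=; rewrite tassocV_linear tassoc_linear.
move=> m t /=; elim/tens_ind: t => [|a n p t IHt].
  by rewrite tassocV_fun0 (lin0 tassoc_linear) tel0r.
by rewrite tassocV_funP [LHS]tassoc_linear tassoc_funE IHt -telPr.
Qed.

End Associator.

Section Unit.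

Lemma regular_linearr (m : R) : linear (fun r => r * m).
Proof. by move=> a r s; rewrite mulrDl scalerAl. Qed.

Lemma regular_linearl (r : R) : linear ( *%R r).
Proof. by move=> a m n; rewrite mulrDr scalerAr. Qed.

Definition regular_bimod : bimod :=
  @Bimod R *%R *%R regular_linearl regular_linearr regular_linearl
    regular_linearr (@mul1r R) (@mulr1 R) (fun r s m => esym (mulrA r s m))
    (fun r s m => mulrA m r s) (fun r s m => esym (mulrA r m s)).

Variable M : bimod.

Lemma tunitl_bal : @balanced regular_bimod M M (fun r m => lact r m).
Proof.
split=> [m|r|s r m]; [exact: lact_linearl|exact: lact_linear|exact: lactA].
Qed.

Definition tunitl_fun : tens regular_bimod M -> M :=
  @tlift regular_bimod M M (fun r m => lact r m).

Lemma tunitl_funE (r : regular_bimod) m : tunitl_fun (tel r m) = lact r m.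
Proof. exact: tliftE tunitl_bal r m. Qed.

Lemma tunitl_linear : linear tunitl_fun.
Proof. exact: tlift_linear tunitl_bal. Qed.

Lemma tunitl_bimap :
  (forall r t, tunitl_fun (lact r t) = lact r (tunitl_fun t)) /\
  (forall r t, tunitl_fun (ract t r) = ract (tunitl_fun t) r).
Proof.
apply: (tens_bimap tunitl_linear) => r m n; rewrite !tunitl_funE /=.
- by rewrite lactA.
- by rewrite lractA.
Qed.

Definition tunitl : bimap (tens regular_bimod M) M :=
  Bimap tunitl_linear tunitl_bimap.1 tunitl_bimap.2.

Lemma tunitr_bal : @balanced M regular_bimod M (fun m r => ract m r).
Proof.
split=> [r|m|s m r]; [exact: ract_linearl|exact: ract_linear|].
by rewrite /= ractA.
Qed.

Definition tunitr_fun : tens M regular_bimod -> M :=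
  @tlift M regular_bimod M (fun m r => ract m r).

Lemma tunitr_funE m (r : regular_bimod) : tunitr_fun (tel m r) = ract m r.
Proof. exact: tliftE tunitr_bal m r. Qed.

Lemma tunitr_linear : linear tunitr_fun.
Proof. exact: tlift_linear tunitr_bal. Qed.

Lemma tunitr_bimap :
  (forall r t, tunitr_fun (lact r t) = lact r (tunitr_fun t)) /\
  (forall r t, tunitr_fun (ract t r) = ract (tunitr_fun t) r).
Proof.
apply: (tens_bimap tunitr_linear) => r m n; rewrite !tunitr_funE /=.
- by rewrite lractA.
- by rewrite ractA.
Qed.

Definition tunitr : bimap (tens M regular_bimod) M :=
  Bimap tunitr_linear tunitr_bimap.1 tunitr_bimap.2.

End Unit.

End Bimodules.

Section QuotientBimodule.
Variables (K : fieldType) (R A : algType K) (S : A -> Prop).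
Variable phi : {lrmorphism R -> A}.

Definition aquot_in (r : R) : aquot S := api S (phi r).
Definition aquot_lact (r : R) (x : aquot S) : aquot S := aquot_in r * x.
Definition aquot_ract (x : aquot S) (r : R) : aquot S := x * aquot_in r.

Lemma aquot_inP a r s : aquot_in (a *: r + s) = a *: aquot_in r + aquot_in s.
Proof. by rewrite /aquot_in linearP [LHS]linearP. Qed.

Lemma aquot_inM r s : aquot_in (r * s) = aquot_in r * aquot_in s.
Proof. by rewrite /aquot_in rmorphM [LHS]rmorphM. Qed.

Lemma aquot_in1 : aquot_in 1 = 1.
Proof. by rewrite /aquot_in rmorph1. Qed.

Lemma aquot_lact_linear r : linear (aquot_lact r).
Proof. by move=> a x y; rewrite /aquot_lact mulrDr aquot_scalerAr. Qed.

Lemma aquot_lact_linearl x : linear (aquot_lact^~ x).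
Proof.
by move=> a r s; rewrite /aquot_lact aquot_inP mulrDl aquot_scalerAl.
Qed.

Lemma aquot_ract_linear x : linear (aquot_ract x).
Proof.
by move=> a r s; rewrite /aquot_ract aquot_inP mulrDr aquot_scalerAr.
Qed.

Lemma aquot_ract_linearl r : linear (aquot_ract^~ r).
Proof. by move=> a x y; rewrite /aquot_ract mulrDl aquot_scalerAl. Qed.

Lemma aquot_lact1 x : aquot_lact 1 x = x.
Proof. by rewrite /aquot_lact aquot_in1 mul1r. Qed.

Lemma aquot_ract1 x : aquot_ract x 1 = x.
Proof. by rewrite /aquot_ract aquot_in1 mulr1. Qed.

Lemma aquot_lactA r s x : aquot_lact (r * s) x = aquot_lact r (aquot_lact s x).
Proof. by rewrite /aquot_lact aquot_inM mulrA. Qed.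

Lemma aquot_ractA r s x : aquot_ract x (r * s) = aquot_ract (aquot_ract x r) s.
Proof. by rewrite /aquot_ract aquot_inM mulrA. Qed.

Lemma aquot_lractA r s x :
  aquot_ract (aquot_lact r x) s = aquot_lact r (aquot_ract x s).
Proof. by rewrite /aquot_lact /aquot_ract mulrA. Qed.

Definition aquot_bimod : bimod R :=
  @Bimod K R (aquot S) aquot_lact aquot_ract
    aquot_lact_linear aquot_lact_linearl aquot_ract_linear aquot_ract_linearl
    aquot_lact1 aquot_ract1 aquot_lactA aquot_ractA aquot_lractA.

End QuotientBimodule.


Section ColorCategory.
Variables (K : fieldType) (R : algType K) (B : zmodType).
Variables (degR : B -> R -> Prop) (eps : B -> B -> K).

(* A bimodule with a family of subsets [deg b], the candidate homogeneous
   components; [is_graded] says that they form a grading. *)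
Record grbimod := GrBimod {
  gbim :> bimod R;
  deg : B -> gbim -> Prop
}.

Record is_graded (M : grbimod) : Prop := IsGraded {
  deg0 : forall b, deg b (0 : M);
  degP : forall b a (x y : M), deg b x -> deg b y -> deg b (a *: x + y);
  deg_sum : forall x : M, exists (s : seq B) (f : B -> M),
    (forall b, deg b (f b)) /\ x = \sum_(b <- s) f b;
  deg_direct : forall (s : seq B) (f : B -> M), uniq s ->
    (forall b, deg b (f b)) -> \sum_(b <- s) f b = 0 ->
    forall b, b \in s -> f b = 0;
  deg_lact : forall a b r (x : M), degR a r -> deg b x ->
    deg (a + b) (lact r x);
  deg_ract : forall a b (x : M) r, deg a x -> degR b r ->
    deg (a + b) (ract x r)
}.

(* tau (x \otimes y) = eps(|x|,|y|) y \otimes x is compatible with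
   x r \otimes y = x \otimes r y for x in R only if r y = eps(|r|,|y|) y r;
   the bimodules with this property are those on which tau is defined. *)
Definition color_commuting (M : grbimod) : Prop :=
  forall a b r (x : M), degR a r -> deg b x ->
  lact r x = eps a b *: ract x r.

Definition color_object (M : grbimod) : Prop :=
  is_graded M /\ color_commuting M.

Record grmor (M N : grbimod) := GrMor {
  gmor :> bimap M N;
  gmor_deg : forall b x, deg b x -> deg b (gmor x)
}.

Definition grunit : grbimod := @GrBimod (regular_bimod R) degR.

Definition grtens (M N : grbimod) : grbimod :=
  @GrBimod (tens M N) (fun c => lspan (fun t => exists a b (x : M) (y : N),
    [/\ a + b = c, deg a x, deg b y & t = tel x y])).

Definition is_color_braiding (M N : grbimod)
    (t : grmor (grtens M N) (grtens N M)) : Prop :=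
  forall a b (x : M) (y : N), deg a x -> deg b y ->
  t (tel x y) = eps a b *: tel y x.

(* id \otimes t \otimes id on (M \otimes M) \otimes (M \otimes M). *)
Definition mid_swap (M : grbimod) (t : grmor (grtens M M) (grtens M M))
    (x : tens (tens M M) (tens M M)) : tens (tens M M) (tens M M) :=
  let id := bimap_id M in
  tassocV M M (tens M M) (tmap id (tassoc M M M)
    (tmap id (tmap t id) (tmap id (tassocV M M M) (tassoc M M (tens M M) x)))).

Record color_hopf_algebra (H : grbimod) := ColorHopf {
  hobj : color_object H;
  hbraid : grmor (grtens H H) (grtens H H);
  hmul : grmor (grtens H H) H;
  hunit : grmor grunit H;
  hcomul : grmor H (grtens H H);
  hcounit : grmor H grunit;
  hanti : grmor H H;
  hbraidE : is_color_braiding hbraid;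
  hmulA : forall t : tens (tens H H) H,
    hmul (tmap hmul (bimap_id H) t) =
    hmul (tmap (bimap_id H) hmul (tassoc H H H t));
  hmul1l : forall t : tens grunit H,
    hmul (tmap hunit (bimap_id H) t) = tunitl H t;
  hmul1r : forall t : tens H grunit,
    hmul (tmap (bimap_id H) hunit t) = tunitr H t;
  hcomulA : forall x : H,
    tassoc H H H (tmap hcomul (bimap_id H) (hcomul x)) =
    tmap (bimap_id H) hcomul (hcomul x);
  hcounitl : forall x : H,
    tunitl H (tmap hcounit (bimap_id H) (hcomul x)) = x;
  hcounitr : forall x : H,
    tunitr H (tmap (bimap_id H) hcounit (hcomul x)) = x;
  hcomulM : forall t : tens H H,
    hcomul (hmul t) = tmap hmul hmul (mid_swap hbraid (tmap hcomul hcomul t));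
  hcomul1 : forall t : tens grunit grunit,
    hcomul (hunit (tunitl grunit t)) = tmap hunit hunit t;
  hcounitM : forall t : tens H H,
    hcounit (hmul t) = tunitl grunit (tmap hcounit hcounit t);
  hcounit1 : forall r : grunit, hcounit (hunit r) = r;
  hantil : forall x : H,
    hmul (tmap hanti (bimap_id H) (hcomul x)) = hunit (hcounit x);
  hantir : forall x : H,
    hmul (tmap (bimap_id H) hanti (hcomul x)) = hunit (hcounit x)
}.

End ColorCategory.

Arguments hmul {K R B degR eps H}.
Arguments hunit {K R B degR eps H}.


Definition is_rep (K : fieldType) (V : vectType K) (G : zmodType)
    (rho : G -> 'End(V)) : Prop :=
  rho 0 = \1%VF /\ forall g h, rho (g + h) = (rho g \o rho h)%VF.

Definition quantum_system (K : fieldType) (n : nat) (q : 'I_n -> 'I_n -> K)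
  : Prop :=
  [/\ forall i j, q i j != 0, forall i, q i i = 1
    & forall i j, q j i = (q i j)^-1].

Definition is_lbasis (K : fieldType) (W : lmodType K) (I : choiceType)
    (e : I -> W) : Prop :=
  forall x : W, exists! c : {malg K[I]}, x = \sum_(k <- msupp c) c@_k *: e k.

Definition antisym_bichar (K : fieldType) (B : zmodType) (eps : B -> B -> K)
  : Prop :=
  [/\ forall a b, eps a b != 0,
      forall a b c, eps (a + b) c = eps a c * eps b c,
      forall a b c, eps a (b + c) = eps a b * eps a c
    & forall a b, eps b a = (eps a b)^-1].

Section QuantumDrinfeldOrbifold.
Variables (K : fieldType) (G : finZmodType) (V : vectType K) (n : nat).
Variables (v : n.-tuple V) (chi : 'I_n -> lin_char G K).
Variables (q : 'I_n -> 'I_n -> K).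

(* V \otimes KG is {ffun G -> V}: f stands for \sum_g (f g) \otimes g. *)
Variable kappa : V -> V -> {ffun G -> V}.

Definition parameter_function : Prop :=
  [/\ forall u, linear (kappa u), forall u, linear (kappa^~ u)
    & forall i j : 'I_n, kappa v`_i v`_j = - q i j *: kappa v`_j v`_i].

(* c_r^{ijg} *)
Definition kappa_coef (i j r : 'I_n) (g : G) : K :=
  coord v r (kappa v`_i v`_j g).

Local Notation TG := (skew (diag_action chi)).

Definition kappa_el (i j : 'I_n) : TG :=
  [ffun g => \sum_r kappa_coef i j r g *: tvar K r].

Definition xvar (i : 'I_n) : TG := skew_el (diag_action chi) (tvar K i) 0.

Definition qdoa_rel (z : TG) : Prop := exists i j,
  z = xvar i * xvar j - q i j *: (xvar j * xvar i) - kappa_el i j.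

Definition qdoa := aquot qdoa_rel.
HB.instance Definition _ := GRing.Lmodule.on qdoa.
HB.instance Definition _ := GRing.PzRing.on qdoa.

Definition qdoa_var (i : 'I_n) : qdoa := api qdoa_rel (xvar i).

Definition qdoa_in : group_alg K G -> qdoa :=
  aquot_in qdoa_rel (group_alg_in (diag_action chi)).

Definition qdoa_pbw_monomial (p : {ffun 'I_n -> nat} * G) : qdoa :=
  (\prod_(i < n) qdoa_var i ^+ p.1 i) * qdoa_in (group_el K p.2).

Definition pbw_property : Prop := is_lbasis qdoa_pbw_monomial.

Definition strong_vanishing (rho : G -> 'End(V)) : Prop :=
  forall g (i j k r : 'I_n), kappa_coef i j r g != 0 ->
  rho g v`_k = (q i k * q j k * q k r) *: v`_k.

(* A = Z^n x G *)
Local Notation A := ('rV[int]_n * G)%type.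

Definition var_deg (i : 'I_n) : A := (delta_mx 0 i, 0).
Definition grp_deg (g : G) : A := (0, g).

Definition rel_deg (a : A) : Prop := exists i j r g, kappa_coef i j r g != 0 /\
  a = var_deg i + var_deg j - var_deg r - grp_deg g.

(* A / N *)
Definition qdeg : zmodType := Quotient.quot (zspan_zmod rel_deg).
Definition qcls (a : A) : qdeg := \pi_qdeg a.

(* As eps is bimultiplicative, it is determined by the formula when 0 < n. *)
Definition commutation_factor (eps : qdeg -> qdeg -> K) : Prop :=
  antisym_bichar eps /\
  forall g h (i j : 'I_n),
    eps (qcls (var_deg i + grp_deg g)) (qcls (var_deg j + grp_deg h)) =
    q i j * chi j g * (chi i h)^-1.

Definition group_deg (b : qdeg) : group_alg K G -> Prop :=
  lspan (fun f => exists g, qcls (grp_deg g) = b /\ f = group_el K g).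

(* The algebra grading generated by |v_i| and |g|. *)
Inductive qdoa_deg : qdeg -> qdoa -> Prop :=
| qdoa_deg0 b : qdoa_deg b 0
| qdoa_degP b a x y of qdoa_deg b x & qdoa_deg b y : qdoa_deg b (a *: x + y)
| qdoa_degM a b x y of qdoa_deg a x & qdoa_deg b y : qdoa_deg (a + b) (x * y)
| qdoa_deg_var i : qdoa_deg (qcls (var_deg i)) (qdoa_var i)
| qdoa_deg_grp g : qdoa_deg (qcls (grp_deg g)) (qdoa_in (group_el K g)).

Definition qdoa_grbimod : grbimod (group_alg K G) qdeg :=
  @GrBimod K (group_alg K G) qdeg
    (aquot_bimod qdoa_rel (group_alg_in (diag_action chi))) qdoa_deg.

(* The multiplication and unit of the Hopf algebra are those of the algebra. *)
Definition is_braided_hopf (eps : qdeg -> qdeg -> K) : Prop :=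
  exists h : color_hopf_algebra group_deg eps qdoa_grbimod,
    (forall x y : qdoa, hmul h (tel (x : qdoa_grbimod) (y : qdoa_grbimod))
       = x * y) /\
    (forall f : group_alg K G, hunit h f = qdoa_in f).

End QuantumDrinfeldOrbifold.

(* Main.v *)
(* The braided Hopf structure has the generators v_i primitive: Delta v_i =
   v_i (x) 1 + 1 (x) v_i, eps v_i = 0, S v_i = - v_i. The defining relations
   q-commute v_i and v_j up to terms v_r g of the same degree in A/N, so H is
   the enveloping algebra of a color Lie algebra over KG. Each structure map
   x |-> x . m0 comes from an action of H on a suitable KG-bimodule, given by
   operators for the v_i that satisfy the relations: on H (x) H for Delta, on
   KG for eps, on H for S (acting by signed right multiplication). Each Hopf
   identity then compares two maps out of H that start at the same value and
   intertwine the same operators.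
   The bicharacter on Z^n x G descends to A/N by the strong vanishing condition
   and because chi_r = chi_i chi_j whenever c_r^{ijg} <> 0; the latter follows
   from the PBW property by conjugating the relations with elements of G. *)

Require Import Defs.
From mathcomp Require Import all_boot all_order all_algebra.
From mathcomp Require Import ssrAC boolp finmap monalg functions ring.

Set Implicit Arguments.
Unset Strict Implicit.
Unset Printing Implicit Defensive.

Import GRing.Theory.
Local Open Scope ring_scope.
Local Open Scope quotient_scope.

(** The sign eps(|v_i|,|x|) makes sense only for homogeneous x, whereas tensors, structure maps and
    induction range over all of H. It is therefore replaced by the linear operator [twist], which
    multiplies each component of degree b by eps(a,b); identities are checked on homogeneous
    elements and extended by linearity. Elements of KG also have nontrivial degrees, so the
    operators for v_i commute with KG only up to a factor, and tau is well defined over KG because r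
    x = eps(|r|,|x|) x r. For fixed i, j, r the coefficients form one element k = sum_g c_r^{ijg} g
    of KG, homogeneous of degree |v_i| + |v_j| - |v_r| by the choice of N. The Hopf argument thus
    runs in an abstract algebra with relations v_i v_j - eps(|v_i|,|v_j|) v_j v_i = sum_r v_r k. It
    asks two things of H: induction along left multiplication by generators, and extension of
    admissible operators to an action. The PBW basis enters in two ways: spanning gives the
    induction, and independence of the v_r g gives chi_r = chi_i chi_j. *)

(** * Linear maps and linear spans *)

Section LinearClosure.
Variables (K : fieldType) (U W : lmodType K).

Lemma lin_sum (f : U -> W) (I : Type) (s : seq I) (P : pred I) (F : I -> U) :
  linear f -> f (\sum_(i <- s | P i) F i) = \sum_(i <- s | P i) f (F i).
Proof.
move=> lf; elim: s => [|i s IHs]; first by rewrite !big_nil (lin0 lf).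
by rewrite !big_cons; case: (P i); rewrite ?(linD lf) IHs.
Qed.

Lemma linB (f : U -> W) x y : linear f -> f (x - y) = f x - f y.
Proof. by move=> lf; rewrite -scaleN1r (linD lf) (linZ lf) scaleN1r. Qed.

Lemma linear_comp (X : lmodType K) (f : W -> X) (h : U -> W) :
  linear f -> linear h -> linear (fun x => f (h x)).
Proof. by move=> lf lh a x y; rewrite lh lf. Qed.

Lemma linear_id : linear (fun x : U => x).
Proof. by []. Qed.

Lemma linear_scale (f : U -> W) c : linear f -> linear (fun x => c *: f x).
Proof.
by move=> lf a x y; rewrite lf scalerDr !scalerA mulrC.
Qed.

Lemma linear_add (f h : U -> W) :
  linear f -> linear h -> linear (fun x => f x + h x).
Proof. by move=> lf lh a x y; rewrite lf lh scalerDr addrACA. Qed.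

Lemma linear_opp (f : U -> W) : linear f -> linear (fun x => - f x).
Proof. by move=> lf a x y; rewrite lf opprD scalerN. Qed.

Lemma linear_zero : linear (fun _ : U => 0 : W).
Proof. by move=> a x y; rewrite scaler0 addr0. Qed.

Lemma lspan_linear (S : U -> Prop) (Q : W -> Prop) (f : U -> W) : linear f ->
  (forall x, S x -> lspan Q (f x)) -> forall x, lspan S x -> lspan Q (f x).
Proof.
move=> lf SQ x; elim=> [{}x /SQ //||a {}x y _ Qx _ Qy].
  by rewrite (lin0 lf); exact: lspan0.
by rewrite lf; exact: lspanP.
Qed.

Lemma lspan_ext (S : U -> Prop) (f h : U -> W) : linear f -> linear h ->
  (forall x, S x -> f x = h x) -> forall x, lspan S x -> f x = h x.
Proof.
move=> lf lh fh x; elim=> [{}x /fh //||a {}x y _ Ex _ Ey].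
  by rewrite !lin0.
by rewrite lf lh Ex Ey.
Qed.

End LinearClosure.

(** * Linear maps defined degree by degree on a graded bimodule *)

Section Grading.
Variables (K : fieldType) (R : algType K) (B : zmodType).
Variables (degR : B -> R -> Prop) (M : grbimod R B).
Hypothesis gM : is_graded degR M.

Lemma deg_scale b a (x : M) : deg b x -> deg b (a *: x).
Proof.
by move=> bx; rewrite -[_ *: _]addr0; apply: (degP gM) => //; exact: (deg0 gM).
Qed.

Lemma deg_add b (x y : M) : deg b x -> deg b y -> deg b (x + y).
Proof. by move=> bx byy; rewrite -[x]scale1r; exact: (degP gM). Qed.

Lemma hom_span (x : M) : lspan (fun y => exists b, deg b y) x.
Proof.
have [s [f [fs ->]]] := deg_sum gM x.
elim: s => [|b s IHs]; first by rewrite big_nil; exact: lspan0.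
rewrite big_cons -[f b]scale1r; apply: lspanP => //.
by apply: lspan_gen; exists b.
Qed.

Lemma hom_ext (W : lmodType K) (f h : M -> W) : linear f -> linear h ->
  (forall b x, deg b x -> f x = h x) -> f =1 h.
Proof.
move=> lf lh fh x; apply: (lspan_ext lf lh) (hom_span x) => y [b].
exact: fh.
Qed.

(** The list may repeat degrees, so its entries are grouped by degree. Directness of the grading
    makes each group sum zero, and all entries of one group go through the same linear map. *)
Lemma homogeneous_sum0 (W : lmodType K) (F : B -> M -> W)
    (s : seq (B * M)) :
  (forall b, linear (F b)) -> (forall p, p \in s -> deg p.1 p.2) ->
  \sum_(p <- s) p.2 = 0 -> \sum_(p <- s) F p.1 p.2 = 0.
Proof.
move=> lF degs s0; pose t := undup [seq p.1 | p <- s].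
pose c b := \sum_(p <- s | p.1 == b) p.2.
have split_t (X : lmodType K) (h : B * M -> X) :
    \sum_(p <- s) h p = \sum_(b <- t) \sum_(p <- s | p.1 == b) h p.
  rewrite [RHS](exchange_big_dep predT) //= big_seq [RHS]big_seq.
  apply: eq_bigr => p ps; under eq_bigl => b do rewrite eq_sym.
  rewrite -big_filter (filter_pred1_uniq (undup_uniq _)) ?big_seq1 //.
  by rewrite mem_undup map_f.
have degc b : deg b (c b).
  rewrite /c big_seq_cond.
  apply: (big_ind (fun x : M => deg b x)); first exact: (deg0 gM).
    by move=> x y; exact: deg_add.
  by move=> p /andP[/degs dp /eqP <-].
have c0 b : b \in t -> c b = 0.
  apply: (deg_direct gM (undup_uniq _) degc).
  by rewrite -[RHS]s0 (split_t _ snd).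
rewrite (split_t _ (fun p => F p.1 p.2)) big_seq big1 // => b bt.
have -> : \sum_(p <- s | p.1 == b) F p.1 p.2 = F b (c b).
  by rewrite lin_sum //; apply: eq_bigr => p /eqP ->.
by rewrite c0 // (lin0 (lF b)).
Qed.

(** Choice picks a decomposition of every vector into homogeneous pieces. By [homogeneous_sum0] the
    value does not depend on the decomposition; linearity follows by comparing the one chosen for a
    x + y with the concatenation of those of a x and y. *)
Lemma homogeneous_extension (W : lmodType K) (F : B -> M -> W) :
  (forall b, linear (F b)) ->
  exists f : M -> W, linear f /\ forall b x, deg b x -> f x = F b x.
Proof.
move=> lF.
have dec (x : M) : exists s : seq (B * M),
    (forall p, p \in s -> deg p.1 p.2) /\ x = \sum_(p <- s) p.2.
  have [s [f [fs ->]]] := deg_sum gM x.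
  exists [seq (b, f b) | b <- s]; rewrite big_map; split=> //.
  by move=> _ /mapP[b _ ->]; exact: fs.
have [d dP] := choice dec.
pose h (s : seq (B * M)) := \sum_(p <- s) F p.1 p.2.
pose sc a (s : seq (B * M)) := [seq (p.1, a *: p.2) | p <- s].
have sc_deg a s : (forall p, p \in s -> deg p.1 p.2) ->
    forall p, p \in sc a s -> deg p.1 p.2.
  by move=> ds _ /mapP[p ps ->]; exact: deg_scale (ds _ ps).
have sc_h a s : h (sc a s) = a *: h s.
  rewrite /h big_map scaler_sumr; apply: eq_bigr => p _.
  by rewrite (linZ (lF _)).
have sc_s a s : \sum_(p <- sc a s) p.2 = a *: \sum_(p <- s) p.2.
  by rewrite big_map scaler_sumr.
have hE s t : (forall p, p \in s -> deg p.1 p.2) ->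
    (forall p, p \in t -> deg p.1 p.2) ->
    \sum_(p <- s) p.2 = \sum_(p <- t) p.2 -> h s = h t.
  move=> ds dt st; apply/eqP; rewrite -subr_eq0 -scaleN1r -sc_h -big_cat.
  apply/eqP/homogeneous_sum0 => //.
    by move=> p; rewrite mem_cat => /orP[/ds //|/(sc_deg _ _ dt)].
  by rewrite big_cat sc_s /= st scaleN1r subrr.
exists (fun x => h (d x)); split=> [a x y|b x bx].
  rewrite -sc_h -big_cat.
  have [[dx xE] [dy yE]] := (dP x, dP y).
  have [dxy xyE] := dP (a *: x + y).
  apply: hE => //.
    by move=> p; rewrite mem_cat => /orP[/(sc_deg _ _ dx)|/dy].
  by rewrite -xyE big_cat sc_s /= -xE -yE.
have [dx xE] := dP x.
rewrite (hE _ [:: (b, x)]) //.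
- by rewrite /h big_seq1.
- by move=> p; rewrite inE => /eqP ->.
- by rewrite -xE big_seq1.
Qed.

End Grading.



(** * Calculus of elementary tensors over R *)

Section BimoduleTheory.
Variables (K : fieldType) (R : algType K).
Implicit Types M N P : bimod R.

Lemma lactZ M r a (m : M) : lact r (a *: m) = a *: lact r m.
Proof. exact: linZ (lact_linear r) a m. Qed.
Lemma ractZ M r a (m : M) : ract (a *: m) r = a *: ract m r.
Proof. exact: linZ (ract_linearl r) a m. Qed.
Lemma lactD M r (m m' : M) : lact r (m + m') = lact r m + lact r m'.
Proof. exact: linD (lact_linear r) m m'. Qed.
Lemma ractD M r (m m' : M) : ract (m + m') r = ract m r + ract m' r.
Proof. exact: linD (ract_linearl r) m m'. Qed.

Section Elementary.
Variables M N : bimod R.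
Implicit Types (m : M) (n : N).

Lemma telZl a m n : tel (a *: m) n = a *: tel m n.
Proof. exact: linZ (tel_linearl n) a m. Qed.
Lemma telZr a m n : tel m (a *: n) = a *: tel m n.
Proof. exact: linZ (tel_linearr m) a n. Qed.
Lemma telDl m m' n : tel (m + m') n = tel m n + tel m' n.
Proof. exact: linD (tel_linearl n) m m'. Qed.
Lemma telDr m n n' : tel m (n + n') = tel m n + tel m n'.
Proof. exact: linD (tel_linearr m) n n'. Qed.

Lemma tel_suml I (s : seq I) (F : I -> M) n :
  tel (\sum_(i <- s) F i) n = \sum_(i <- s) tel (F i) n.
Proof. exact: (lin_sum (f := fun m => tel m n) s xpredT F (tel_linearl n)). Qed.
Lemma tel_sumr I (s : seq I) (F : I -> N) m :
  tel m (\sum_(i <- s) F i) = \sum_(i <- s) tel m (F i).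
Proof. exact: (lin_sum (f := tel m) s xpredT F (tel_linearr m)). Qed.

Lemma lact_tel r m n : lact r (tel m n : tens M N) = tel (lact r m) n.
Proof. exact: tlactE. Qed.
Lemma ract_tel r m n : ract (tel m n : tens M N) r = tel m (ract n r).
Proof. exact: tractE. Qed.

Lemma tmapE M' N' (f : bimap M M') (h : bimap N N') m n :
  tmap f h (tel m n) = tel (f m) (h n).
Proof. exact: tmap_funE. Qed.

Lemma tassocE P m n (p : P) :
  tassoc M N P (tel (tel m n : tens M N) p) = tel m (tel n p : tens N P).
Proof. exact: tassoc_funE. Qed.

Lemma tassocVE P m n (p : P) :
  tassocV M N P (tel m (tel n p : tens N P)) = tel (tel m n : tens M N) p.
Proof. exact: tassocV_funE. Qed.
End Elementary.

Lemma tunitlE M r (m : M) : tunitl M (tel (r : regular_bimod R) m) = lact r m.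
Proof. exact: tunitl_funE. Qed.
Lemma tunitrE M (m : M) r : tunitr M (tel m (r : regular_bimod R)) = ract m r.
Proof. exact: tunitr_funE. Qed.
End BimoduleTheory.

(** * Bicharacters, twist operators and the braiding *)

Section Bicharacter.
Variables (K : fieldType) (B : zmodType) (eps : B -> B -> K).
Hypothesis eps_bichar : antisym_bichar eps.

Lemma bichar_neq0 a b : eps a b != 0.
Proof. by case: eps_bichar. Qed.
Lemma bicharDl a b c : eps (a + b) c = eps a c * eps b c.
Proof. by case: eps_bichar. Qed.
Lemma bicharDr a b c : eps a (b + c) = eps a b * eps a c.
Proof. by case: eps_bichar. Qed.
Lemma bicharK a b : eps a b * eps b a = 1.
Proof.
have [_ _ _ /(_ a b) ->] := eps_bichar.
by rewrite divff ?bichar_neq0.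
Qed.
Lemma bichar0r a : eps a 0 = 1.
Proof. by apply: (mulfI (bichar_neq0 a 0)); rewrite -bicharDr addr0 mulr1. Qed.
Lemma bichar0l a : eps 0 a = 1.
Proof. by apply: (mulfI (bichar_neq0 0 a)); rewrite -bicharDl addr0 mulr1. Qed.
End Bicharacter.

Section ColorObject.
Variables (K : fieldType) (R : algType K) (B : zmodType).
Variables (degR : B -> R -> Prop) (eps : B -> B -> K).
Hypothesis eps_bichar : antisym_bichar eps.
Hypothesis degR_span : forall r : R, lspan (fun s => exists b, degR b s) r.

Lemma scalar_ext (W : lmodType K) (f h : R -> W) : linear f -> linear h ->
  (forall c r, degR c r -> f r = h r) -> f =1 h.
Proof.
by move=> lf lh fh r; apply: (lspan_ext lf lh) (degR_span r) => s [c /fh].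
Qed.

Section Twist.
Variable H : grbimod R B.
Hypothesis objH : color_object degR eps H.
Let gH : is_graded degR H := objH.1.

Lemma color_lact a b r (x : H) : degR a r -> deg b x ->
  lact r x = eps a b *: ract x r.
Proof. exact: objH.2. Qed.

Lemma twist_key a (b : B) : linear (fun x : H => eps a b *: x).
Proof. exact: linear_scale _ (@linear_id _ _). Qed.

(** The map x |-> eps(a,|x|) x, extended linearly to all of H: the sign incurred when something of
    degree a moves past x. *)
Definition twist (a : B) : H -> H :=
  sval (cid (homogeneous_extension gH (twist_key a))).

Lemma twist_linear a : linear (twist a).
Proof. exact: (svalP (cid (homogeneous_extension gH (twist_key a)))).1. Qed.

Lemma twistE a b x : deg b x -> twist a x = eps a b *: x.
Proof. exact: (svalP (cid (homogeneous_extension gH (twist_key a)))).2. Qed.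

Lemma deg_twist a b x : deg b x -> deg b (twist a x).
Proof. by move=> bx; rewrite (twistE _ bx); exact: (deg_scale gH). Qed.

Lemma twist_lact a c r x : degR c r ->
  twist a (lact r x) = eps a c *: lact r (twist a x).
Proof.
move=> cr; move: x; apply: (hom_ext gH).
- exact: linear_comp (twist_linear a) (lact_linear r).
- exact/linear_scale/linear_comp/twist_linear/lact_linear.
move=> b x bx; rewrite (twistE _ bx) (twistE _ (deg_lact gH cr bx)).
by rewrite lactZ scalerA (bicharDr eps_bichar).
Qed.

Lemma twist_ract a c r x : degR c r ->
  twist a (ract x r) = eps a c *: ract (twist a x) r.
Proof.
move=> cr; move: x; apply: (hom_ext gH).
- exact: linear_comp (twist_linear a) (ract_linearl r).
- exact: linear_scale _ (linear_comp (ract_linearl r) (twist_linear a)).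
move=> b x bx; rewrite (twistE _ bx) (twistE _ (deg_ract gH bx cr)).
by rewrite ractZ scalerA (bicharDr eps_bichar) mulrC.
Qed.

Lemma twist_comm a b x : twist a (twist b x) = twist b (twist a x).
Proof.
move: x; apply: (hom_ext gH).
- exact: linear_comp (twist_linear a) (twist_linear b).
- exact: linear_comp (twist_linear b) (twist_linear a).
move=> c x cx; rewrite (twistE _ cx) (linZ (twist_linear _)).
rewrite (twistE _ cx) (linZ (twist_linear _)).
by rewrite (twistE b cx) !scalerA mulrC.
Qed.

Lemma twistD a b x : twist (a + b) x = twist a (twist b x).
Proof.
move: x; apply: (hom_ext gH).
- exact: twist_linear.
- exact: linear_comp (twist_linear a) (twist_linear b).
move=> c x cx; rewrite (twistE b cx) (linZ (twist_linear _)).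
by rewrite !(twistE _ cx) scalerA mulrC (bicharDl eps_bichar).
Qed.

Lemma twist0 x : twist 0 x = x.
Proof.
move: x; apply: (hom_ext gH); [exact: twist_linear|exact: linear_id|].
by move=> b x bx; rewrite (twistE _ bx) (bichar0l eps_bichar) scale1r.
Qed.

(* Color commutativity with the degree of x unknown. *)
Lemma lact_twist c r (x : H) : degR c r -> lact r x = ract (twist c x) r.
Proof.
move=> cr; move: x; apply: (hom_ext gH).
- exact: lact_linear.
- exact: linear_comp (ract_linearl r) (twist_linear c).
by move=> b x bx; rewrite (twistE _ bx) ractZ (color_lact cr bx).
Qed.

Lemma twist_tel (M : bimod R) c r (x : H) (m : M) : degR c r ->
  tel (twist c x) (lact r m) = tel (lact r x) m.
Proof. by move=> cr; rewrite -telR -(lact_twist _ cr). Qed.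

End Twist.

Section Braiding.
Variables M N : grbimod R B.
Hypotheses (objM : color_object degR eps M) (objN : color_object degR eps N).
Let gM : is_graded degR M := objM.1.

Lemma color_swap_key (y : N) (b : B) :
  linear (fun x : M => tel (twist objN b y) x).
Proof. exact: tel_linearr. Qed.

(** Only x has to be split into components: once its degree is known, the sign eps(|x|,|y|) is a
    twist of y, which may be arbitrary. *)
Definition color_swap (x : M) (y : N) : tens N M :=
  sval (cid (homogeneous_extension gM (color_swap_key y))) x.

Lemma color_swap_linearl y : linear (color_swap^~ y).
Proof.
exact: (svalP (cid (homogeneous_extension gM (color_swap_key y)))).1.
Qed.

Lemma color_swapE a x y : deg a x -> color_swap x y = tel (twist objN a y) x.
Proof.
exact: (svalP (cid (homogeneous_extension gM (color_swap_key y)))).2.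
Qed.

(** For r of degree c and x of degree b, twisting r y by b gives a factor eps(b,c). Carrying r to
    the right past y adds the twist by c that x r requires, and carrying it past x gives eps(c,b),
    which cancels the first factor. Both M and N must therefore be color commuting. *)
Lemma color_swap_bal : balanced color_swap.
Proof.
split=> [y|x a y y'|r x y]; first exact: color_swap_linearl.
  move: x; apply: (hom_ext gM); first exact: color_swap_linearl.
    by apply: linear_add; [apply: linear_scale|]; exact: color_swap_linearl.
  by move=> b x bx; rewrite !(color_swapE _ bx) twist_linear telPl.
move: r; apply: scalar_ext.
- exact: linear_comp (color_swap_linearl y) (ract_linear x).
- move=> a r s; rewrite lact_linearl; move: x; apply: (hom_ext gM).
  + exact: color_swap_linearl.
  + by apply: linear_add; [apply: linear_scale|]; exact: color_swap_linearl.
  + by move=> b x bx; rewrite !(color_swapE _ bx) twist_linear telPl.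
move=> c r cr; move: x; apply: (hom_ext gM).
- exact: linear_comp (color_swap_linearl y) (ract_linearl r).
- exact: color_swap_linearl.
move=> b x bx; rewrite (color_swapE _ (deg_ract gM bx cr)) (color_swapE _ bx).
rewrite (twist_lact _ _ _ cr) twistD twist_comm telZl.
rewrite (lact_twist objN _ cr) telR (color_lact objM cr bx) telZr scalerA.
by rewrite bicharK // scale1r.
Qed.

Definition braiding_fun : tens M N -> tens N M := tlift color_swap.

Lemma braiding_linear : linear braiding_fun.
Proof. exact: tlift_linear color_swap_bal. Qed.

Lemma braiding_funE a x y : deg a x ->
  braiding_fun (tel x y) = tel (twist objN a y) x.
Proof.
move=> ax; rewrite /braiding_fun (tliftE color_swap_bal).
exact: color_swapE.
Qed.

Lemma braiding_bimap :
  (forall r t, braiding_fun (lact r t) = lact r (braiding_fun t)) /\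
  (forall r t, braiding_fun (ract t r) = ract (braiding_fun t) r).
Proof.
apply: (tens_bimap braiding_linear) => r x y; move: r; apply: scalar_ext.
- move=> a r s; rewrite lact_linearl telPl.
  exact: braiding_linear.
- exact: lact_linearl.
- move=> c r cr; move: x; apply: (hom_ext gM).
  + apply: linear_comp braiding_linear _.
    exact: linear_comp (tel_linearl _) (lact_linear r).
  + apply: linear_comp (lact_linear r) _.
    exact: linear_comp braiding_linear (tel_linearl _).
  move=> b x bx; rewrite (braiding_funE _ (deg_lact gM cr bx)).
  rewrite (braiding_funE _ bx) lact_tel (lact_twist objN _ cr) -twistD telR.
  done.
- move=> a r s; rewrite ract_linear telPr.
  exact: braiding_linear.
- exact: ract_linear.
- move=> c r cr; move: x; apply: (hom_ext gM).
  + exact: linear_comp braiding_linear (tel_linearl _).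
  + apply: linear_comp (ract_linearl r) _.
    exact: linear_comp braiding_linear (tel_linearl _).
  move=> b x bx; rewrite !(braiding_funE _ bx) (twist_ract _ _ _ cr).
  rewrite telZl telR (color_lact objM cr bx) telZr scalerA bicharK //.
  by rewrite scale1r ract_tel.
Qed.

Lemma braiding_deg c t :
  deg (c : B) (t : grtens M N) -> deg c (braiding_fun t : grtens N M).
Proof.
apply: lspan_linear; first exact: braiding_linear.
move=> _ [a [b [x [y [<- ax byy ->]]]]]; rewrite (braiding_funE _ ax).
by apply: lspan_gen; exists b, a, (twist objN a y), x;
  split=> //; [rewrite addrC|exact: deg_twist].
Qed.

Definition braiding : grmor (grtens M N) (grtens N M) :=
  @GrMor K R B (grtens M N) (grtens N M)
    (Bimap braiding_linear braiding_bimap.1 braiding_bimap.2) braiding_deg.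

Lemma braidingP : is_color_braiding eps braiding.
Proof.
move=> a b x y ax byy; rewrite /= (braiding_funE _ ax) (twistE _ _ byy).
by rewrite telZl.
Qed.

End Braiding.
End ColorObject.



(** * An abstract color enveloping algebra and its modules *)

Lemma addr_cross_cancel (U : zmodType) (a b c d e f : U) :
  - a - d + (- c - b) + (e + c + (d + f)) = - a + e + (- b + f).
Proof.
rewrite [LHS](AC ((2*2)*(2*2)) ((1*5)*(4*8)*((2*7)*(3*6)))) /=.
by rewrite !addNr !addr0.
Qed.

Section ColorEnvelope.
Variables (K : fieldType) (R : algType K) (B : zmodType).
Variables (degR : B -> R -> Prop) (eps : B -> B -> K).
Hypothesis eps_bichar : antisym_bichar eps.
Hypothesis degR_span : forall r : R, lspan (fun s => exists b, degR b s) r.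

Variable H : grbimod R B.
Hypothesis objH : color_object degR eps H.
Variables (one : H) (mul : H -> H -> H).
Hypotheses (mul_linearl : forall y, linear (mul^~ y))
  (mul_linearr : forall x, linear (mul x)) (mul_assoc : associative mul)
  (mul_onel : left_id one mul) (mul_oner : right_id one mul)
  (lact_mul : forall r x y, lact r (mul x y) = mul (lact r x) y)
  (ract_mul : forall r x y, ract (mul x y) r = mul x (ract y r))
  (mulR : forall r x y, mul (ract x r) y = mul x (lact r y))
  (deg_one : deg 0 one)
  (deg_mul : forall a b x y, deg a x -> deg b y -> deg (a + b) (mul x y)).

Variables (I : finType) (v : I -> H) (vdeg : I -> B) (k : I -> I -> I -> R).
Hypotheses (deg_var : forall i, deg (vdeg i) (v i))
  (deg_k : forall i j r, degR (vdeg i + vdeg j - vdeg r) (k i j r))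
  (mul_var : forall i j,
     mul (v i) (v j) - eps (vdeg i) (vdeg j) *: mul (v j) (v i) =
     \sum_r mul (v r) (lact (k i j r) one)).

Let gH : is_graded degR H := objH.1.
Local Notation tw := (twist objH).
Local Notation T2 := (tens H H).

(* Left H-modules, given through the actions of R and of the generators,
   with a compatible right action of R. *)
Record hmodule (M : bimod R) (D : I -> M -> M) : Prop := HModule {
  hm_linear : forall i, linear (D i);
  hm_lact : forall i c r m, degR c r ->
    D i (lact r m) = eps (vdeg i) c *: lact r (D i m);
  hm_ract : forall i m r, D i (ract m r) = ract (D i m) r;
  hm_rel : forall i j m,
    D i (D j m) - eps (vdeg i) (vdeg j) *: D j (D i m) =
    \sum_r D r (lact (k i j r) m)
}.

Hypothesis hgen_ind : forall P : H -> Prop, P one ->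
  (forall a x y, P x -> P y -> P (a *: x + y)) ->
  (forall r x, P x -> P (lact r x)) ->
  (forall i x, P x -> P (mul (v i) x)) -> forall x, P x.

(** The existence half of the universal property of H; [m0] has to commute with R because [one]
    does. Uniqueness is provided by [gen_bimap_ext]. *)
Hypothesis hlift : forall (M : bimod R) (D : I -> M -> M) (m0 : M),
  hmodule D -> (forall r, lact r m0 = ract m0 r) ->
  exists f : bimap H M, f one = m0 /\ forall i x, f (mul (v i) x) = D i (f x).

Lemma gen_bimap_ext (M : bimod R) (D : I -> M -> M) (f h : H -> M) :
  linear f -> linear h -> f one = h one ->
  (forall r x, f (lact r x) = lact r (f x)) ->
  (forall r x, h (lact r x) = lact r (h x)) ->
  (forall i x, f (mul (v i) x) = D i (f x)) ->
  (forall i x, h (mul (v i) x) = D i (h x)) -> f =1 h.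
Proof.
move=> lf lh fh1 fl hl fv hv; apply: hgen_ind => //.
- by move=> a x y Ex Ey; rewrite lf lh Ex Ey.
- by move=> r x Ex; rewrite fl hl Ex.
- by move=> i x Ex; rewrite fv hv Ex.
Qed.

Lemma lact_one r : lact r one = ract one r.
Proof. by rewrite -[RHS]mul_oner mulR mul_onel. Qed.

Lemma mulZl a x y : mul (a *: x) y = a *: mul x y.
Proof. exact: linZ (mul_linearl y) a x. Qed.
Lemma mulZr a x y : mul x (a *: y) = a *: mul x y.
Proof. exact: linZ (mul_linearr x) a y. Qed.

Lemma mul_suml J (s : seq J) (F : J -> H) x :
  mul (\sum_(r <- s) F r) x = \sum_(r <- s) mul (F r) x.
Proof. exact: (lin_sum (f := mul^~ x) s xpredT F (mul_linearl x)). Qed.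
Lemma mulDl x y z : mul (x + y) z = mul x z + mul y z.
Proof. exact: linD (mul_linearl z) x y. Qed.
Lemma mulDr x y z : mul x (y + z) = mul x y + mul x z.
Proof. exact: linD (mul_linearr x) y z. Qed.
Lemma mul_oppl x y : mul (- x) y = - mul x y.
Proof. by rewrite -scaleN1r mulZl scaleN1r. Qed.
Lemma mul_oppr x y : mul x (- y) = - mul x y.
Proof. by rewrite -scaleN1r mulZr scaleN1r. Qed.

Lemma twist_mul a c x y : deg c x -> tw a (mul x y) = eps a c *: mul x (tw a y).
Proof.
move=> cx; move: y; apply: (hom_ext gH).
- exact: linear_comp (twist_linear objH a) (mul_linearr x).
- apply: linear_scale.
  exact: linear_comp (mul_linearr x) (twist_linear objH a).
move=> b y byy; rewrite (twistE _ _ (deg_mul cx byy)) (twistE _ _ byy) mulZr.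
by rewrite scalerA (bicharDr eps_bichar).
Qed.

Lemma var_lact i c r x : degR c r ->
  mul (v i) (lact r x) = eps (vdeg i) c *: lact r (mul (v i) x).
Proof.
move=> cr; rewrite -mulR lact_mul (color_lact objH cr (deg_var i)) mulZl.
by rewrite scalerA bicharK // scale1r.
Qed.

Lemma mul_var_mul i j x :
  mul (v i) (mul (v j) x) - eps (vdeg i) (vdeg j) *: mul (v j) (mul (v i) x) =
  \sum_r mul (v r) (lact (k i j r) x).
Proof.
rewrite !mul_assoc -mulZl -mul_oppl -mulDl mul_var.
rewrite mul_suml; apply: eq_bigr => r _.
by rewrite -mul_assoc -lact_mul mul_onel.
Qed.

Lemma mul_hmodule : hmodule (fun i => mul (v i)).
Proof.
split=> [i|i c r x|i x r|i j x]; first exact: mul_linearr.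
- exact: var_lact.
- by rewrite ract_mul.
- exact: mul_var_mul.
Qed.

Lemma hom_tens_ext (M : bimod R) (W : lmodType K) (f h : tens H M -> W) :
  linear f -> linear h ->
  (forall a x m, deg a x -> f (tel x m) = h (tel x m)) -> f =1 h.
Proof.
move=> lf lh fh; apply: (tens_ext lf lh) => x m; move: x; apply: (hom_ext gH).
- exact: linear_comp lf (tel_linearl m).
- exact: linear_comp lh (tel_linearl m).
by move=> b x bx; exact: fh bx.
Qed.

(** * The tensor product of H with a module *)

Section TensorModule.
Variables (M : bimod R) (D : I -> M -> M).
Hypothesis hD : hmodule D.

(* For M = H this is multiplication by v_i (x) 1 + 1 (x) v_i in H (x) H. *)
Definition dtens (i : I) : tens H M -> tens H M := tlift (fun (x : H) (m : M) =>
  tel (mul (v i) x) m + tel (tw (vdeg i) x) (D i m)).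

(** In the second summand both sides acquire the factor eps(|v_i|,|r|): from the twist of x r on one
    side, from moving [D i] past r on the other. *)
Lemma dtens_bal i : balanced (fun (x : H) (m : M) =>
  tel (mul (v i) x) m + tel (tw (vdeg i) x) (D i m)).
Proof.
split=> [m|x|r x m].
- apply: linear_add; first exact: linear_comp (tel_linearl m) (mul_linearr _).
  exact: linear_comp (tel_linearl _) (twist_linear objH _).
- apply: linear_add; first exact: tel_linearr.
  exact: linear_comp (tel_linearr _) (hm_linear hD i).
move: r; apply: (scalar_ext degR_span).
- apply: linear_add.
    apply: linear_comp (tel_linearl m) _.
    exact: linear_comp (mul_linearr _) (ract_linear x).
  apply: linear_comp (tel_linearl _) _.
  exact: linear_comp (twist_linear objH _) (ract_linear x).
- apply: linear_add; first exact: linear_comp (tel_linearr _) (lact_linearl m).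
  apply: linear_comp (tel_linearr _) _.
  exact: linear_comp (hm_linear hD i) (lact_linearl m).
move=> c r cr; rewrite -ract_mul telR (twist_ract eps_bichar _ _ _ cr).
by rewrite (hm_lact hD _ _ cr) telZl telZr telR.
Qed.

Lemma dtens_linear i : linear (dtens i).
Proof. exact: tlift_linear (dtens_bal i). Qed.

Lemma dtensE i x m : dtens i (tel x m) =
  tel (mul (v i) x) m + tel (tw (vdeg i) x) (D i m).
Proof. by rewrite /dtens (tliftE (dtens_bal i)). Qed.

(** The summands v_i (x) 1 and 1 (x) v_i satisfy the relations separately, the first by
    [mul_var_mul] and the second by the relations on M. The mixed terms cancel because
    eps(|v_i|,|v_j|) eps(|v_j|,|v_i|) = 1. *)
Lemma dtens_hmodule : hmodule dtens.
Proof.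
split=> [i|i c r t cr|i t r|i j t]; first exact: dtens_linear.
- move: t; apply: tens_ext.
  + exact: linear_comp (dtens_linear i) (lact_linear r).
  + exact: linear_scale _ (linear_comp (lact_linear r) (dtens_linear i)).
  move=> x m; rewrite lact_tel !dtensE (var_lact _ _ cr).
  rewrite (twist_lact eps_bichar _ _ _ cr) !telZl -scalerDr.
  by rewrite lactD !lact_tel.
- move: t; apply: tens_ext.
  + exact: linear_comp (dtens_linear i) (ract_linearl r).
  + exact: linear_comp (ract_linearl r) (dtens_linear i).
  by move=> x m; rewrite ract_tel !dtensE ractD !ract_tel (hm_ract hD).
move: t; apply: tens_ext.
- apply: linear_add; first exact: linear_comp (dtens_linear i) (dtens_linear j).
  apply: linear_opp; apply: linear_scale.
  exact: linear_comp (dtens_linear j) (dtens_linear i).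
- move=> a s t; rewrite scaler_sumr -big_split; apply: eq_bigr => r _.
  by rewrite lactP (dtens_linear r).
move=> x m; rewrite !dtensE.
rewrite !(linD (dtens_linear _)) !dtensE.
rewrite !(twist_mul _ _ (deg_var _)).
under [RHS]eq_bigr => r _.
  rewrite lact_tel dtensE (twist_lact eps_bichar _ _ _ (deg_k i j r)) telZl.
  (* The relation on M has its coefficient in the second factor, while R acts on the tensor product
     through the first. Since the degrees of v_r and [k i j r] add up to |v_i| + |v_j|, the twist by
     |v_i| + |v_j| is exactly what carries the coefficient across. *)
  have <- : tel (tw (vdeg i) (tw (vdeg j) x)) (D r (lact (k i j r) m)) =
    eps (vdeg r) (vdeg i + vdeg j - vdeg r)
      *: tel (lact (k i j r) (tw (vdeg r) x)) (D r m).
    rewrite (hm_lact hD _ _ (deg_k i j r)) telZr -(twistD eps_bichar).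
    rewrite -[X in tw X x](subrK (vdeg r)) (twistD eps_bichar).
    by rewrite (twist_tel objH _ _ (deg_k i j r)).
  over.
rewrite big_split /= -tel_suml -mul_var_mul.
rewrite -tel_sumr -(hm_rel hD).
rewrite -![_ - _ *: _]addrC -!scaleNr !telPl !telPr !telZl !scalerDr !scalerA.
rewrite !mulNr bicharK // scaleN1r (twist_comm objH (vdeg j)).
rewrite !scaleNr.
exact: addr_cross_cancel.
Qed.

End TensorModule.


(** The steps of [hgen_ind] do not preserve homogeneity. It therefore first yields that x is a
    combination of homogeneous elements, each satisfying P in its own degree; the projection f to
    degree b then retains only those of degree b. *)
Lemma hom_gen_ind (P : B -> H -> Prop) : (forall b, P b 0) ->
  (forall b a x y, P b x -> P b y -> P b (a *: x + y)) -> P 0 one ->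
  (forall c b r x, degR c r -> P b x -> P (c + b) (lact r x)) ->
  (forall i b x, P b x -> P (vdeg i + b) (mul (v i) x)) ->
  forall b x, deg b x -> P b x.
Proof.
move=> P0 PP P1 Pl Pv b x bx.
pose S y := exists c, deg c y /\ P c y.
have Sx : lspan S x.
  move: (x); apply: hgen_ind => [|a y z|r y Sy|i y].
  - by apply: lspan_gen; exists 0.
  - exact: lspanP.
  - have ll := lact_linearl y.
    apply: (lspan_linear (f := fun s => lact s y) ll) (degR_span r).
    move=> s [c cs]; apply: (lspan_linear (lact_linear s)) Sy.
    move=> z [d [dz Pz]]; apply: lspan_gen; exists (c + d); split.
      exact: (deg_lact gH cs dz).
    exact: Pl.
  - apply: (lspan_linear (mul_linearr _)) => z [d [dz Pz]].
    apply: lspan_gen; exists (vdeg i + d); split; last exact: Pv.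
    exact: deg_mul.
have lF c : linear (fun y : H => if c == b then y else 0).
  by case: (c == b); [exact: linear_id|exact: linear_zero].
have [f [lf fE]] := homogeneous_extension gH lF.
have {1}<- : f x = x by rewrite (fE b) // eqxx.
elim: {bx} Sx => [{}x [c [cx Pc]]||a {}x y _ Px _ Py].
- by rewrite (fE c) //; case: eqVneq => [<-|].
- by rewrite (lin0 lf).
- by rewrite lf; exact: PP.
Qed.

(** * Coproduct, counit and antipode as maps into modules *)

Lemma comul_central r : lact r (tel one one : T2) = ract (tel one one : T2) r.
Proof. by rewrite lact_tel ract_tel lact_one telR lact_one. Qed.

Local Notation D2 := (dtens (fun i => mul (v i))).
Local Notation D3 := (dtens D2).

Let hD2 : hmodule D2 := dtens_hmodule mul_hmodule.

Let D2_linear i : linear (D2 i) := dtens_linear mul_hmodule i.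
Let D2E i x y : D2 i (tel x y) =
  tel (mul (v i) x) y + tel (tw (vdeg i) x) (mul (v i) y).
Proof. exact: (dtensE mul_hmodule). Qed.

Definition comul : bimap H T2 := sval (cid (hlift hD2 comul_central)).

Lemma comul_one : comul one = tel one one.
Proof. exact: (svalP (cid (hlift hD2 comul_central))).1. Qed.

Lemma comul_var i x : comul (mul (v i) x) = D2 i (comul x).
Proof. exact: (svalP (cid (hlift hD2 comul_central))).2. Qed.

Lemma zero_hmodule : @hmodule (regular_bimod R) (fun _ _ => 0).
Proof.
split=> [i|i c r m _|i m r|i j m]; first exact: linear_zero.
- by rewrite lact0 scaler0.
- by rewrite ract0.
- by rewrite scaler0 subr0 big1.
Qed.

Lemma counit_central r :
  lact r (1 : regular_bimod R) = ract (1 : regular_bimod R) r.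
Proof. by rewrite /= mulr1 mul1r. Qed.

Definition counit : bimap H (regular_bimod R) :=
  sval (cid (hlift zero_hmodule counit_central)).

Lemma counit_one : counit one = 1.
Proof. exact: (svalP (cid (hlift zero_hmodule counit_central))).1. Qed.

Lemma counit_var i x : counit (mul (v i) x) = 0.
Proof. exact: (svalP (cid (hlift zero_hmodule counit_central))).2. Qed.

(** A braided antihomomorphism with S v_i = - v_i satisfies S (v_i x) = - eps(|v_i|,|x|) S(x) v_i.
    As S preserves degrees, the sign can be read off S(x), which makes the right side an operator on
    S(x). *)
Definition danti i x := - mul (tw (vdeg i) x) (v i).

Lemma danti_linear i : linear (danti i).
Proof.
apply: linear_opp.
exact: linear_comp (mul_linearl _) (twist_linear objH _).
Qed.

Lemma dantiE i b x : deg b x ->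
  danti i x = - eps (vdeg i) b *: mul x (v i).
Proof. by move=> bx; rewrite /danti (twistE _ _ bx) mulZl scaleNr. Qed.

(** For x of degree b, both sides of the relation equal - eps(|v_i| + |v_j|, b) x (v_i v_j -
    eps(|v_i|,|v_j|) v_j v_i). Right multiplications compose in the reverse order, and the signs
    between v_i and v_j make up for this. *)
Lemma danti_hmodule : hmodule danti.
Proof.
split=> [i|i c r x cr|i x r|i j x]; first exact: danti_linear.
- rewrite /danti (twist_lact eps_bichar _ _ _ cr) mulZl -lact_mul -scalerN.
  by rewrite -(scaleN1r (mul _ _)) lactZ scaleN1r.
- move: r; apply: (scalar_ext degR_span).
  + exact: linear_comp (danti_linear i) (ract_linear x).
  + exact: ract_linear.
  move=> c r cr; rewrite /danti (twist_ract eps_bichar _ _ _ cr) mulZl mulR.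
  rewrite (color_lact objH cr (deg_var i)) mulZr scalerA bicharK // scale1r.
  by rewrite -ract_mul -scaleN1r -ractZ scaleN1r.
move: x; apply: (hom_ext gH).
- apply: linear_add; first exact: linear_comp (danti_linear i) (danti_linear j).
  apply/linear_opp/linear_scale.
  exact: linear_comp (danti_linear j) (danti_linear i).
- move=> a x y; rewrite scaler_sumr -big_split; apply: eq_bigr => r _.
  by rewrite lactP (danti_linear r).
move=> b x bx; rewrite !(dantiE _ bx) !(linZ (danti_linear _)).
rewrite !(dantiE _ (deg_mul bx (deg_var _))) -!mul_assoc !scalerA !mulrNN.
under [RHS]eq_bigr => r _.
  rewrite (dantiE _ (deg_lact gH (deg_k i j r) bx)).
  rewrite (color_lact objH (deg_k i j r) bx) mulZl mulR.
  rewrite (color_lact objH (deg_k i j r) (deg_var r)) mulZr.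
  rewrite -[X in ract X _]mul_oner ract_mul -lact_one !scalerA.
  (* The factor turns out not to depend on r: the signs between v_r and its coefficient cancel, and
     the two degrees add up to |v_i| + |v_j|. It can thus be pulled out of the sum, where [mul_var]
     applies. *)
  have -> : - eps (vdeg r) (vdeg i + vdeg j - vdeg r + b)
      * (eps (vdeg i + vdeg j - vdeg r) b
         * eps (vdeg i + vdeg j - vdeg r) (vdeg r)) = - eps (vdeg i + vdeg j) b.
    rewrite -[in RHS](subrK (vdeg r) (vdeg i + vdeg j)).
    rewrite (bicharDl eps_bichar _ (vdeg r)) (bicharDr eps_bichar).
    set c := _ - _; rewrite mulNr [eps c b * _]mulrC mulrACA bicharK //.
    by rewrite mul1r mulrC.
  over.
rewrite -scaler_sumr -(lin_sum (f := mul x) _ xpredT _ (mul_linearr x)).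
rewrite -mul_var.
rewrite mulDr mul_oppr mulZr scalerBr scalerA.
rewrite !(bicharDr eps_bichar) (bicharDl eps_bichar).
have -> : eps (vdeg i) (vdeg j) * - eps (vdeg i) b *
    - (eps (vdeg j) b * eps (vdeg j) (vdeg i)) =
    eps (vdeg i) b * eps (vdeg j) b.
  rewrite mulrN mulrN mulNr opprK [eps (vdeg j) b * _]mulrC mulrACA.
  by rewrite bicharK // mul1r.
rewrite addrC scaleNr mulNr scaleNr opprK; congr (- _ + _ *: _).
by rewrite mulrCA mulrA.
Qed.


Definition anti : bimap H H := sval (cid (hlift danti_hmodule lact_one)).

Lemma anti_one : anti one = one.
Proof. exact: (svalP (cid (hlift danti_hmodule lact_one))).1. Qed.

Lemma anti_var i x : anti (mul (v i) x) = danti i (anti x).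
Proof. exact: (svalP (cid (hlift danti_hmodule lact_one))).2. Qed.

(** * The structure maps are graded bimodule maps *)

Hypotheses (degR0 : forall b, degR b 0)
  (degRP : forall b a r s, degR b r -> degR b s -> degR b (a *: r + s))
  (degR1 : degR 0 1)
  (degRM : forall a b r s, degR a r -> degR b s -> degR (a + b) (r * s)).

Lemma comul_deg b x : deg b x -> deg b (comul x : grtens H H).
Proof.
move: b x; apply: hom_gen_ind => [b|b a x y||c b r x cr|i b x].
- by rewrite (lin0 (bfun_linear comul)); exact: lspan0.
- by move=> bx byy; rewrite bfun_linear; exact: lspanP.
- rewrite comul_one; apply: lspan_gen; exists 0, 0, one, one.
  by rewrite addr0.
- rewrite bfunl; apply: (lspan_linear (@lact_linear K R T2 r)).
  move=> _ [a [d [y [z [<- ay dz ->]]]]]; rewrite lact_tel addrA.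
  apply: lspan_gen; exists (c + a), d, (lact r y), z; split=> //.
  exact: (deg_lact gH).
- rewrite comul_var; apply: (lspan_linear (D2_linear i)).
  move=> _ [a [d [y [z [<- ay dz ->]]]]]; rewrite D2E -[tel (mul _ _) z]scale1r.
  apply: lspanP; apply: lspan_gen.
    exists (vdeg i + a), d, (mul (v i) y), z.
    split=> //; first by rewrite addrA.
    exact: deg_mul.
  exists a, (vdeg i + d), (tw (vdeg i) y), (mul (v i) z).
  by split=> //; [rewrite addrCA|exact: deg_twist|exact: deg_mul].
Qed.

Lemma counit_deg b x : deg b x -> degR b (counit x).
Proof.
move: b x; apply: hom_gen_ind => [b|b a x y||c b r x cr|i b x].
- by rewrite (lin0 (bfun_linear counit)).
- by move=> bx byy; rewrite bfun_linear; exact: degRP.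
- by rewrite counit_one.
- by rewrite bfunl => bx; exact: degRM.
- by rewrite counit_var.
Qed.

Lemma anti_deg b x : deg b x -> deg b (anti x).
Proof.
move: b x; apply: hom_gen_ind => [b|b a x y||c b r x cr|i b x].
- by rewrite (lin0 (bfun_linear anti)); exact: (deg0 gH).
- by move=> bx byy; rewrite bfun_linear; exact: (degP gH).
- by rewrite anti_one.
- by rewrite bfunl => bx; exact: (deg_lact gH).
- rewrite anti_var => bx; rewrite (dantiE _ bx) addrC.
  by apply: (deg_scale gH); exact: deg_mul.
Qed.

Lemma mul_bal : balanced mul.
Proof. by split. Qed.

Definition mult_fun : T2 -> H := tlift mul.

Lemma mult_funE x y : mult_fun (tel x y) = mul x y.
Proof. exact: tliftE mul_bal x y. Qed.

Lemma mult_linear : linear mult_fun.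
Proof. exact: tlift_linear mul_bal. Qed.

Lemma mult_bimap :
  (forall r t, mult_fun (lact r t) = lact r (mult_fun t)) /\
  (forall r t, mult_fun (ract t r) = ract (mult_fun t) r).
Proof.
apply: (tens_bimap mult_linear) => r x y; rewrite !mult_funE.
- by rewrite lact_mul.
- by rewrite ract_mul.
Qed.

Definition mult : bimap T2 H := Bimap mult_linear mult_bimap.1 mult_bimap.2.

Lemma multE x y : mult (tel x y) = mul x y.
Proof. exact: mult_funE. Qed.

Lemma mult_deg c t : deg c (t : grtens H H) -> deg c (mult t).
Proof.
elim=> [{}t [a [b [x [y [<- ax byy ->]]]]]||a {}t s _ ct _ cs].
- by rewrite multE; exact: deg_mul.
- by rewrite (lin0 (bfun_linear mult)); exact: (deg0 gH).
- by rewrite bfun_linear; exact: (degP gH).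
Qed.

Definition unit_fun (r : regular_bimod R) : H := lact r one.

Lemma unit_bimap :
  (forall r s, unit_fun (lact r s) = lact r (unit_fun s)) /\
  (forall r s, unit_fun (ract s r) = ract (unit_fun s) r).
Proof.
split=> r s; rewrite /unit_fun /= lactA //.
by rewrite lact_one lractA.
Qed.

Definition unit_map : bimap (regular_bimod R) H :=
  @Bimap K R (regular_bimod R) H unit_fun (lact_linearl one) unit_bimap.1
    unit_bimap.2.

Lemma unit_deg b r : degR b r -> deg b (unit_map r).
Proof. by move=> br; rewrite -[b]addr0; exact: (deg_lact gH). Qed.

(** * Multiplicativity of the coproduct *)

Local Notation br := (braiding eps_bichar degR_span objH objH).

Lemma tens_hom_ext (W : lmodType K) (f h : T2 -> W) : linear f -> linear h ->
  (forall a b x y, deg a x -> deg b y -> f (tel x y) = h (tel x y)) ->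
  f =1 h.
Proof.
move=> lf lh fh; apply: (hom_tens_ext lf lh) => a x y ax.
move: y; apply: (hom_ext gH).
- exact: linear_comp lf (tel_linearr x).
- exact: linear_comp lh (tel_linearr x).
by move=> b y byy; exact: fh ax byy.
Qed.

(* The product of the algebra H (x) H in the braided category. *)
Definition mul2 (s t : T2) : T2 := tmap mult mult (mid_swap br (tel s t)).

Lemma mul2E b x y z w : deg b y ->
  mul2 (tel x y) (tel z w) = tel (mul x (tw b z)) (mul y w).
Proof.
move=> byy.
have brE : br (tel y z) = tel (tw b z) y by exact: braiding_funE.
rewrite /mul2 /mid_swap tassocE !tmapE tassocVE tmapE.
rewrite [X in tassoc _ _ _ (tel X _)]brE.
by rewrite tassocE tassocVE tmapE !multE.
Qed.

Lemma mid_swap_linear : linear (mid_swap br).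
Proof.
apply: (linear_comp (bfun_linear (tassocV H H T2))).
apply: (linear_comp (bfun_linear (tmap (bimap_id H) (tassoc H H H)))).
apply: (linear_comp (bfun_linear (tmap (bimap_id H) (tmap br (bimap_id H))))).
apply: (linear_comp (bfun_linear (tmap (bimap_id H) (tassocV H H H)))).
exact: bfun_linear.
Qed.

Lemma mul2_linearl t : linear (mul2^~ t).
Proof.
apply: (linear_comp (bfun_linear (tmap mult mult))).
exact: linear_comp mid_swap_linear (tel_linearl t).
Qed.

Lemma mul2_linearr s : linear (mul2 s).
Proof.
apply: (linear_comp (bfun_linear (tmap mult mult))).
exact: linear_comp mid_swap_linear (tel_linearr s).
Qed.

Lemma mul2_lact r s t : mul2 (lact r s) t = lact r (mul2 s t).
Proof.
move: s; apply: tens_hom_ext.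
- exact: linear_comp (mul2_linearl t) (lact_linear r).
- exact: linear_comp (lact_linear r) (mul2_linearl t).
move=> a b x y ax byy; move: t; apply: tens_ext.
- exact: mul2_linearr.
- exact: linear_comp (lact_linear r) (mul2_linearr _).
by move=> z w; rewrite lact_tel !(mul2E _ _ _ byy) lact_tel lact_mul.
Qed.

(** The case of associativity of H (x) H that multiplicativity of Delta requires: the leftmost
    factor is Delta v_i. *)
Lemma mul2_var i s t : mul2 (D2 i s) t = D2 i (mul2 s t).
Proof.
move: s; apply: tens_hom_ext.
- exact: linear_comp (mul2_linearl t) (D2_linear i).
- exact: linear_comp (D2_linear i) (mul2_linearl t).
move=> a b x y ax byy; move: t; apply: tens_ext.
- exact: mul2_linearr.
- exact: linear_comp (D2_linear i) (mul2_linearr _).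
move=> z w; rewrite D2E (linD (mul2_linearl _)) !(mul2E _ _ _ byy).
rewrite (mul2E _ _ _ (deg_mul (deg_var i) byy)) D2E -!mul_assoc.
by rewrite (twist_mul _ _ ax) (twistE _ _ ax) mulZl (twistD eps_bichar).
Qed.

(** With y fixed, both sides as functions of x take [one] to Delta y and turn multiplication by v_i
    into [D2 i]. *)
Lemma comul_mul x y : comul (mul x y) = mul2 (comul x) (comul y).
Proof.
move: x; apply: (gen_bimap_ext (D := D2)).
- exact: linear_comp (bfun_linear comul) (mul_linearl y).
- exact: linear_comp (mul2_linearl _) (bfun_linear comul).
- rewrite comul_one mul_onel; move: (comul y); apply: tens_ext.
  + exact: linear_id.
  + exact: mul2_linearr.
  move=> z w; rewrite (mul2E _ _ _ deg_one) !mul_onel.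
  by rewrite (twist0 eps_bichar).
- by move=> r x; rewrite -lact_mul bfunl.
- by move=> r x; rewrite bfunl mul2_lact.
- by move=> i x; rewrite -mul_assoc comul_var.
- by move=> i x; rewrite comul_var mul2_var.
Qed.

(** * Coassociativity, counit and antipode identities *)

Definition twist2 (a : B) : T2 -> T2 :=
  tlift (fun x y : H => tel (tw a x) (tw a y)).

Lemma twist2_bal a : balanced (fun x y : H => tel (tw a x) (tw a y)).
Proof.
split=> [y|x|r x y].
- exact: linear_comp (tel_linearl _) (twist_linear objH a).
- exact: linear_comp (tel_linearr _) (twist_linear objH a).
move: r; apply: (scalar_ext degR_span).
- apply: linear_comp (tel_linearl _) _.
  exact: linear_comp (twist_linear objH a) (ract_linear x).
- apply: linear_comp (tel_linearr _) _.
  exact: linear_comp (twist_linear objH a) (lact_linearl y).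
move=> c r cr; rewrite (twist_ract eps_bichar _ _ _ cr).
by rewrite (twist_lact eps_bichar _ _ _ cr) telZl telZr telR.
Qed.

Lemma twist2_linear a : linear (twist2 a).
Proof. exact: tlift_linear (twist2_bal a). Qed.

Lemma twist2E a x y : twist2 a (tel x y) = tel (tw a x) (tw a y).
Proof. exact: tliftE (twist2_bal a) x y. Qed.

(** Delta preserves degrees, and eps(a, c + d) = eps(a,c) eps(a,d) distributes the twist over the
    two factors. *)
Lemma comul_twist a x : comul (tw a x) = twist2 a (comul x).
Proof.
move: x; apply: (hom_ext gH).
- exact: linear_comp (bfun_linear comul) (twist_linear objH a).
- exact: linear_comp (twist2_linear a) (bfun_linear comul).
move=> b x bx; rewrite (twistE _ _ bx) (linZ (bfun_linear comul)).
have lb : linear (fun t : T2 => eps a b *: t).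
  exact: linear_scale _ (@linear_id _ _).
apply: (lspan_ext lb (twist2_linear a)) (comul_deg bx).
move=> _ [c [d [y [z [<- cy dz ->]]]]]; rewrite twist2E.
by rewrite (twistE _ _ cy) (twistE _ _ dz) telZl telZr scalerA bicharDr.
Qed.

(** Both iterated coproducts intertwine multiplication by v_i with [D3], the action of v_i (x) 1 (x)
    1 + 1 (x) v_i (x) 1 + 1 (x) 1 (x) v_i. For the left one, Delta is applied to a twisted first
    factor, which is why [comul_twist] is needed. *)
Lemma comul_assoc x :
  tassoc H H H (tmap comul (bimap_id H) (comul x)) =
  tmap (bimap_id H) comul (comul x).
Proof.
pose F t := tassoc H H H (tmap comul (bimap_id H) t).
have lF : linear F by exact: linear_comp (bfun_linear _) (bfun_linear _).
pose G := tmap (bimap_id H) comul.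
have FD i t : F (D2 i t) = D3 i (F t).
  move: t; apply: tens_ext.
  - exact: linear_comp lF (D2_linear i).
  - exact: linear_comp (dtens_linear hD2 i) lF.
  move=> y z; rewrite D2E (linD lF) /F !tmapE comul_var comul_twist.
  move: (comul y); apply: tens_ext.
  - apply: linear_add; apply: (linear_comp (bfun_linear (tassoc H H H))).
      exact: linear_comp (tel_linearl _) (D2_linear i).
    exact: linear_comp (tel_linearl _) (twist2_linear _).
  - apply: (linear_comp (dtens_linear hD2 i)).
    exact: (linear_comp (bfun_linear (tassoc H H H))) (tel_linearl _).
  move=> a b; rewrite D2E twist2E telDl (linD (bfun_linear (tassoc H H H))).
  by rewrite !tassocE (dtensE hD2) D2E telDr addrA.
have GD i t : G (D2 i t) = D3 i (G t).
  move: t; apply: tens_ext.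
  - exact: linear_comp (bfun_linear G) (D2_linear i).
  - exact: linear_comp (dtens_linear hD2 i) (bfun_linear G).
  move=> y z; rewrite D2E (linD (bfun_linear G)) /G !tmapE comul_var.
  by rewrite (dtensE hD2).
move: x; apply: (gen_bimap_ext (D := D3) (f := fun x => F (comul x))
  (h := fun x => G (comul x))).
- exact: linear_comp lF (bfun_linear comul).
- exact: linear_comp (bfun_linear G) (bfun_linear comul).
- by rewrite /F /G comul_one !tmapE comul_one tassocE.
- by move=> r x; rewrite /F !bfunl.
- by move=> r x; rewrite !bfunl.
- by move=> i x; rewrite comul_var FD.
- by move=> i x; rewrite comul_var GD.
Qed.

Lemma comul_counitl x : tunitl H (tmap counit (bimap_id H) (comul x)) = x.
Proof.
pose F t := tunitl H (tmap counit (bimap_id H) t).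
have lF : linear F by exact: linear_comp (bfun_linear _) (bfun_linear _).
have FD i t : F (D2 i t) = mul (v i) (F t).
  move: t; apply: hom_tens_ext.
  - exact: linear_comp lF (D2_linear i).
  - exact: linear_comp (mul_linearr _) lF.
  move=> c y z cy; rewrite D2E (linD lF) /F !tmapE !tunitlE counit_var.
  rewrite (twistE _ _ cy) (linZ (bfun_linear counit)).
  rewrite (linZ (lact_linearl _)) (lin0 (lact_linearl _)) add0r.
  (* The sign left by the twist of y is the one for v_i passing [counit y], an element of R of the
     same degree as y. *)
  by rewrite (var_lact _ _ (counit_deg cy)).
move: x; apply: (gen_bimap_ext (D := fun i => mul (v i))
  (f := fun x => F (comul x))) => //.
- exact: linear_comp lF (bfun_linear comul).
- by rewrite /F comul_one tmapE tunitlE counit_one lact1.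
- by move=> r x; rewrite /F !bfunl.
- by move=> i x; rewrite comul_var FD.
Qed.

Lemma comul_counitr x : tunitr H (tmap (bimap_id H) counit (comul x)) = x.
Proof.
pose F t := tunitr H (tmap (bimap_id H) counit t).
have lF : linear F by exact: linear_comp (bfun_linear _) (bfun_linear _).
have FD i t : F (D2 i t) = mul (v i) (F t).
  move: t; apply: tens_ext.
  - exact: linear_comp lF (D2_linear i).
  - exact: linear_comp (mul_linearr _) lF.
  move=> y z; rewrite D2E (linD lF) /F !tmapE !tunitrE counit_var.
  by rewrite (lin0 (ract_linear _)) addr0 ract_mul.
move: x; apply: (gen_bimap_ext (D := fun i => mul (v i))
  (f := fun x => F (comul x))) => //.
- exact: linear_comp lF (bfun_linear comul).
- by rewrite /F comul_one tmapE tunitrE counit_one ract1.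
- by move=> r x; rewrite /F !bfunl.
- by move=> i x; rewrite comul_var FD.
Qed.

Lemma counit_mul x y : counit (mul x y) = counit x * counit y.
Proof.
move: x; apply: (gen_bimap_ext (D := fun _ (_ : regular_bimod R) => 0)
  (f := fun x => counit (mul x y)) (h := fun x => counit x * counit y)).
- exact: linear_comp (bfun_linear counit) (mul_linearl y).
- exact: linear_comp (regular_linearr (counit y)) (bfun_linear counit).
- by rewrite mul_onel counit_one mul1r.
- by move=> r x; rewrite -lact_mul bfunl.
- by move=> r x; rewrite bfunl /= mulrA.
- by move=> i x; rewrite -mul_assoc counit_var.
- by move=> i x; rewrite counit_var mul0r.
Qed.

(** S(v_i y) z cancels against the twisted S(y) v_i z, so F vanishes on the image of [D2 i], just as
    the counit vanishes on v_i x. Both sides thus intertwine multiplication by v_i with zero. *)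
Lemma mult_antil x :
  mult (tmap anti (bimap_id H) (comul x)) = unit_map (counit x).
Proof.
pose F t := mult (tmap anti (bimap_id H) t).
have lF : linear F by exact: linear_comp (bfun_linear _) (bfun_linear _).
have FD i t : F (D2 i t) = 0.
  move: t; apply: hom_tens_ext.
  - exact: linear_comp lF (D2_linear i).
  - exact: linear_zero.
  move=> c y z cy; rewrite D2E (linD lF) /F !tmapE !multE anti_var.
  rewrite (twistE _ _ cy) (linZ (bfun_linear anti)) (dantiE _ (anti_deg cy)).
  by rewrite !mulZl -mul_assoc scaleNr addNr.
move: x; apply: (gen_bimap_ext (D := fun _ _ => 0) (f := fun x => F (comul x))
  (h := fun x => unit_map (counit x))).
- exact: linear_comp lF (bfun_linear comul).
- exact: linear_comp (bfun_linear unit_map) (bfun_linear counit).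
- rewrite /F comul_one tmapE multE anti_one counit_one mul_onel.
  by rewrite /= /unit_fun lact1.
- by move=> r x; rewrite /F !bfunl.
- by move=> r x; rewrite !bfunl.
- by move=> i x; rewrite comul_var FD.
- by move=> i x; rewrite counit_var (lin0 (bfun_linear unit_map)).
Qed.

(** On this side F does not kill the image of [D2 i]: it turns [D2 i] into the color commutator with
    v_i. The right side of the identity fits because v_i color commutes with the image of R, so this
    commutator vanishes there. *)
Lemma mult_antir x :
  mult (tmap (bimap_id H) anti (comul x)) = unit_map (counit x).
Proof.
pose F t := mult (tmap (bimap_id H) anti t).
have lF : linear F by exact: linear_comp (bfun_linear _) (bfun_linear _).
pose D i z := mul (v i) z - mul (tw (vdeg i) z) (v i).
have lD i : linear (D i).
  apply: linear_add; first exact: mul_linearr.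
  apply: linear_opp.
  exact: linear_comp (mul_linearl _) (twist_linear objH _).
have FD i t : F (D2 i t) = D i (F t).
  move: t; apply: tens_hom_ext.
  - exact: linear_comp lF (D2_linear i).
  - exact: linear_comp (lD i) lF.
  move=> a b y z ay bz; rewrite D2E (linD lF) /F !tmapE !multE anti_var.
  rewrite (dantiE _ (anti_deg bz)) (twistE _ _ ay) /D.
  rewrite (twistE _ _ (deg_mul ay (anti_deg bz))) !mulZl mulZr !mul_assoc.
  by rewrite scalerA mulrN scaleNr bicharDr.
move: x; apply: (gen_bimap_ext (D := D) (f := fun x => F (comul x))
  (h := fun x => unit_map (counit x))).
- exact: linear_comp lF (bfun_linear comul).
- exact: linear_comp (bfun_linear unit_map) (bfun_linear counit).
- rewrite /F comul_one tmapE multE anti_one counit_one mul_onel.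
  by rewrite /= /unit_fun lact1.
- by move=> r x; rewrite /F !bfunl.
- by move=> r x; rewrite !bfunl.
- by move=> i x; rewrite comul_var FD.
move=> i x; rewrite counit_var (lin0 (bfun_linear unit_map)).
move: (counit x); apply: (scalar_ext degR_span).
- exact: linear_zero.
- exact: linear_comp (lD i) (bfun_linear unit_map).
move=> c r cr; rewrite /= /unit_fun /D (var_lact _ _ cr) mul_oner.
rewrite (twist_lact eps_bichar _ _ _ cr) (twistE _ _ deg_one).
by rewrite (bichar0r eps_bichar) scale1r mulZl -lact_mul mul_onel subrr.
Qed.

Lemma mult_assoc (t : tens T2 H) :
  mult (tmap mult (bimap_id H) t) =
  mult (tmap (bimap_id H) mult (tassoc H H H t)).
Proof.
move: t; apply: tens_ext.
- apply: (linear_comp (bfun_linear mult)).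
  exact: (bfun_linear (tmap mult (bimap_id H))).
- apply: (linear_comp (bfun_linear mult)).
  apply: (linear_comp (bfun_linear (tmap (bimap_id H) mult))).
  exact: (bfun_linear (tassoc H H H)).
move=> s z; move: s; apply: tens_ext.
- apply: (linear_comp (bfun_linear mult)).
  exact: linear_comp (bfun_linear (tmap mult _)) (tel_linearl z).
- apply: (linear_comp (bfun_linear mult)).
  apply: (linear_comp (bfun_linear (tmap (bimap_id H) mult))).
  exact: linear_comp (bfun_linear (tassoc H H H)) (tel_linearl z).
by move=> x y; rewrite tassocE !tmapE !multE mul_assoc.
Qed.

Lemma mult_unitl (t : tens (regular_bimod R) H) :
  mult (tmap unit_map (bimap_id H) t) = tunitl H t.
Proof.
move: t; apply: tens_ext.
- apply: (linear_comp (bfun_linear mult)).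
  exact: (bfun_linear (tmap unit_map (bimap_id H))).
- exact: (bfun_linear (tunitl H)).
by move=> r x; rewrite tmapE multE tunitlE -lact_mul mul_onel.
Qed.

Lemma mult_unitr (t : tens H (regular_bimod R)) :
  mult (tmap (bimap_id H) unit_map t) = tunitr H t.
Proof.
move: t; apply: tens_ext.
- apply: (linear_comp (bfun_linear mult)).
  exact: (bfun_linear (tmap (bimap_id H) unit_map)).
- exact: (bfun_linear (tunitr H)).
by move=> x r; rewrite tmapE multE tunitrE -mulR mul_oner.
Qed.

Lemma comul_mult (t : T2) :
  comul (mult t) = tmap mult mult (mid_swap br (tmap comul comul t)).
Proof.
move: t; apply: tens_ext.
- exact: linear_comp (bfun_linear comul) (bfun_linear mult).
- apply: (linear_comp (bfun_linear (tmap mult mult))).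
  exact: linear_comp mid_swap_linear (bfun_linear (tmap comul comul)).
by move=> x y; rewrite multE comul_mul tmapE.
Qed.

Lemma comul_unit (t : tens (regular_bimod R) (regular_bimod R)) :
  comul (unit_map (tunitl (regular_bimod R) t)) = tmap unit_map unit_map t.
Proof.
move: t; apply: tens_ext.
- apply: (linear_comp (bfun_linear comul)).
  apply: (linear_comp (bfun_linear unit_map)).
  exact: (bfun_linear (tunitl (regular_bimod R))).
- exact: (bfun_linear (tmap unit_map unit_map)).
move=> r s; rewrite tunitlE tmapE /= /unit_fun bfunl comul_one lact_tel.
by rewrite -telR lractA -lact_one [in LHS]lactA.
Qed.

Lemma counit_mult (t : T2) :
  counit (mult t) = tunitl (regular_bimod R) (tmap counit counit t).
Proof.
move: t; apply: tens_ext.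
- exact: linear_comp (bfun_linear counit) (bfun_linear mult).
- apply: (linear_comp (bfun_linear (tunitl (regular_bimod R)))).
  exact: (bfun_linear (tmap counit counit)).
by move=> x y; rewrite multE counit_mul tmapE tunitlE.
Qed.

Lemma counit_unit r : counit (unit_map r) = r.
Proof. by rewrite /= /unit_fun bfunl counit_one /= mulr1. Qed.

Theorem color_envelope_hopf : exists h : color_hopf_algebra degR eps H,
  (forall x y, hmul h (tel x y) = mul x y) /\
  (forall r, hunit h r = lact r one).
Proof.
unshelve eexists.
  apply: (@ColorHopf K R B degR eps H objH br
    (@GrMor K R B (grtens H H) H mult mult_deg)
    (@GrMor K R B (grunit degR) H unit_map unit_deg)
    (@GrMor K R B H (grtens H H) comul comul_deg)
    (@GrMor K R B H (grunit degR) counit counit_deg)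
    (@GrMor K R B H H anti anti_deg)).
- exact: braidingP.
- exact: mult_assoc.
- exact: mult_unitl.
- exact: mult_unitr.
- exact: comul_assoc.
- exact: comul_counitl.
- exact: comul_counitr.
- exact: comul_mult.
- exact: comul_unit.
- exact: counit_mult.
- exact: counit_unit.
- exact: mult_antil.
- exact: mult_antir.
by split=> [x y|r]; [exact: multE|].
Qed.

End ColorEnvelope.



(** * Modules over the algebra given by generators and relations *)

Lemma malg_unitM (M : monomType) (A : nzRingType) (u w : M) :
  (<< u >> : {malg A[M]}) * << w >> = << mmul u w >>.
Proof.
rewrite (malgMEw (msuppU_le (k := u) (x := 1)) (msuppU_le (k := w) (x := 1))).
by rewrite !big_seq_fset1 !mcoeffUU mulr1.
Qed.

Lemma malg_ext (K : fieldType) (J : choiceType) (W : lmodType K)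
    (f h : {malg K[J]} -> W) :
  linear f -> linear h -> (forall u, f << u >> = h << u >>) -> f =1 h.
Proof.
move=> lf lh fh x; rewrite [x]monalgE.
rewrite (lin_sum (f := f) _ xpredT _ lf) (lin_sum (f := h) _ xpredT _ lh).
apply: eq_bigr => u _.
have -> : << x@_u *g u >> = x@_u *: (<< u >> : {malg K[J]}).
  by apply/malgP => w; rewrite mcoeffZ !mcoeffU mulrnAr mulr1.
by rewrite (linZ lf) (linZ lh) fh.
Qed.

Section Presentation.
Variables (K : fieldType) (G : finZmodType) (V : vectType K) (n : nat).
Variables (v : n.-tuple V) (chi : 'I_n -> lin_char G K).
Variables (q : 'I_n -> 'I_n -> K) (kappa : V -> V -> {ffun G -> V}).

Local Notation act := (diag_action chi).
Local Notation TG := (Defs.skew act).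
Local Notation H := (qdoa v chi q kappa).

Section Module.
Variables (W : lmodType K) (D : 'I_n -> W -> W) (E : G -> W -> W).
Hypotheses (D_linear : forall i, linear (D i))
  (E_linear : forall g, linear (E g))
  (E0 : forall w, E 0 w = w) (ED : forall g h w, E (g + h) w = E g (E h w))
  (E_D : forall g i w, E g (D i w) = chi i g *: D i (E g w))
  (D_rel : forall i j w, D i (D j w) - q i j *: D j (D i w) =
     \sum_g \sum_r kappa_coef v kappa i j r g *: D r (E g w)).

Definition word_act (u : {fmonom 'I_n}) (w : W) : W := foldr D w u.

Lemma word_act_linear u : linear (word_act u).
Proof.
rewrite /word_act; elim: (fmonom_val u) => [|i s IHs] a x y //=.
by rewrite IHs D_linear.
Qed.

Definition tens_act (x : tensor_alg K n) (w : W) : W :=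
  malg_lift (word_act^~ w) x.

Lemma tens_act_linearl w : linear (tens_act^~ w).
Proof. exact: malg_lift_linear. Qed.

Lemma tens_actU u w : tens_act << u >> w = word_act u w.
Proof. exact: malg_liftU. Qed.

Lemma tens_act_linear x : linear (tens_act x).
Proof.
move=> a w w'; rewrite /tens_act /malg_lift scaler_sumr -big_split /=.
apply: eq_bigr => u _; rewrite word_act_linear scalerDr !scalerA.
by rewrite [_ * a]mulrC.
Qed.

Lemma tens_mul_linear (x : tensor_alg K n) : linear ( *%R x).
Proof. by move=> a y z; rewrite mulrDr scalerAr. Qed.

Lemma tens_mul_linearl (y : tensor_alg K n) : linear (fun x => x * y).
Proof. by move=> a x z; rewrite mulrDl scalerAl. Qed.

Lemma tens_actM x y w : tens_act (x * y) w = tens_act x (tens_act y w).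
Proof.
move: x; apply: (malg_ext (f := fun x => tens_act (x * y) w)
                          (h := fun x => tens_act x (tens_act y w))).
- exact: linear_comp (tens_act_linearl w) (tens_mul_linearl y).
- exact: tens_act_linearl.
move=> u; move: y; apply: (malg_ext (f := fun y => tens_act (<< u >> * y) w)
                          (h := fun y => tens_act << u >> (tens_act y w))).
- exact: linear_comp (tens_act_linearl w) (tens_mul_linear _).
- exact: linear_comp (tens_act_linear _) (tens_act_linearl w).
by move=> u'; rewrite malg_unitM !tens_actU /word_act fmM foldr_cat.
Qed.

Lemma tens_act1 w : tens_act 1 w = w.
Proof. by rewrite tens_actU /word_act fm1. Qed.

Lemma tens_act_var i w : tens_act (tvar K i) w = D i w.
Proof. by rewrite tens_actU /word_act fmU. Qed.

Lemma tens_act_group g x w : E g (tens_act x w) = tens_act (act g x) (E g w).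
Proof.
move: x; apply: (malg_ext (f := fun x => E g (tens_act x w))
                          (h := fun x => tens_act (act g x) (E g w))).
- exact: linear_comp (E_linear g) (tens_act_linearl w).
- exact: linear_comp (tens_act_linearl _) (gact_linear act g).
move=> u; rewrite /= /tensor_act malg_twistU (linZ (tens_act_linearl _)).
rewrite !tens_actU /word_act /word_char.
elim: (fmonom_val u) => [|i s IHs] /=; first by rewrite big_nil scale1r.
by rewrite big_cons E_D IHs (linZ (D_linear i)) scalerA.
Qed.

Definition skew_act (f : TG) (w : W) : W := \sum_g tens_act (f g) (E g w).

Lemma skew_act_linearl w : linear (skew_act^~ w).
Proof.
move=> a f h; rewrite /skew_act scaler_sumr -big_split /=.
by apply: eq_bigr => g _; rewrite !ffunE tens_act_linearl.
Qed.

Lemma skew_act_linear f : linear (skew_act f).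
Proof.
move=> a w w'; rewrite /skew_act scaler_sumr -big_split /=.
by apply: eq_bigr => g _; rewrite E_linear tens_act_linear.
Qed.

Lemma skew_act_el a g w : skew_act (skew_el act a g) w = tens_act a (E g w).
Proof.
rewrite /skew_act (bigD1 g) //= ffunE eqxx big1 ?addr0 // => h /negbTE hg.
by rewrite ffunE hg (lin0 (tens_act_linearl _)).
Qed.

Lemma skew_actM f h w : skew_act (f * h) w = skew_act f (skew_act h w).
Proof.
rewrite [f]skew_elE [h]skew_elE.
set F := BIG_F; rewrite big_distrl /=.
rewrite !(lin_sum (f := skew_act^~ _) _ xpredT _ (skew_act_linearl _)).
apply: eq_bigr => g _; rewrite big_distrr /=.
rewrite !(lin_sum (f := skew_act^~ _) _ xpredT _ (skew_act_linearl _)).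
rewrite (lin_sum (f := skew_act _) _ xpredT _ (skew_act_linear _)).
apply: eq_bigr => l _; rewrite skew_elM !skew_act_el tens_actM ED.
by rewrite tens_act_group.
Qed.

Lemma skew_act_var i w : skew_act (xvar chi i) w = D i w.
Proof. by rewrite skew_act_el E0 tens_act_var. Qed.

Lemma skew_act_kappa i j w : skew_act (kappa_el v chi kappa i j) w =
  \sum_g \sum_r kappa_coef v kappa i j r g *: D r (E g w).
Proof.
apply: eq_bigr => g _; rewrite ffunE.
rewrite (lin_sum (f := tens_act^~ _) _ xpredT _ (tens_act_linearl _)).
apply: eq_bigr => r _.
by rewrite (linZ (tens_act_linearl _)) tens_act_var.
Qed.

Lemma skew_act_rel z w : z \in ideal_submod (qdoa_rel v q kappa (chi := chi)) ->
  skew_act z w = 0.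
Proof.
have D0 (f h : TG) u : skew_act (f - h) u = skew_act f u - skew_act h u.
  exact: (linB (f := skew_act^~ u) f h (skew_act_linearl u)).
move=> /asboolP zI; elim: zI w => [{}z [i [j ->]] w|w|x y _ IHx _ IHy w
    |a x _ IHx w|a x _ IHx w].
- rewrite !D0 skew_act_kappa (skew_actM (xvar chi i) (xvar chi j)).
  rewrite (linZ (skew_act_linearl w) (q i j)).
  by rewrite (skew_actM (xvar chi j) (xvar chi i)) !skew_act_var D_rel subrr.
- exact: lin0 (skew_act_linearl w).
- by rewrite (linD (skew_act_linearl w)) IHx IHy addr0.
- by rewrite skew_actM IHx (lin0 (skew_act_linear a)).
- by rewrite skew_actM IHx.
Qed.

(** The universal property of the presentation. Words act by composing the [D i], and a g acts as a
    after [E g]. [E_D] makes this an action of the skew group algebra, and by [D_rel] the defining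
    ideal acts by zero, so that any representative of a class may be used. *)
Lemma qdoa_lift : exists rep : H -> W -> W,
  [/\ forall w, linear (rep^~ w), forall x, linear (rep x),
      forall x y w, rep (x * y) w = rep x (rep y w),
      forall i w, rep (qdoa_var v chi q kappa i) w = D i w
    & forall g w, rep (qdoa_in v chi q kappa (group_el K g)) w = E g w].
Proof.
pose rep (x : H) w := skew_act (repr x) w.
have repE f w : rep (api _ f) w = skew_act f w.
  apply/eqP; rewrite -subr_eq0.
  have /lpi_eq/(skew_act_rel w) <- := api_repr (api (qdoa_rel v q kappa) f).
  by rewrite /rep (linB (f := fun f => skew_act f w) _ f (skew_act_linearl w)).
exists rep; split.
- move=> w a x y; rewrite -[x]api_repr -[y]api_repr -[_ + _]linearP !repE.
  exact: skew_act_linearl.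
- by move=> x; exact: skew_act_linear.
- move=> x y w; rewrite -[x]api_repr -[y]api_repr -rmorphM !repE.
  exact: skew_actM.
- by move=> i w; rewrite repE skew_act_var.
move=> g w; rewrite /qdoa_in /aquot_in repE.
by rewrite [X in skew_act X _]group_alg_in_el skew_act_el tens_act1.
Qed.

End Module.
End Presentation.



(** * The bicharacter on Z^n x G *)

Section CommutationFactor.
Variables (K : fieldType) (G : finZmodType) (n : nat).
Variables (chi : 'I_n -> lin_char G K) (q : 'I_n -> 'I_n -> K).
Hypothesis q_system : quantum_system q.

Local Notation A := ('rV[int]_n * G)%type.

Let q_neq0 i j : q i j != 0. Proof. by case: q_system. Qed.

Lemma lchar_neq0 (c : lin_char G K) g : c g != 0.
Proof.
apply/eqP => c0; have := lchar0 c; rewrite -(subrr g) lcharD c0 mul0r.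
by move/esym/eqP; rewrite oner_eq0.
Qed.

Definition quantum_pairing (a b : A) : K :=
  \prod_i \prod_j q i j ^ (a.1 0 i * b.1 0 j).

Definition char_pairing (a b : A) : K := \prod_j chi j a.2 ^ b.1 0 j.

(** On generators its values are q_ij at (|v_i|,|v_j|), chi_j(g) at (|g|,|v_j|), chi_i(h)^-1 at
    (|v_i|,|h|) and 1 at (|g|,|h|); their product is the value prescribed at (|v_i||g|,|v_j||h|). *)
Definition free_bichar (a b : A) : K :=
  quantum_pairing a b * char_pairing a b / char_pairing b a.

Lemma quantum_pairing_antisym a b :
  quantum_pairing b a = (quantum_pairing a b)^-1.
Proof.
rewrite /quantum_pairing exchange_big -prodfV; apply: eq_bigr => i _.
rewrite -prodfV; apply: eq_bigr => j _ /=.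
have [_ _ ->] := q_system; rewrite mulrC.
by rewrite exprz_inv invr_expz.
Qed.

Lemma quantum_pairingDl a b c :
  quantum_pairing (a + b) c = quantum_pairing a c * quantum_pairing b c.
Proof.
rewrite /quantum_pairing -big_split; apply: eq_bigr => i _ /=.
rewrite -big_split; apply: eq_bigr => j _ /=.
by rewrite !mxE mulrDl expfzDr.
Qed.

Lemma quantum_pairing_neq0 a b : quantum_pairing a b != 0.
Proof.
by apply/prodf_neq0 => i _; apply/prodf_neq0 => j _; rewrite expfz_neq0.
Qed.

Lemma char_pairingDl a b c :
  char_pairing (a + b) c = char_pairing a c * char_pairing b c.
Proof.
rewrite -big_split; apply: eq_bigr => j _ /=.
by rewrite lcharD exprzMl ?unitfE ?lchar_neq0.
Qed.

Lemma char_pairingDr a b c :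
  char_pairing a (b + c) = char_pairing a b * char_pairing a c.
Proof.
rewrite -big_split; apply: eq_bigr => j _ /=.
by rewrite mxE expfzDr ?lchar_neq0.
Qed.

Lemma char_pairing_neq0 a b : char_pairing a b != 0.
Proof. by apply/prodf_neq0 => i _; rewrite expfz_neq0 ?lchar_neq0. Qed.

Lemma free_bichar_antisym : antisym_bichar free_bichar.
Proof.
have anti a b : free_bichar b a = (free_bichar a b)^-1.
  rewrite /free_bichar quantum_pairing_antisym !invfM invrK.
  by rewrite mulrAC.
have Dl a b c : free_bichar (a + b) c = free_bichar a c * free_bichar b c.
  rewrite /free_bichar quantum_pairingDl char_pairingDl char_pairingDr invfM.
  by rewrite [RHS]mulrACA; congr (_ * _); exact: mulrACA.
split=> // [a b|a b c].
  by rewrite !mulf_neq0 ?invr_neq0 ?quantum_pairing_neq0 ?char_pairing_neq0.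
by rewrite anti Dl invfM -!anti.
Qed.

Lemma free_bichar_var i (b : A) :
  free_bichar (var_deg G i) b = (\prod_j q i j ^ b.1 0 j) / chi i b.2.
Proof.
rewrite /free_bichar [char_pairing (var_deg G i) b]big1 => [|j _]; last first.
  by rewrite lchar0 exp1rz.
rewrite mulr1; congr (_ / _).
  rewrite /quantum_pairing (bigD1 i) //= [X in _ * X]big1 => [|k /negbTE ki].
    by rewrite mulr1; apply: eq_bigr => j _; rewrite mxE !eqxx mul1r.
  by rewrite big1 // => j _; rewrite mxE ki andbF mul0r expr0z.
rewrite /char_pairing (bigD1 i) //= big1 => [|k /negbTE ki].
  by rewrite mulr1 mxE !eqxx expr1z.
by rewrite mxE ki andbF expr0z.
Qed.

Lemma free_bichar_grp g (b : A) :
  free_bichar (grp_deg n g) b = \prod_j chi j g ^ b.1 0 j.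
Proof.
rewrite /free_bichar /quantum_pairing big1 => [|i _]; last first.
  by rewrite big1 // => j _; rewrite mxE mul0r expr0z.
rewrite mul1r [char_pairing b _]big1 ?divr1 // => j _.
by rewrite mxE expr0z.
Qed.

End CommutationFactor.



(** * Independence of PBW monomials and conjugation by group elements *)

Lemma lbasis_free (K : fieldType) (W : lmodType K) (J : choiceType)
    (e : J -> W) (m : {malg K[J]}) :
  is_lbasis e -> malg_lift e m = 0 -> m = 0.
Proof.
move=> /(_ 0) [c [_ uc]] m0.
rewrite -(uc m) // -(uc 0) //.
exact: esym (lin0 (malg_lift_linear e)).
Qed.

Lemma lbasis_indep (K : fieldType) (W : lmodType K) (J : choiceType)
    (e : J -> W) (I : finType) (k : I -> J) (a : I -> K) :
  is_lbasis e -> injective k -> \sum_i a i *: e (k i) = 0 -> forall i, a i = 0.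
Proof.
move=> eb kinj a0 i.
pose m : {malg K[J]} := \sum_i a i *: << k i >>.
have m0 : m = 0.
  apply: (lbasis_free eb); rewrite -[RHS]a0.
  rewrite (lin_sum (f := malg_lift e) _ xpredT _ (malg_lift_linear e)).
  by apply: eq_bigr => j _; rewrite (linZ (malg_lift_linear e)) malg_liftU.
have := congr1 (mcoeff (k i)) m0; rewrite mcoeff0 => <-.
have mlin : linear (mcoeff (k i) : {malg K[J]} -> K^o).
  by move=> b x y; rewrite mcoeffD mcoeffZ.
rewrite (lin_sum (f := mcoeff (k i) : _ -> K^o) _ xpredT _ mlin) (bigD1 i) //=.
rewrite mcoeffZ mcoeffUU mulr1 big1 ?addr0 // => j /negbTE ji.
by rewrite mcoeffZ mcoeffU (inj_eq kinj) ji mulr0.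
Qed.

Section ConjugatedRelation.
Variables (K : fieldType) (A : lmodType K) (one : A) (mul : A -> A -> A).
Hypotheses (mul_linearl : forall y, linear (mul^~ y))
  (mul_linearr : forall x, linear (mul x)) (mul_assoc : associative mul)
  (mul_oner : right_id one mul).
Variables (G : finZmodType) (I : finType) (e : G -> A) (x : I -> A).
Variables (chi : I -> lin_char G K) (c : I -> G -> K) (i j : I) (a : K).
Hypotheses (e0 : e 0 = one) (eM : forall g h, mul (e g) (e h) = e (g + h))
  (e_x : forall g r, mul (e g) (x r) = chi r g *: mul (x r) (e g))
  (x_rel : mul (x i) (x j) - a *: mul (x j) (x i) =
     \sum_g \sum_r c r g *: mul (x r) (e g)).

Lemma relation_mul y :
  mul (x i) (mul (x j) y) - a *: mul (x j) (mul (x i) y) =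
  \sum_g \sum_r c r g *: mul (x r) (mul (e g) y).
Proof.
have ZL b z : mul (b *: z) y = b *: mul z y by exact: (linZ (mul_linearl y)).
rewrite !mul_assoc -ZL -(linB (f := mul^~ y) _ _ (mul_linearl y)) x_rel.
rewrite (lin_sum (f := mul^~ y) _ xpredT _ (mul_linearl y)).
apply: eq_bigr => g _.
rewrite (lin_sum (f := mul^~ y) _ xpredT _ (mul_linearl y)).
by apply: eq_bigr => r _; rewrite ZL mul_assoc.
Qed.

Lemma color_comm_mul u y z a1 a2 :
  mul u y = a1 *: mul y u -> mul u z = a2 *: mul z u ->
  mul u (mul y z) = (a1 * a2) *: mul (mul y z) u.
Proof.
move=> uy uz; rewrite mul_assoc uy (linZ (mul_linearl z)) -mul_assoc uz.
by rewrite (linZ (mul_linearr y)) scalerA mul_assoc.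
Qed.

Lemma color_comm_lin u b y z a1 :
  mul u y = a1 *: mul y u -> mul u z = a1 *: mul z u ->
  mul u (b *: y + z) = a1 *: mul (b *: y + z) u.
Proof.
move=> uy uz; rewrite (linD (mul_linearr u)) (linZ (mul_linearr u)) uy uz.
rewrite (linD (mul_linearl u)) (linZ (mul_linearl u)) scalerDr !scalerA.
by rewrite [b * _]mulrC.
Qed.

Lemma relation_grp_sum : \sum_g \sum_r c r g *: mul (x r) (e g) =
  \sum_r mul (x r) (\sum_g c r g *: e g).
Proof.
rewrite exchange_big; apply: eq_bigr => r _.
rewrite (lin_sum _ xpredT _ (mul_linearr (x r))); apply: eq_bigr => g _.
by rewrite (linZ (mul_linearr (x r))).
Qed.

Lemma grp_mul g h y : mul (e (g + h)) y = mul (e g) (mul (e h) y).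
Proof. by rewrite mul_assoc eM. Qed.

Lemma grp_var_mul g r y :
  mul (e g) (mul (x r) y) = chi r g *: mul (x r) (mul (e g) y).
Proof. by rewrite mul_assoc e_x (linZ (mul_linearl y)) -mul_assoc. Qed.

(** Let S be the common value of the two sides of the relation. Moving [e h] past the left side
    gives the factor chi_i(h) chi_j(h), and moving it past the term x_r e_g of the right side gives
    chi_r(h), as G is abelian. Cancelling the invertible [e h] leaves the difference. *)
Lemma conjugated_relation h :
  \sum_g \sum_r (c r g * (chi r h - chi i h * chi j h)) *: mul (x r) (e g) = 0.
Proof.
have ZL b y z : mul (b *: y) z = b *: mul y z.
  exact: (linZ (mul_linearl z)).
have ZR b y z : mul y (b *: z) = b *: mul y z.
  exact: (linZ (mul_linearr y)).
have e_xx r s : mul (e h) (mul (x r) (x s)) =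
    (chi r h * chi s h) *: mul (mul (x r) (x s)) (e h).
  by rewrite mul_assoc e_x ZL -mul_assoc e_x ZR scalerA mul_assoc.
pose S := \sum_g \sum_r c r g *: mul (x r) (e g).
have eS1 : mul (e h) S = (chi i h * chi j h) *: mul S (e h).
  rewrite /S -x_rel (linB _ _ (mul_linearr (e h))) ZR !e_xx.
  rewrite (linB (f := mul^~ (e h)) _ _ (mul_linearl (e h))) ZL scalerBr.
  rewrite !scalerA.
  by rewrite [a * _]mulrC [chi j h * _]mulrC.
have eS2 : mul (e h) S =
    mul (\sum_g \sum_r (c r g * chi r h) *: mul (x r) (e g)) (e h).
  rewrite /S (lin_sum _ xpredT _ (mul_linearr (e h))).
  rewrite (lin_sum (f := mul^~ (e h)) _ xpredT _ (mul_linearl (e h))).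
  apply: eq_bigr => g _; rewrite (lin_sum _ xpredT _ (mul_linearr (e h))).
  rewrite (lin_sum (f := mul^~ (e h)) _ xpredT _ (mul_linearl (e h))).
  apply: eq_bigr => r _; rewrite ZR mul_assoc e_x !ZL scalerA -!mul_assoc.
  by rewrite !eM addrC.
have cancel_e y z : mul y (e h) = mul z (e h) -> y = z.
  move=> yz; rewrite -[y]mul_oner -[z]mul_oner -e0 -(subrr h) -eM.
  by rewrite !mul_assoc yz.
rewrite eS1 -ZL in eS2; have {}eS2 := cancel_e _ _ eS2.
transitivity (\sum_g \sum_r (c r g * chi r h) *: mul (x r) (e g) -
    (chi i h * chi j h) *: S); last by rewrite eS2 subrr.
rewrite scaler_sumr -sumrB; apply: eq_bigr => g _.
rewrite scaler_sumr -sumrB; apply: eq_bigr => r _.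
by rewrite scalerA -scalerBl [_ * c _ _]mulrC -mulrBr.
Qed.

End ConjugatedRelation.

Section QuantumOrbifold.
Variables (K : fieldType) (G : finZmodType) (V : vectType K) (n : nat).
Variables (v : n.-tuple V) (chi : 'I_n -> lin_char G K).
Variables (q : 'I_n -> 'I_n -> K) (kappa : V -> V -> {ffun G -> V}).

Local Notation act := (diag_action chi).
Local Notation TG := (Defs.skew act).
Local Notation H := (qdoa v chi q kappa).
Local Notation X := (qdoa_var v chi q kappa).
Local Notation In := (qdoa_in v chi q kappa).
Local Notation Ing g := (In (@group_el K G g)).
Local Notation c_ := (kappa_coef v kappa).

Lemma group_alg_sum (f : group_alg K G) : f = \sum_g f g *: group_el K g.
Proof.
apply/ffunP=> g; rewrite sum_ffunE (bigD1 g) //= big1 ?addr0.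
  by rewrite !ffunE eqxx [RHS]mulr1.
by move=> h /negbTE hg; rewrite !ffunE eq_sym hg [LHS]mulr0.
Qed.

Lemma group_elM (g h : G) : group_el K g * group_el K h = group_el K (g + h).
Proof. by rewrite [LHS]skew_elM /= mulr1. Qed.

Lemma qdoa_in_linear : linear In.
Proof. exact: aquot_inP. Qed.

Lemma qdoa_in_el g : Ing g = api (qdoa_rel v q kappa) (skew_el act 1 g).
Proof. by rewrite /qdoa_in /aquot_in; congr api; exact: group_alg_in_el. Qed.

Lemma qdoa_scalerAl a (x y : H) : a *: x * y = a *: (x * y).
Proof. exact: esym (aquot_scalerAl a x y). Qed.

Lemma qdoa_scalerAr a (x y : H) : x * (a *: y) = a *: (x * y).
Proof. exact: esym (aquot_scalerAr a x y). Qed.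

Lemma qdoa_grpM g h : Ing g * Ing h = Ing (g + h).
Proof. by rewrite -group_elM /qdoa_in aquot_inM. Qed.

Lemma qdoa_grp0 : Ing 0 = 1.
Proof. exact: aquot_in1. Qed.

Lemma qdoa_grp_var g i : Ing g * X i = chi i g *: (X i * Ing g).
Proof.
rewrite !qdoa_in_el /qdoa_var -!rmorphM -[RHS]linearZ; congr api.
rewrite /xvar !skew_elM diag_action_var mul1r gact0 mulr1 add0r addr0.
exact: (linZ (skew_el_linear act g)).
Qed.

Lemma qdoa_relE i j : X i * X j - q i j *: (X j * X i) =
  \sum_g \sum_r c_ i j r g *: (X r * Ing g).
Proof.
pose I0 := ideal_submod (qdoa_rel v q kappa (chi := chi)).
have -> : \sum_g \sum_r c_ i j r g *: (X r * Ing g) =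
    api (qdoa_rel v q kappa) (kappa_el v chi kappa i j).
  rewrite [kappa_el _ _ _ _ _]skew_elE linear_sum; apply: eq_bigr => g _.
  rewrite ffunE.
  rewrite (lin_sum (f := fun a => skew_el act a g) _ xpredT _
    (skew_el_linear act g)).
  rewrite linear_sum; apply: eq_bigr => r _.
  rewrite (linZ (skew_el_linear act g)) linearZ; congr (_ *: _).
  rewrite qdoa_in_el /qdoa_var -rmorphM; congr api.
  by rewrite /xvar skew_elM gact0 mulr1 add0r.
rewrite /qdoa_var -!rmorphM -linearZ -linearB.
apply/lpi_eq/asboolP; apply: ideal_gen; by exists i, j.
Qed.

Lemma pbw_monomial_var r g :
  qdoa_pbw_monomial v chi q kappa ([ffun i => nat_of_bool (i == r)], g) =
  X r * Ing g.
Proof.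
rewrite /qdoa_pbw_monomial /=; congr (_ * _).
under eq_bigr => i _ do rewrite ffunE.
have -> : \prod_(i < n) X i ^+ (i == r) = \prod_(i < n | i == r) X i.
  by rewrite [RHS]big_mkcond; apply: eq_bigr => i _; case: (i == r).
exact: big_pred1_eq.
Qed.

Hypothesis pbw : pbw_property v chi q kappa.

Lemma pbw_coef (a : 'I_n -> G -> K) :
  \sum_g \sum_r a r g *: (X r * Ing g) = 0 -> forall r g, a r g = 0.
Proof.
move=> a0 r g; pose k (p : G * 'I_n) : {ffun 'I_n -> nat} * G :=
  ([ffun i => nat_of_bool (i == p.2)], p.1).
have kinj : injective k.
  move=> [h s] [h' s'] [/ffunP /(_ s)]; rewrite !ffunE eqxx /=.
  by case: eqP => // -> _ ->.
apply: (lbasis_indep (a := fun p : G * 'I_n => a p.2 p.1) pbw kinj _ (g, r)).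
rewrite -[RHS]a0 pair_big; apply: eq_bigr => -[h s] _ /=.
by rewrite -pbw_monomial_var.
Qed.

(** A separate name for the product, so that it can be made opaque where unfolding the quotient is
    unwanted. *)
Definition qdoa_mul (x y : H) : H := x * y.

Lemma qdoa_mul_linearl y : linear (qdoa_mul^~ y).
Proof. by move=> a x z; rewrite /qdoa_mul mulrDl qdoa_scalerAl. Qed.

Lemma qdoa_mul_linearr x : linear (qdoa_mul x).
Proof. by move=> a y z; rewrite /qdoa_mul mulrDr qdoa_scalerAr. Qed.

Lemma qdoa_mulA : associative qdoa_mul.
Proof. exact: mulrA. Qed.

Lemma qdoa_rel_mul i j (y : H) :
  qdoa_mul (X i) (qdoa_mul (X j) y)
    - q i j *: (qdoa_mul (X j) (qdoa_mul (X i) y)) =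
  \sum_g \sum_r c_ i j r g *: (qdoa_mul (X r) (qdoa_mul (Ing g) y)).
Proof.
exact: (relation_mul qdoa_mul_linearl qdoa_mulA (qdoa_relE i j)).
Qed.

Lemma qdoa_mul1 y : qdoa_mul 1 y = y.
Proof. exact: mul1r. Qed.

Lemma qdoa_grp_mul g h y :
  qdoa_mul (Ing (g + h)) y = qdoa_mul (Ing g) (qdoa_mul (Ing h) y).
Proof. exact: (grp_mul qdoa_mulA qdoa_grpM). Qed.

Lemma qdoa_grp_var_mul g i y : qdoa_mul (Ing g) (qdoa_mul (X i) y) =
  chi i g *: qdoa_mul (X i) (qdoa_mul (Ing g) y).
Proof. exact: (grp_var_mul qdoa_mul_linearl qdoa_mulA qdoa_grp_var). Qed.

Lemma qdoa_color_comm_mul u y z a1 a2 :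
  qdoa_mul u y = a1 *: qdoa_mul y u -> qdoa_mul u z = a2 *: qdoa_mul z u ->
  qdoa_mul u (qdoa_mul y z) = (a1 * a2) *: qdoa_mul (qdoa_mul y z) u.
Proof. exact: (color_comm_mul qdoa_mul_linearl qdoa_mul_linearr qdoa_mulA). Qed.

Lemma qdoa_color_comm_lin u b y z a1 :
  qdoa_mul u y = a1 *: qdoa_mul y u -> qdoa_mul u z = a1 *: qdoa_mul z u ->
  qdoa_mul u (b *: y + z) = a1 *: qdoa_mul (b *: y + z) u.
Proof. exact: (color_comm_lin qdoa_mul_linearl qdoa_mul_linearr). Qed.

Lemma qdoa_rel_in i j :
  qdoa_mul (X i) (X j) - q i j *: qdoa_mul (X j) (X i) =
  \sum_r qdoa_mul (X r) (In [ffun g => c_ i j r g]).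
Proof.
apply: (etrans (qdoa_relE i j)).
apply: (etrans (relation_grp_sum qdoa_mul_linearr (fun g => Ing g) X
  (c_ i j))).
apply: eq_bigr => r _; congr qdoa_mul.
rewrite [[ffun _ => _]](group_alg_sum _) (lin_sum _ xpredT _ qdoa_in_linear).
by apply: eq_bigr => g _; rewrite ffunE (linZ qdoa_in_linear).
Qed.

Lemma kappa_char i j r g : c_ i j r g != 0 ->
  forall h, chi r h = chi i h * chi j h.
Proof.
move=> crg h; pose a r g := c_ i j r g * (chi r h - chi i h * chi j h).
suff /(_ r g) /eqP : forall r g, a r g = 0.
  by rewrite mulf_eq0 (negPf crg) subr_eq0 => /eqP.
apply: pbw_coef.
exact: (conjugated_relation qdoa_mul_linearl qdoa_mul_linearr qdoa_mulA
  (@mulr1 H) qdoa_grp0 qdoa_grpM qdoa_grp_var (qdoa_relE i j)).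
Qed.

End QuantumOrbifold.



(** * Induction on the generators *)

Lemma prod_exp_ind (A : pzRingType) (P : A -> Prop) (I : Type) (s : seq I)
    (x : I -> A) (m : I -> nat) (y : A) :
  (forall i z, P z -> P (x i * z)) -> P y -> P (\prod_(i <- s) x i ^+ m i * y).
Proof.
move=> Px Py; elim: s => [|i s IHs]; first by rewrite big_nil mul1r.
rewrite big_cons -mulrA; elim: (m i) => [|k IHk]; first by rewrite mul1r.
by rewrite exprS -mulrA; exact: Px.
Qed.

Section Generation.
Variables (K : fieldType) (G : finZmodType) (V : vectType K) (n : nat).
Variables (v : n.-tuple V) (chi : 'I_n -> lin_char G K).
Variables (q : 'I_n -> 'I_n -> K) (kappa : V -> V -> {ffun G -> V}).
Hypothesis pbw : pbw_property v chi q kappa.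

Local Notation H := (qdoa v chi q kappa).
Local Notation X := (qdoa_var v chi q kappa).
Local Notation In := (qdoa_in v chi q kappa).

(** The PBW monomials span H, and each arises from 1 by left multiplication by a group element and
    then by variables. *)
Lemma qdoa_gen_ind (P : H -> Prop) : P 1 ->
  (forall a x y, P x -> P y -> P (a *: x + y)) ->
  (forall r x, P x -> P (qdoa_mul (In r) x)) ->
  (forall i x, P x -> P (qdoa_mul (X i) x)) -> forall x, P x.
Proof.
move=> P1 PP Pl Pv x.
have P0 : P 0 by have := PP (-1) _ _ P1 P1; rewrite scaleN1r addNr.
have Pk k : P (qdoa_pbw_monomial v chi q kappa k).
  apply: prod_exp_ind; first exact: Pv.
  by rewrite -[In _]mulr1; exact: Pl.
have [c [-> _]] := pbw x.
apply: big_ind => // [y z Py Pz|k _]; last first.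
  by rewrite -[_ *: _]addr0; exact: PP.
by rewrite -[y]scale1r; exact: PP.
Qed.

End Generation.

(** * Descent of the bicharacter to A/N *)

Section QuotientBicharacter.
Variables (K : fieldType) (G : finZmodType) (V : vectType K) (n : nat).
Variables (v : n.-tuple V) (chi : 'I_n -> lin_char G K).
Variables (q : 'I_n -> 'I_n -> K) (kappa : V -> V -> {ffun G -> V}).
Hypothesis q_system : quantum_system q.
Hypothesis kappa_chi : forall i j r g, kappa_coef v kappa i j r g != 0 ->
  forall h, chi r h = chi i h * chi j h.
Hypothesis kappa_q : forall i j r g, kappa_coef v kappa i j r g != 0 ->
  forall k, chi k g = q i k * q j k * q k r.

Local Notation A := ('rV[int]_n * G)%type.
Local Notation B := (qdeg v kappa).
Local Notation cls := (qcls v kappa).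
Local Notation eps0 := (free_bichar chi q).

Let eps0_bichar := free_bichar_antisym chi q_system.

Lemma qclsD a b : cls (a + b) = cls a + cls b.
Proof.
exact: (raddfD \pi_(Quotient.quot (zspan_zmod (@rel_deg K G V n v kappa)))).
Qed.

Lemma qclsB a b : cls (a - b) = cls a - cls b.
Proof.
exact: (raddfB \pi_(Quotient.quot (zspan_zmod (@rel_deg K G V n v kappa)))).
Qed.

Lemma grp_degD (g h : G) : grp_deg n (g + h) = grp_deg n g + grp_deg n h.
Proof. by congr pair; rewrite addr0. Qed.

Lemma qcls0 : cls 0 = 0.
Proof. by rewrite -[X in cls X](subrr 0) qclsB subrr. Qed.

Lemma qcls_eq a b : cls a = cls b <-> zspan (@rel_deg K G V n v kappa) (a - b).
Proof.
have := Quotient.idealrBE (zspan_zmod (@rel_deg K G V n v kappa)) a b.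
rewrite -[cls a]/(\pi_B a) -[cls b]/(\pi_B b) => e; split.
  by move=> /eqP; rewrite -e => /asboolP.
by move=> /asboolP ab; apply/eqP; rewrite -e.
Qed.

Lemma qcls_repr (a : B) : cls (repr a) = a.
Proof. exact: reprK. Qed.

Lemma free_bicharB a b c : eps0 (a - b) c = eps0 a c / eps0 b c.
Proof.
by rewrite -[in RHS](subrK b a) (bicharDl eps0_bichar) mulfK // bichar_neq0.
Qed.

(** Pair a generator of N with b = (m,h). The Z^n part of b contributes the product over k of (q_ik
    q_jk q_kr / chi_k(g))^{m_k}, which is 1 by strong vanishing. The G part contributes chi_r(h) /
    (chi_i(h) chi_j(h)), which is 1 by [kappa_chi]. *)
Lemma free_bichar_rel a b : zspan (@rel_deg K G V n v kappa) a -> eps0 a b = 1.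
Proof.
elim=> [{}a [i [j [r [g [c0 ->]]]]]||x y _ IHx _ IHy]; last 2 first.
- exact: bichar0l eps0_bichar _.
- by rewrite free_bicharB IHx IHy divr1.
rewrite !free_bicharB (bicharDl eps0_bichar) !free_bichar_var free_bichar_grp.
have [q0 _ qV] := q_system.
pose P s := \prod_k q s k ^ b.1 0 k.
have -> : \prod_k chi k g ^ b.1 0 k = P i * P j / P r.
  rewrite /P -prodfV -!big_split; apply: eq_bigr => k _ /=.
  rewrite (kappa_q c0) (qV r k) !exprzMl ?unitfE ?mulf_neq0 ?invr_eq0 //.
  by rewrite exprz_inv invr_expz.
have P0 s : P s != 0 by apply/prodf_neq0 => k _; rewrite expfz_neq0.
rewrite -!/(P _) (kappa_chi c0).
have [ci0 cj0] := (lchar_neq0 (chi i) b.2, lchar_neq0 (chi j) b.2).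
move: (P0 i) (P0 j) (P0 r) => Pi0 Pj0 Pr0.
by field; rewrite Pi0 Pj0 Pr0 ci0 cj0.
Qed.

Definition quotient_bichar (a b : B) : K := eps0 (repr a) (repr b).

Lemma quotient_bicharE a b : quotient_bichar (cls a) (cls b) = eps0 a b.
Proof.
have e0l x y c : cls x = cls y -> eps0 x c = eps0 y c.
  move/qcls_eq/(free_bichar_rel c); rewrite free_bicharB => /divr1_eq.
  done.
have e0r x y c : cls x = cls y -> eps0 c x = eps0 c y.
  have [_ _ _ anti] := eps0_bichar.
  by move=> xy; rewrite (anti x c) (anti y c) (e0l _ _ c xy).
rewrite /quotient_bichar (e0l _ a) ?qcls_repr //.
by rewrite (e0r _ b) ?qcls_repr.
Qed.

Lemma quotient_bichar_antisym : antisym_bichar quotient_bichar.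
Proof.
have [nz Dl Dr anti] := eps0_bichar.
split=> [a b|a b c|a b c|a b]; first exact: nz.
- rewrite -[a]qcls_repr -[b]qcls_repr -[c]qcls_repr -qclsD !quotient_bicharE.
  exact: Dl.
- rewrite -[a]qcls_repr -[b]qcls_repr -[c]qcls_repr -qclsD !quotient_bicharE.
  exact: Dr.
- exact: anti.
Qed.

Lemma quotient_bichar_var_grp i g :
  quotient_bichar (cls (var_deg G i)) (cls (grp_deg n g)) = (chi i g)^-1.
Proof.
rewrite quotient_bicharE free_bichar_var // big1 ?mul1r // => j _.
by rewrite mxE expr0z.
Qed.

Lemma quotient_bichar_var i j :
  quotient_bichar (cls (var_deg G i)) (cls (var_deg G j)) = q i j.
Proof.
rewrite quotient_bicharE free_bichar_var // lchar0 divr1.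
rewrite (bigD1 j) //= big1 ?mulr1 => [|k /negbTE kj].
  by rewrite mxE !eqxx expr1z.
by rewrite mxE kj andbF expr0z.
Qed.

Lemma quotient_bichar_grp g h :
  quotient_bichar (cls (grp_deg n g)) (cls (grp_deg n h)) = 1.
Proof.
rewrite quotient_bicharE free_bichar_grp big1 // => j _.
by rewrite mxE expr0z.
Qed.

Lemma quotient_bichar_factor : commutation_factor chi q quotient_bichar.
Proof.
split=> [|g h i j]; first exact: quotient_bichar_antisym.
have eb := quotient_bichar_antisym.
have [_ _ _ anti] := eb.
rewrite !qclsD (bicharDl eb) !(bicharDr eb) quotient_bichar_var.
rewrite quotient_bichar_var_grp quotient_bichar_grp mulr1 mulrAC.
congr (_ * _ * _).
by rewrite anti quotient_bichar_var_grp invrK.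
Qed.

Lemma kappa_deg i j r g : kappa_coef v kappa i j r g != 0 ->
  cls (grp_deg n g) =
  cls (var_deg G i) + cls (var_deg G j) - cls (var_deg G r).
Proof.
move=> c0; rewrite -qclsD -qclsB; apply/esym/qcls_eq/zspan_gen.
by exists i, j, r, g.
Qed.

End QuotientBicharacter.



(** * The A/N-grading of H *)

Lemma scale_eq (K : fieldType) (W : lmodType K) (a : K) (x y : W) :
  (a != 0 -> x = y) -> a *: x = a *: y.
Proof. by have [->|_ ->] := eqVneq a 0; rewrite ?scale0r. Qed.

Lemma grading_of_projections (K : fieldType) (W : lmodType K) (B : zmodType)
    (dg : B -> W -> Prop) (comp : B -> W -> W) :
  (forall b, dg b 0) ->
  (forall b a x y, dg b x -> dg b y -> dg b (a *: x + y)) ->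
  (forall b, linear (comp b)) ->
  (forall a x, dg a x -> forall b, comp b x = if b == a then x else 0) ->
  (forall x, lspan (fun y => exists b, dg b y) x) ->
  (forall x, exists (s : seq B) (f : B -> W),
    (forall b, dg b (f b)) /\ x = \sum_(b <- s) f b) /\
  (forall (s : seq B) (f : B -> W), uniq s -> (forall b, dg b (f b)) ->
    \sum_(b <- s) f b = 0 -> forall b, b \in s -> f b = 0).
Proof.
move=> dg0 dgP lc cE sp; split=> [x|s f us df s0 b bs]; last first.
  rewrite -[RHS](lin0 (lc b)) -s0 (lin_sum _ xpredT _ (lc b)).
  rewrite (bigD1_seq b) //= (cE _ _ (df b)) eqxx big1 ?addr0 // => c /negbTE cb.
  by rewrite (cE _ _ (df c)) eq_sym cb.
(* Any duplicate-free list containing s is allowed, so that in the inductive step the decompositions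
   of x and y can be written over one common list of degrees. *)
suff [dx [s xs]] : (forall b, dg b (comp b x)) /\ exists s : seq B,
    forall t, uniq t -> {subset s <= t} -> x = \sum_(b <- t) comp b x.
  exists (undup s), (comp^~ x); split=> //; apply: xs (undup_uniq _) _ => b.
  by rewrite mem_undup.
elim: (sp x) => {x} [x [a ax]||a x y _ [dx [s xs]] _ [dy [t yt]]].
- split=> [b|]; first by rewrite (cE _ _ ax); case: eqP => [->|].
  exists [:: a] => t ut at_.
  have {}at_ : a \in t by rewrite at_ ?inE.
  rewrite (bigD1_seq a) //= (cE _ _ ax) eqxx big1 ?addr0 // => b /negbTE ba.
  by rewrite (cE _ _ ax) ba.
- split=> [b|]; first by rewrite (lin0 (lc b)).
  by exists [::] => t _ _; rewrite big1 // => b _; rewrite (lin0 (lc b)).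
- split=> [b|]; first by rewrite lc; exact: dgP.
  exists (s ++ t) => u uu stu.
  rewrite (eq_bigr _ (fun b _ => lc b a x y)) big_split -scaler_sumr /=.
  rewrite -(xs u) // -?(yt u) // => b bs; apply: stu.
    by rewrite mem_cat bs orbT.
  by rewrite mem_cat bs.
Qed.

Lemma lspan_sum (K : fieldType) (W : lmodType K) (S : W -> Prop) (I : Type)
    (s : seq I) (a : I -> K) (x : I -> W) :
  (forall i, lspan S (a i *: x i)) -> lspan S (\sum_(i <- s) a i *: x i).
Proof.
move=> Sx; apply: big_ind => //; first exact: lspan0.
by move=> y z Sy Sz; rewrite -[y]scale1r; exact: lspanP.
Qed.

Lemma lspan_scale (K : fieldType) (W : lmodType K) (S : W -> Prop) (a : K)
    (x : W) :
  (a != 0 -> S x) -> lspan S (a *: x).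
Proof.
have [->|a0 Sx] := eqVneq a 0; first by rewrite scale0r => _; exact: lspan0.
by rewrite -[_ *: _]addr0; apply: lspanP (lspan0 _); exact/lspan_gen/Sx.
Qed.

Section OrbifoldGrading.
Variables (K : fieldType) (G : finZmodType) (V : vectType K) (n : nat).
Variables (v : n.-tuple V) (chi : 'I_n -> lin_char G K).
Variables (q : 'I_n -> 'I_n -> K) (kappa : V -> V -> {ffun G -> V}).
Hypothesis pbw : pbw_property v chi q kappa.

Local Notation H := (qdoa v chi q kappa).
Local Notation X := (qdoa_var v chi q kappa).
Local Notation In := (qdoa_in v chi q kappa).
Local Notation Ing g := (In (@group_el K G g)).
Local Notation c_ := (kappa_coef v kappa).
Local Notation B := (qdeg v kappa).
Local Notation cls := (qcls v kappa).
Local Notation dvar i := (cls (var_deg G i)).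
Local Notation dgrp g := (cls (grp_deg n g)).
Local Notation "x ** y" := (qdoa_mul x y) (at level 40, left associativity).

Local Opaque qdoa_mul qdoa_var qdoa_in.

Definition shift (x : H) (b : B) (f : B -> H) : B -> H :=
  fun c => x ** f (c - b).

Lemma shift_linear x b : linear (shift x b).
Proof.
move=> a f h; apply/funext => c.
exact: (qdoa_mul_linearr x a (f (c - b)) (h (c - b))).
Qed.

(* H acts on functions from degrees to H, an element of degree b shifting
   degrees by b: this shows that the grading is well defined. *)
Lemma qdoa_shift : exists rep : H -> (B -> H) -> (B -> H),
  (forall f, linear (rep^~ f)) /\
  (forall b x, qdoa_deg b x -> forall f c, rep x f c = x ** f (c - b)).
Proof.
have sE x b f c : shift x b f c = x ** f (c - b) by [].
(* Here the quotient by N matters: when the coefficient is nonzero, |v_r| + |g| and |v_i| + |v_j|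
   agree in A/N, so both sides of the relation shift degrees equally. *)
have dcls i j r g : c_ i j r g != 0 ->
    forall c, c - dvar r - dgrp g = c - dvar i - dvar j.
  by move=> c0 c; rewrite (kappa_deg c0) opprB addrA subrK opprD addrA.
have [||||||rep [rl rr rM rX rI]] := @qdoa_lift K G V n v chi q kappa (B -> H)
    (fun i => shift (X i) (dvar i)) (fun g => shift (Ing g) (dgrp g)).
- by move=> i; exact: shift_linear.
- by move=> g; exact: shift_linear.
- move=> f; apply/funext => c; rewrite sE qdoa_grp0 qdoa_mul1.
  by rewrite -[grp_deg _ _]/(0 : 'rV_n * G) qcls0 subr0.
- move=> g h f; apply/funext => c.
  rewrite -[RHS]/(Ing g ** (Ing h ** f (c - dgrp g - dgrp h))).
  rewrite -[LHS]/(Ing (g + h) ** f (c - dgrp (g + h))).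
  have -> : dgrp (g + h) = dgrp g + dgrp h.
    by rewrite -qclsD -grp_degD.
  by rewrite opprD addrA; exact: qdoa_grp_mul.
- move=> g i f; apply/funext => c.
  rewrite -[RHS]/(chi i g *: (X i ** (Ing g ** f (c - dvar i - dgrp g)))).
  by rewrite !sE qdoa_grp_var_mul addrAC.
- move=> i j f; apply/funext => c.
  transitivity (\sum_g \sum_r c_ i j r g *:
     (X r ** (Ing g ** f (c - dvar i - dvar j)))).
    rewrite -qdoa_rel_mul -[LHS]/(X i ** (X j ** f (c - dvar i - dvar j))
      - q i j *: (X j ** (X i ** f (c - dvar j - dvar i)))).
    by rewrite [c - dvar j - dvar i]addrAC.
  rewrite fct_sumE; apply: eq_bigr => g _; rewrite fct_sumE.
  apply: eq_bigr => r _; rewrite -[RHS]/(c_ i j r g *: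
    (X r ** (Ing g ** f (c - dvar r - dgrp g)))).
  by apply: scale_eq => c0; rewrite (dcls _ _ _ _ c0).
exists rep; split=> // b x; elim=> {b x}.
- move=> b f c; rewrite (lin0 (rl f)).
  by rewrite (lin0 (qdoa_mul_linearl _)).
- move=> b a x y _ IHx _ IHy f c; rewrite (rl f) addrfctE scalrfctE /= IHx IHy.
  by rewrite qdoa_mul_linearl.
- move=> a b x y _ IHx _ IHy f c; rewrite rM IHx IHy.
  by rewrite [LHS]qdoa_mulA opprD addrA.
- by move=> i f c; rewrite rX.
- by move=> g f c; rewrite rI.
Qed.


(** Since [qdoa_deg] is generated inductively, independence of its degrees is not evident. Let H act
    by shifts on the function [w0], the unit placed in degree 0: an element x of degree a sends it
    to x placed in degree a, and evaluation at b reads off the component. *)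
Lemma qdoa_components : exists comp : B -> H -> H,
  (forall b, linear (comp b)) /\
  forall a (x : H), qdoa_deg a x ->
    forall b, comp b x = if b == a then x else 0.
Proof.
have [rep [rl rE]] := qdoa_shift.
pose w0 (c : B) : H := if c == 0 then 1 else 0.
exists (fun b x => rep x w0 b); split=> [b a x y|a x ax b].
  exact: (congr1 (fun f => f b) (rl w0 a x y)).
rewrite (rE _ _ ax) /w0 subr_eq0; case: eqP => _; first exact: mulr1.
exact: lin0 (qdoa_mul_linearr x).
Qed.

Lemma qdoa_in_deg b r : group_deg b r -> qdoa_deg b (In r).
Proof.
elim=> [_ [g [<- ->]]||a x y _ dx _ dy]; first exact: qdoa_deg_grp.
- by rewrite (lin0 (@qdoa_in_linear K G V n v chi q kappa)); exact: qdoa_deg0.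
- by rewrite qdoa_in_linear; exact: qdoa_degP.
Qed.

Lemma qdoa_deg1 : qdoa_deg 0 (1 : H).
Proof.
have := qdoa_deg_grp v chi q kappa 0.
by rewrite qdoa_grp0 -[grp_deg n _]/(0 : 'rV_n * G) qcls0.
Qed.

Lemma qdoa_deg_span (x : H) : lspan (fun y => exists b, qdoa_deg b y) x.
Proof.
move: x; apply: (qdoa_gen_ind pbw).
- by apply: lspan_gen; exists 0; exact: qdoa_deg1.
- by move=> a x y; exact: lspanP.
- move=> r x; apply: (lspan_linear (qdoa_mul_linearr _)) => y [b yb].
  apply: (lspan_linear (qdoa_mul_linearl y)
    (S := fun z => exists b, qdoa_deg b z)).
    by move=> z [a za]; apply: lspan_gen; exists (a + b); exact: qdoa_degM.
  rewrite (group_alg_sum r).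
  rewrite (lin_sum _ xpredT _ (@qdoa_in_linear K G V n v chi q kappa)).
  apply: big_ind => [||g _]; first exact: lspan0.
    by move=> y1 y2 S1 S2; rewrite -[y1]scale1r; exact: lspanP.
  rewrite (linZ (@qdoa_in_linear K G V n v chi q kappa)).
  by apply: lspan_scale => _; exists (dgrp g); exact: qdoa_deg_grp.
- move=> i x; apply: (lspan_linear (qdoa_mul_linearr _)) => y [b yb].
  apply: lspan_gen; exists (dvar i + b); apply: qdoa_degM => //.
  exact: qdoa_deg_var.
Qed.

Lemma qdoa_is_graded :
  is_graded (@group_deg K G V n v kappa) (qdoa_grbimod v chi q kappa).
Proof.
have [comp [lc cE]] := qdoa_components.
have [sumE direct] := grading_of_projections (@qdoa_deg0 K G V n v chi q kappa)
  (@qdoa_degP K G V n v chi q kappa) lc cE qdoa_deg_span.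
split=> //.
- exact: qdoa_deg0.
- exact: qdoa_degP.
- by move=> a b r x ra xb; apply: qdoa_degM xb; exact: qdoa_in_deg.
- by move=> a b x r xa rb; apply: qdoa_degM xa _; exact: qdoa_in_deg.
Qed.

End OrbifoldGrading.



(** * The quantum Drinfeld orbifold algebra as a color enveloping algebra *)

Section OrbifoldHopf.
Variables (K : fieldType) (G : finZmodType) (V : vectType K) (n : nat).
Variables (v : n.-tuple V) (chi : 'I_n -> lin_char G K).
Variables (q : 'I_n -> 'I_n -> K) (kappa : V -> V -> {ffun G -> V}).
Hypothesis pbw : pbw_property v chi q kappa.
Hypothesis q_system : quantum_system q.
Hypothesis kappa_q : forall i j r g, kappa_coef v kappa i j r g != 0 ->
  forall k, chi k g = q i k * q j k * q k r.

Local Notation H := (qdoa v chi q kappa).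
Local Notation X := (qdoa_var v chi q kappa).
Local Notation In := (qdoa_in v chi q kappa).
Local Notation Ing g := (In (@group_el K G g)).
Local Notation c_ := (kappa_coef v kappa).
Local Notation B := (qdeg v kappa).
Local Notation cls := (qcls v kappa).
Local Notation dvar i := (cls (var_deg G i)).
Local Notation dgrp g := (cls (grp_deg n g)).
Local Notation "x ** y" := (qdoa_mul x y) (at level 40, left associativity).
Local Notation eps := (@quotient_bichar K G V n v chi q kappa).
Local Notation gdeg := (@group_deg K G V n v kappa).

Local Opaque qdoa_mul qdoa_var qdoa_in.

Let kappa_chi := @kappa_char K G V n v chi q kappa pbw.
Let eps_bichar : antisym_bichar eps :=
  quotient_bichar_antisym q_system kappa_chi kappa_q.

(** Induction on how x is built: products use bimultiplicativity, variables use g v_i = chi_i(g) v_i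
    g, and group elements use that G is abelian. *)
Lemma qdoa_grp_comm g b (x : H) : qdoa_deg b x ->
  Ing g ** x = eps (dgrp g) b *: (x ** Ing g).
Proof.
elim=> {b x}.
- move=> b; rewrite (lin0 (qdoa_mul_linearr _)) (lin0 (qdoa_mul_linearl _)).
  by rewrite scaler0.
- by move=> b a x y _ IHx _ IHy; exact: (qdoa_color_comm_lin a IHx IHy).
- move=> a b x y _ IHx _ IHy; rewrite (bicharDr eps_bichar).
  exact: (qdoa_color_comm_mul IHx IHy).
- move=> i; have -> : eps (dgrp g) (dvar i) = chi i g.
    have [_ _ _ ->] := eps_bichar.
    by rewrite (quotient_bichar_var_grp q_system kappa_chi kappa_q) invrK.
  exact: qdoa_grp_var.
move=> h; rewrite (quotient_bichar_grp q_system kappa_chi kappa_q) scale1r.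
apply: (etrans (qdoa_grpM _ _ _ _ g h)); rewrite addrC.
exact: esym (qdoa_grpM _ _ _ _ h g).
Qed.

Lemma qdoa_color_object : color_object gdeg eps (qdoa_grbimod v chi q kappa).
Proof.
split; first exact: qdoa_is_graded.
move=> a b r x ar bx.
have lr : linear (fun r => eps a b *: (x ** In r)).
  apply: linear_scale; apply: (linear_comp (qdoa_mul_linearr x)).
  exact: qdoa_in_linear.
have ll : linear (fun r => In r ** x).
  by apply: (linear_comp (qdoa_mul_linearl x)); exact: qdoa_in_linear.
apply: (lspan_ext ll lr) ar => _ [g [<- ->]].
exact: qdoa_grp_comm.
Qed.

Definition kappa_group (i j r : 'I_n) : group_alg K G := [ffun g => c_ i j r g].

(** The group elements with nonzero coefficient have distinct degrees in A, but N identifies all of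
    them with |v_i| + |v_j| - |v_r|. *)
Lemma kappa_group_deg i j r :
  gdeg (dvar i + dvar j - dvar r) (kappa_group i j r).
Proof.
rewrite (group_alg_sum (kappa_group i j r)); apply: lspan_sum => g.
rewrite ffunE; apply: lspan_scale => c0; exists g; split=> //.
exact: kappa_deg.
Qed.

Lemma group_alg_span (r : group_alg K G) :
  lspan (fun s => exists b : B, gdeg b s) r.
Proof.
rewrite (group_alg_sum r); apply: lspan_sum => g; apply: lspan_scale => _.
by exists (dgrp g); apply: lspan_gen; exists g.
Qed.

Lemma group_deg1 : gdeg 0 1.
Proof.
apply: lspan_gen; exists 0; split=> //.
by rewrite -[grp_deg n _]/(0 : 'rV_n * G) qcls0.
Qed.

Lemma group_degM a b r s : gdeg a r -> gdeg b s -> gdeg (a + b) (r * s).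
Proof.
move=> ar bs.
have ll : linear (fun r : group_alg K G => r * s).
  by move=> c y z; rewrite mulrDl scalerAl.
apply: (lspan_linear ll) ar => _ [g [<- ->]].
have lr : linear (fun s : group_alg K G => group_el K g * s).
  by move=> c y z; rewrite mulrDr scalerAr.
apply: (lspan_linear lr) bs => _ [h [<- ->]].
apply: lspan_gen; exists (g + h); rewrite group_elM; split=> //.
by rewrite grp_degD qclsD.
Qed.

(** [D] and the left KG-action satisfy the hypotheses of [qdoa_lift], and f is x |-> x m0 for the
    resulting action of H. That action commutes with the right KG-action, by induction on x. *)
Lemma qdoa_hlift (M : bimod (group_alg K G)) (D : 'I_n -> M -> M) (m0 : M) :
  hmodule gdeg eps (fun i => dvar i) kappa_group D ->
  (forall r, lact r m0 = ract m0 r) ->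
  exists f : bimap (qdoa_grbimod v chi q kappa) M,
    f (1 : H) = m0 /\ forall i (x : H), f (X i ** x) = D i (f x).
Proof.
move=> [Dlin Dlact Dract Drel] m0r.
have gdeg_el g : gdeg (dgrp g) (group_el K g) by apply: lspan_gen; exists g.
have D_g i g m : lact (group_el K g) (D i m) =
    chi i g *: D i (lact (group_el K g) m).
  rewrite (Dlact _ _ _ _ (gdeg_el g)).
  rewrite (quotient_bichar_var_grp q_system kappa_chi kappa_q) scalerA.
  by rewrite divff ?scale1r // lchar_neq0.
have lsum r (m : M) : lact r m = \sum_g r g *: lact (group_el K g) m.
  rewrite [in LHS](group_alg_sum r) (lin_sum _ xpredT _ (lact_linearl m)).
  by apply: eq_bigr => g _; rewrite (linZ (lact_linearl m)).
have [||||||rep [rl rr rM rX rI]] := @qdoa_lift K G V n v chi q kappa M D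
    (fun g m => lact (group_el K g) m).
- exact: Dlin.
- by move=> g; exact: lact_linear.
- by move=> w; exact: lact1.
- by move=> g h w; rewrite -lactA group_elM.
- by move=> g i w; exact: D_g.
- move=> i j w; rewrite -(quotient_bichar_var q_system kappa_chi kappa_q) Drel.
  rewrite exchange_big; apply: eq_bigr => r _.
  rewrite lsum (lin_sum _ xpredT _ (Dlin r)); apply: eq_bigr => g _.
  by rewrite ffunE (linZ (Dlin r)).
have rMul x y w : rep (x ** y) w = rep x (rep y w) := rM x y w.
have rIn r w : rep (In r) w = lact r w.
  rewrite lsum [in LHS](group_alg_sum r).
  rewrite (lin_sum _ xpredT _ (@qdoa_in_linear K G V n v chi q kappa)).
  rewrite (lin_sum (f := rep^~ w) _ xpredT _ (rl w)); apply: eq_bigr => g _.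
  rewrite (linZ (@qdoa_in_linear K G V n v chi q kappa)) (linZ (rl w)).
  by rewrite rI.
have r1 w : rep 1 w = w.
  by rewrite -qdoa_grp0 rI -[group_el K 0]/(1 : group_alg K G) lact1.
have rR x : forall w r, rep x (ract w r) = ract (rep x w) r.
  move: x; apply: (qdoa_gen_ind pbw).
  - by move=> w r; rewrite !r1.
  - move=> a x y IHx IHy w r.
    by rewrite (rl (ract w r)) IHx IHy (rl w) ractP.
  - by move=> s x IHx w r; rewrite !rMul IHx !rIn lractA.
  - by move=> i x IHx w r; rewrite !rMul IHx !rX Dract.
have fl r (x : qdoa_grbimod v chi q kappa) :
    rep (lact r x) m0 = lact r (rep x m0).
  by rewrite -rIn; exact: rM.
(* Centrality of [m0] enters here: (x r) m0 = x (r m0) = x (m0 r) = (x m0) r. *)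
have fr r (x : qdoa_grbimod v chi q kappa) :
    rep (ract x r) m0 = ract (rep x m0) r.
  by rewrite -rR -m0r -rIn; exact: rM.
exists (@Bimap K _ (qdoa_grbimod v chi q kappa) M (fun x => rep x m0)
  (rl m0) fl fr).
split; first exact: r1.
by move=> i x; rewrite /= rMul rX.
Qed.

Lemma qdoa_mul_var i j :
  X i ** X j - eps (dvar i) (dvar j) *: (X j ** X i) =
  \sum_r X r ** (In (kappa_group i j r) ** 1).
Proof.
rewrite (quotient_bichar_var q_system kappa_chi kappa_q).
apply: (etrans (qdoa_rel_in _ _ _ _ i j)); apply: eq_bigr => r _.
by congr (_ ** _); exact: esym (mulr1 _).
Qed.

Lemma qdoa_braided_hopf : is_braided_hopf chi q eps.
Proof.
pose mul := @qdoa_mul K G V n v chi q kappa.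
have mll y : linear (fun x => mul x y) by exact: qdoa_mul_linearl.
have mlr x : linear (mul x) by exact: qdoa_mul_linearr.
have mA : associative mul by exact: qdoa_mulA.
have m1l : left_id (1 : H) mul by exact: mul1r.
have m1r : right_id (1 : H) mul by exact: mulr1.
have dM a b x y : qdoa_deg a x -> qdoa_deg b y -> qdoa_deg (a + b) (mul x y).
  exact: qdoa_degM.
have [h [hM hI]] := @color_envelope_hopf K (group_alg K G) B gdeg eps
  eps_bichar group_alg_span (qdoa_grbimod v chi q kappa) qdoa_color_object
  (1 : H) mul mll mlr mA m1l m1r (fun r x y => mA (In r) x y)
  (fun r x y => esym (mA x y (In r))) (fun r x y => esym (mA x (In r) y))
  (qdoa_deg1 v chi q kappa) dM
  'I_n X (fun i => dvar i) kappa_group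
  (@qdoa_deg_var K G V n v chi q kappa) kappa_group_deg qdoa_mul_var
  (qdoa_gen_ind pbw) qdoa_hlift (fun b => lspan0 _) (fun b => @lspanP _ _ _)
  group_deg1 group_degM.
exists h; split=> [x y|f]; first exact: hM.
apply: (etrans (hI f)); exact: mulr1.
Qed.

End OrbifoldHopf.

Theorem corollary6p7 (K : fieldType) (charK : [pchar K] =i pred0)
  (G : finZmodType) (V : vectType K)
  (n : nat) (v : n.-tuple V) (v_basis : basis_of fullv v)
  (rho : G -> 'End(V)) (rho_rep : is_rep rho)
  (chi : 'I_n -> lin_char G K)
  (rho_diag : forall (g : G) (i : 'I_n), rho g v`_i = chi i g *: v`_i)
  (q : 'I_n -> 'I_n -> K) (q_system : quantum_system q)
  (kappa : V -> V -> {ffun G -> V}) (kappa_param : parameter_function v q kappa)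
  (pbw : pbw_property v chi q kappa)
  (svc : strong_vanishing v q kappa rho) :
  exists eps : qdeg v kappa -> qdeg v kappa -> K,
    commutation_factor chi q eps /\ is_braided_hopf chi q eps.
Proof.
have v_neq0 (k : 'I_n) : v`_k != 0.
  apply: (free_not0 (basis_free v_basis)).
  by apply: mem_nth; rewrite size_tuple ltn_ord.
(* The strong vanishing condition equates two multiples of the nonzero vector v_k, so it becomes an
   identity of scalars. *)
have kappa_q i j r g : kappa_coef v kappa i j r g != 0 ->
    forall k, chi k g = q i k * q j k * q k r.
  move=> c0 k; have := svc _ _ _ k _ c0; rewrite rho_diag => /eqP.
  rewrite -subr_eq0 -scalerBl scaler_eq0 (negPf (v_neq0 k)) orbF subr_eq0.
  by move/eqP.
exists (@quotient_bichar K G V n v chi q kappa); split.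
  exact: (quotient_bichar_factor q_system (kappa_char pbw) kappa_q).
exact: qdoa_braided_hopf.
Qed.
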